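(* Let $1 \leq p < 2$ and let $S = (\sigma_j + i t_j)$ be a bounded sequence of points in $\mathbb{C}_{1/2}$. (i) If $\sum_j (\sigma_j - 1/2) < \infty$, then there is a non-trivial function in $\mathscr{H}^p$ vanishing on $S$. (ii) If there is a non-trivial function in $\mathscr{H}^p$ vanishing on $S$, then $\sum_j (\sigma_j - 1/2)^{1+\epsilon} < \infty$ for every $\epsilon > 0$. (iii) If $S$ is contained in a cone $\{\sigma + it \in \mathbb{C}_{1/2} : |t - t_0| \leq c(\sigma - 1/2)\}$ for some $t_0 \in \mathbb{R}$ and $c > 0$, then there is a non-trivial function in $\mathscr{H}^p$ vanishing on $S$ if and only if $\sum_j (\sigma_j - 1/2) < \infty$.
   Context: $\mathbb{C}_{1/2} = \{s = \sigma + it : \sigma > 1/2\}$. For $1 \leq p < \infty$, the Hardy space of Dirichlet series $\mathscr{H}^p$ is the closure (completion) of the set of all Dirichlet polynomials $\sum_{n=1}^N a_n n^{-s}$ with respect to the norm \[\left\|\sum_{n=1}^N \frac{a_n}{n^s}\right\|_{\mathscr{H}^p} = \lim_{T \to \infty}\left(\frac{1}{2T} \int_{-T}^T \left|\sum_{n=1}^N \frac{a_n}{n^{it}}\right|^p\,dt\right)^{1/p}.\] Its elements are identified with Dirichlet series defining analytic functions in $\mathbb{C}_{1/2}$. Sequences consist of not necessarily distinct points. A function vanishes on a sequence $S$ if it vanishes at the points of $S$, taking into account multiplicities (a point occurring $k$ times in $S$ is a zero of order at least $k$); non-trivial means not identically zero. *)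

(* Defs.v *)
(* Stdlib's real numbers with Coquelicot. *)
From Stdlib Require Export Reals List.
From Coquelicot Require Export Coquelicot.
Open Scope R_scope.

(* x ^ y for x >= 0 and y > 0.  Stdlib's Rpower 0 y is exp (y * ln 0) = 1,
   since ln 0 = 0 there, hence the separate case. *)
Definition rpow (x y : R) : R := if Rle_dec x 0 then 0 else Rpower x y.

(* n^{-s} = n^{-sigma} e^{-i t log n} for s = sigma + i t and n >= 1. *)
Definition npow_opp (n : nat) (s : C) : C :=
  Cmult (RtoC (Rpower (INR n) (- Re s)))
        (cos (Im s * ln (INR n)), - sin (Im s * ln (INR n))).

Definition in_half_plane (s : C) : Prop := 1 / 2 < Re s.

(* The Dirichlet polynomial \sum_{n=1}^N a_n n^{-s}; the values of [dp_seq]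
   outside {1, ..., N} are irrelevant. *)
Record dirichlet_poly := DirichletPoly { dp_deg : nat; dp_seq : nat -> C }.

Definition dp_coef (P : dirichlet_poly) (n : nat) : C :=
  if andb (Nat.leb 1 n) (Nat.leb n (dp_deg P)) then dp_seq P n else RtoC 0.

Definition dp_eval (P : dirichlet_poly) (s : C) : C :=
  sum_n_m (fun n => Cmult (dp_coef P n) (npow_opp n s)) 1 (dp_deg P).

Definition dp_minus (P Q : dirichlet_poly) : dirichlet_poly :=
  DirichletPoly (Nat.max (dp_deg P) (dp_deg Q))
    (fun n => Cminus (dp_coef P n) (dp_coef Q n)).

Definition Hp_norm (p : R) (P : dirichlet_poly) : R :=
  real (Lim (fun T => rpow (/ (2 * T) *
                            RInt (fun t => rpow (Cmod (dp_eval P (0, t))) p)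
                                 (- T) T)
                           (/ p))
            p_infty).

Definition Hp_cauchy (p : R) (P : nat -> dirichlet_poly) : Prop :=
  forall eps : R, 0 < eps -> exists K : nat, forall k l : nat,
    (K <= k)%nat -> (K <= l)%nat -> Hp_norm p (dp_minus (P k) (P l)) < eps.

(* The coefficients of an element of the completion: each a_n is a continuous
   functional for the norm, so that it extends to the completion, where the
   class of a Cauchy sequence (P_k) gets the limits of the coefficients of the
   P_k, and these determine the class.  The index n starts at 1. *)
Definition Hp_series (p : R) (a : nat -> C) : Prop :=
  exists P : nat -> dirichlet_poly, Hp_cauchy p P /\
    forall n : nat, (1 <= n)%nat ->
      filterlim (fun k => dp_coef (P k) n) eventually (locally (a n)).

(* Only the values of f in the half-plane matter. *)
Definition in_Hp (p : R) (f : C -> C) : Prop :=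
  exists a : nat -> C, Hp_series p a /\
    forall s : C, in_half_plane s ->
      is_series (fun n => Cmult (a (S n)) (npow_opp (S n) s)) (f s).

Definition nontrivial (f : C -> C) : Prop :=
  exists s : C, in_half_plane s /\ f s <> RtoC 0.

(* f, f', ..., f^(k-1) vanish at s.  C_derive takes its limit along the real
   direction; it is the complex derivative wherever that exists
   (is_C_derive_unique), hence on the half-plane for the analytic f used here. *)
Definition zero_of_order_ge (f : C -> C) (s : C) (k : nat) : Prop :=
  forall i : nat, (i < k)%nat -> Nat.iter i C_derive f s = RtoC 0.

(* Finite or infinite sequences of points: None stands for the absence of a
   point, so that finite sequences end with a tail of None. *)
Definition point_seq := nat -> option C.

Definition all_points (Z : point_seq) (A : C -> Prop) : Prop :=
  forall (j : nat) (s : C), Z j = Some s -> A s.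

Definition bounded_points (Z : point_seq) : Prop :=
  exists M : R, all_points Z (fun s => Cmod s <= M).

(* Convergence of \sum_j w(s_j), over the points s_j of the sequence. *)
Definition ex_sum_over (Z : point_seq) (w : C -> R) : Prop :=
  ex_series (fun j => match Z j with Some s => w s | None => 0 end).

(* js lists k = length js distinct indices at which s occurs. *)
Definition vanishes_on (f : C -> C) (Z : point_seq) : Prop :=
  forall (s : C) (js : list nat),
    NoDup js -> (forall j : nat, In j js -> Z j = Some s) ->
    zero_of_order_ge f s (length js).

Definition Hp_zero_seq (p : R) (Z : point_seq) : Prop :=
  exists f : C -> C, in_Hp p f /\ nontrivial f /\ vanishes_on f Z.

Definition in_cone (t0 c : R) (s : C) : Prop :=
  in_half_plane s /\ Rabs (Im s - t0) <= c * (Re s - 1 / 2).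

(* Main.v *)
Require Import Defs.
From Stdlib Require Import PeanoNat Wf_nat Factorial Lra Lia Classical ClassicalEpsilon FunctionalExtensionality.

(** Write x = Re s - 1/2 for the distance of s to the boundary line.

    Existence of f when the sum of the x_j converges. The coefficients can be taken square-summable, because
    the norm of H^p is at most that of H^2 (L2_in_Hp). A sequence (a_n) gives a function vanishing on the points
    if and only if it is orthogonal to all sequences (ln n)^i n^{-s_j}, where i is less than the multiplicity of
    s_j. These sequences are n^{-1/2} h(ln n) for exponential polynomials h with exponents s_j - 1/2. On
    [0, oo) the integral of |h|^2 is an explicit sum of squares (energy), obtained from the factorisation of a
    Blaschke product: the equation (D + lam) h = (D - conj lam) H removes one exponent at a time. This
    yields bounds for h and h' in which the exponents enter only through their maximal modulus and the sum of
    their real parts, and that sum is finite by hypothesis. Hence for a fixed large N the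
    integral is comparable with its Riemann sum over the points ln n with n >= N, and the value of h at ln 1 is
    controlled by these samples, uniformly in the number of points used (sample_bound). So the first unit
    vector has positive distance from the span, and an orthogonal vector exists (orthogonal_vector).

    Necessity. Point evaluation on Dirichlet polynomials is bounded by a multiple of (1 + 1 / x) times the
    norm (point_eval). Indeed, if K(t) denotes the product over the primes p <= N of
    1 / (1 - conj(p^{-s}) p^{-it}), the function conj(K) / K is unimodular, and the mean of P conj(K) / K is
    P(s) times the product of the 1 - p^{-2 sigma}; finitely many terms of the geometric series are enough, so
    all means are means of trigonometric polynomials. Therefore f is a locally uniform limit of
    Dirichlet polynomials with |f| at most a multiple of 1 + 1 / x (Hp_function).
    For such f, Jensen's inequality (jensen) on discs tangent to the line x = delta bounds the sum of the x_j
    with x_j >= 2 delta by a constant plus a multiple of ln (1 / delta) (far_sum_log), and dyadic summation gives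
    the exponent 1 + eps (necessity_eps). If the points lie in a cone with vertex b, a disc tangent to the boundary
    line at b contains them; there f times (s - b)^2 is bounded, and Jensen's inequality gives the
    convergence of the sum of the x_j (necessity_cone).

    The function theory is that of the uniform closure of the polynomials on a closed disc. Its maximum
    principle (A_max) comes from the mean of p(z) times a truncated Cauchy kernel and from passing to
    powers; division by z - z_0 (A_div) and the derivative (A_derive) follow from it. *)

(** * Complex sums, limits and the exponential *)

Fixpoint csum (u : nat -> C) (n : nat) : C :=
  match n with O => RtoC 0 | S m => Cplus (csum u m) (u m) end.

Fixpoint rsum (u : nat -> R) (n : nat) : R :=
  match n with O => 0 | S m => rsum u m + u m end.

Definition clim (u : nat -> C) (l : C) : Prop :=
  forall eps, 0 < eps -> exists N, forall n, (N <= n)%nat -> Cmod (u n - l) < eps.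

Lemma C_ext (a b : C) : Re a = Re b -> Im a = Im b -> a = b.
Proof. destruct a, b; simpl; intros -> ->; reflexivity. Qed.

Ltac csolve := apply C_ext; simpl; try ring; try field.

Lemma Cmod_sqr (z : C) : Cmod z * Cmod z = Re z * Re z + Im z * Im z.
Proof. pose proof (Cmod2_alt z) as H. simpl in H. nra. Qed.

Lemma Cmod_le_sum (z : C) : Cmod z <= Rabs (Re z) + Rabs (Im z).
Proof.
  pose proof (Cmod_sqr z); pose proof (Cmod_ge_0 z).
  pose proof (Rabs_pos (Re z)); pose proof (Rabs_pos (Im z)).
  assert (Rabs (Re z) * Rabs (Re z) = Re z * Re z) by (rewrite <- Rabs_mult; apply Rabs_pos_eq; nra).
  assert (Rabs (Im z) * Rabs (Im z) = Im z * Im z) by (rewrite <- Rabs_mult; apply Rabs_pos_eq; nra).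
  nra.
Qed.

Lemma Re_le_Cmod (z : C) : Rabs (Re z) <= Cmod z.
Proof. apply re_le_Cmod. Qed.

Lemma Im_le_Cmod (z : C) : Rabs (Im z) <= Cmod z.
Proof.
  pose proof (Rmax_Cmod z). pose proof (Rmax_r (Rabs (fst z)) (Rabs (snd z))).
  unfold Im. lra.
Qed.

Lemma Cmod_minus_sym (a b : C) : Cmod (a - b) = Cmod (b - a).
Proof. rewrite <- Cmod_opp. f_equal. ring. Qed.

Lemma Cmod_tri_minus (a b : C) : Cmod (a - b) <= Cmod a + Cmod b.
Proof. unfold Cminus. rewrite <- (Cmod_opp b). apply Cmod_triangle. Qed.

Lemma Cmod_tri_rev (a b : C) : Cmod a - Cmod b <= Cmod (a - b).
Proof.
  pose proof (Cmod_triangle (a - b) b).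
  replace (a - b + b)%C with a in H by ring. lra.
Qed.

Lemma Cmod_tri3 (a b c : C) : Cmod (a - c) <= Cmod (a - b) + Cmod (b - c).
Proof. replace (a - c)%C with ((a - b) + (b - c))%C by ring. apply Cmod_triangle. Qed.

Lemma Cmod_small_0 (z : C) : (forall eps, 0 < eps -> Cmod z <= eps) -> z = RtoC 0.
Proof.
  intros H. apply Cmod_eq_0. pose proof (Cmod_ge_0 z).
  destruct (Rle_lt_dec (Cmod z) 0) as [h|h]; [lra|].
  specialize (H (Cmod z / 2)). lra.
Qed.

Lemma le_eps (a b : R) : (forall eps, 0 < eps -> a <= b + eps) -> a <= b.
Proof.
  intros H. destruct (Rle_lt_dec a b) as [h|h]; [exact h|].
  specialize (H ((a - b) / 2)). lra.
Qed.

Lemma csum_ext (u v : nat -> C) n : (forall k, (k < n)%nat -> u k = v k) -> csum u n = csum v n.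
Proof. induction n; simpl; intros H; [reflexivity|]. rewrite IHn, H; auto. Qed.

Lemma rsum_ext (u v : nat -> R) n : (forall k, (k < n)%nat -> u k = v k) -> rsum u n = rsum v n.
Proof. induction n; simpl; intros H; [reflexivity|]. rewrite IHn, H; auto. Qed.

Lemma rsum_le (u v : nat -> R) n : (forall k, (k < n)%nat -> u k <= v k) -> rsum u n <= rsum v n.
Proof.
  induction n; simpl; intros H; [lra|].
  pose proof (H n (Nat.lt_succ_diag_r n)).
  assert (rsum u n <= rsum v n) by (apply IHn; intros; apply H; lia). lra.
Qed.

Lemma rsum_pos (u : nat -> R) n : (forall k, 0 <= u k) -> 0 <= rsum u n.
Proof. induction n; simpl; intros H; [lra|]. specialize (IHn H). specialize (H n). lra. Qed.

Lemma rsum_mono (u : nat -> R) n m : (forall k, 0 <= u k) -> (n <= m)%nat -> rsum u n <= rsum u m.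
Proof. intros H h. induction h; simpl; [lra|]. specialize (H m). lra. Qed.

Lemma rsum_scal (c : R) (u : nat -> R) n : rsum (fun k => c * u k) n = c * rsum u n.
Proof. induction n; simpl; [ring|]. rewrite IHn. ring. Qed.

Lemma rsum_plus (u v : nat -> R) n : rsum (fun k => u k + v k) n = rsum u n + rsum v n.
Proof. induction n; simpl; [ring|]. rewrite IHn. ring. Qed.

Lemma csum_plus (u v : nat -> C) n : csum (fun k => u k + v k)%C n = (csum u n + csum v n)%C.
Proof. induction n; simpl; [ring|]. rewrite IHn. ring. Qed.

Lemma csum_minus (u v : nat -> C) n : csum (fun k => u k - v k)%C n = (csum u n - csum v n)%C.
Proof. induction n; simpl; [ring|]. rewrite IHn. ring. Qed.

Lemma csum_scal (c : C) (u : nat -> C) n : csum (fun k => c * u k)%C n = (c * csum u n)%C.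
Proof. induction n; simpl; [ring|]. rewrite IHn. ring. Qed.

Lemma csum_0 n : csum (fun _ => RtoC 0) n = RtoC 0.
Proof. induction n; simpl; [reflexivity|]. rewrite IHn. ring. Qed.

Lemma Re_csum (u : nat -> C) n : Re (csum u n) = rsum (fun k => Re (u k)) n.
Proof. induction n; simpl; [reflexivity|]. rewrite <- IHn. reflexivity. Qed.

Lemma Cmod_csum (u : nat -> C) n : Cmod (csum u n) <= rsum (fun k => Cmod (u k)) n.
Proof.
  induction n; simpl; [rewrite Cmod_0; lra|].
  pose proof (Cmod_triangle (csum u n) (u n)). lra.
Qed.

Lemma Cmod_csum_le (u : nat -> C) (v : nat -> R) n :
  (forall k, (k < n)%nat -> Cmod (u k) <= v k) -> Cmod (csum u n) <= rsum v n.
Proof. intros H. eapply Rle_trans; [apply Cmod_csum|]. apply rsum_le, H. Qed.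

Lemma csum_tail (u : nat -> C) (v : nat -> R) n m : (n <= m)%nat ->
  (forall k, (n <= k)%nat -> Cmod (u k) <= v k) ->
  Cmod (csum u m - csum u n) <= rsum v m - rsum v n.
Proof.
  intros h H. induction h.
  - replace (csum u n - csum u n)%C with (RtoC 0) by ring. rewrite Cmod_0. lra.
  - simpl. replace (csum u m + u m - csum u n)%C with ((csum u m - csum u n) + u m)%C by ring.
    pose proof (Cmod_triangle (csum u m - csum u n) (u m)). specialize (H m h). lra.
Qed.

Lemma clim_unique u l l' : clim u l -> clim u l' -> l = l'.
Proof.
  intros H H'. assert (l - l' = RtoC 0)%C as h.
  { apply Cmod_small_0. intros eps he.
    destruct (H (eps/2)) as [N1 h1]; [lra|]. destruct (H' (eps/2)) as [N2 h2]; [lra|].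
    specialize (h1 (max N1 N2) ltac:(lia)). specialize (h2 (max N1 N2) ltac:(lia)).
    pose proof (Cmod_tri3 l (u (max N1 N2)) l'). rewrite (Cmod_minus_sym l (u _)) in H0. lra. }
  replace l with ((l - l') + l')%C by ring. rewrite h. ring.
Qed.

Lemma clim_ext u v l : (forall n, u n = v n) -> clim u l -> clim v l.
Proof. intros E H eps he. destruct (H eps he) as [N h]. exists N. intros. rewrite <- E. auto. Qed.

Lemma clim_const c : clim (fun _ => c) c.
Proof. intros eps he. exists O. intros. replace (c - c)%C with (RtoC 0) by ring. rewrite Cmod_0; auto. Qed.

Lemma clim_plus u v l l' : clim u l -> clim v l' -> clim (fun n => u n + v n)%C (l + l')%C.
Proof.
  intros H H' eps he. destruct (H (eps/2)) as [N1 h1]; [lra|]. destruct (H' (eps/2)) as [N2 h2]; [lra|].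
  exists (max N1 N2). intros n hn. specialize (h1 n ltac:(lia)). specialize (h2 n ltac:(lia)).
  replace (u n + v n - (l + l'))%C with ((u n - l) + (v n - l'))%C by ring.
  pose proof (Cmod_triangle (u n - l) (v n - l')). lra.
Qed.

Lemma clim_scal c u l : clim u l -> clim (fun n => c * u n)%C (c * l)%C.
Proof.
  intros H eps he. pose proof (Cmod_ge_0 c).
  destruct (H (eps / (Cmod c + 1))) as [N h]; [apply Rdiv_lt_0_compat; lra|].
  exists N. intros n hn. specialize (h n hn).
  replace (c * u n - c * l)%C with (c * (u n - l))%C by ring. rewrite Cmod_mult.
  apply Rle_lt_trans with ((Cmod c + 1) * Cmod (u n - l)).
  - pose proof (Cmod_ge_0 (u n - l)). nra.
  - replace eps with ((Cmod c + 1) * (eps / (Cmod c + 1))) by (field; lra).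
    apply Rmult_lt_compat_l; lra.
Qed.

Lemma clim_le u l B : clim u l -> (exists N, forall n, (N <= n)%nat -> Cmod (u n) <= B) -> Cmod l <= B.
Proof.
  intros H [N hB]. apply le_eps. intros eps he. destruct (H eps he) as [N' h].
  specialize (h (max N N') ltac:(lia)). specialize (hB (max N N') ltac:(lia)).
  pose proof (Cmod_tri_rev l (u (max N N'))). rewrite Cmod_minus_sym in H0. lra.
Qed.

Lemma clim_cauchy u :
  (forall eps, 0 < eps -> exists N, forall n m, (N <= n)%nat -> (N <= m)%nat -> Cmod (u n - u m) < eps) ->
  exists l, clim u l.
Proof.
  intros H.
  assert (forall g : C -> R, (forall a b, Rabs (g a - g b) <= Cmod (a - b)) -> exists l, is_lim_seq (fun n => g (u n)) (Finite l)) as K.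
  { intros g hg. destruct (ex_lim_seq_cauchy_corr (fun n => g (u n))) as [_ K].
    destruct K as [l hl].
    - intros eps. destruct (H eps (cond_pos eps)) as [N h]. exists N. intros.
      eapply Rle_lt_trans; [apply hg|]. auto.
    - exists l. exact hl. }
  destruct (K Re) as [x hx].
  { intros a b. eapply Rle_trans; [|apply Re_le_Cmod]. apply Req_le. reflexivity. }
  destruct (K Im) as [y hy].
  { intros a b. eapply Rle_trans; [|apply Im_le_Cmod]. apply Req_le. reflexivity. }
  exists (x, y). intros eps he.
  apply is_lim_seq_spec in hx. apply is_lim_seq_spec in hy. simpl in hx, hy.
  assert (0 < eps / 2) as he2 by lra.
  destruct (hx (mkposreal _ he2)) as [N1 h1]. destruct (hy (mkposreal _ he2)) as [N2 h2].
  exists (max N1 N2). intros n hn. specialize (h1 n ltac:(lia)). specialize (h2 n ltac:(lia)). simpl in h1, h2.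
  eapply Rle_lt_trans; [apply Cmod_le_sum|]. simpl.
  unfold Re, Im, Rminus in *. lra.
Qed.

Lemma csum_cauchy (u : nat -> C) (v : nat -> R) (L : R) :
  (forall k, Cmod (u k) <= v k) -> (forall n, rsum v n <= L) -> exists l, clim (csum u) l.
Proof.
  intros H B.
  assert (forall k, 0 <= v k) as hv by (intros k; eapply Rle_trans; [apply Cmod_ge_0|apply H]).
  destruct (ex_finite_lim_seq_incr (rsum v) L) as [l hl].
  { intros n; simpl. specialize (hv n). lra. }
  { exact B. }
  apply clim_cauchy. intros eps he. apply is_lim_seq_spec in hl. simpl in hl.
  assert (0 < eps / 2) as he2 by lra.
  destruct (hl (mkposreal _ he2)) as [N h]. exists N. simpl in h.
  assert (forall n m, (N <= n)%nat -> (n <= m)%nat -> Cmod (csum u m - csum u n) < eps) as K.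
  { intros n m hn hm. eapply Rle_lt_trans; [apply (csum_tail u v n m hm)|].
    - intros; apply H.
    - pose proof (h n hn). pose proof (h m ltac:(lia)). apply Rabs_def2 in H0, H1. lra. }
  intros n m hn hm. destruct (Nat.le_gt_cases n m).
  - rewrite Cmod_minus_sym. apply K; lia.
  - apply K; lia.
Qed.

Lemma clim_tail (u : nat -> C) (v : nat -> R) (l : C) (L : R) N :
  (forall k, (N <= k)%nat -> Cmod (u k) <= v k) -> (forall n, (N <= n)%nat -> rsum v n - rsum v N <= L) -> clim (csum u) l ->
  Cmod (l - csum u N) <= L.
Proof.
  intros H B Hl. apply clim_le with (u := fun n => (csum u n - csum u N)%C).
  - apply (clim_plus _ (fun _ => - csum u N)%C); [exact Hl|apply clim_const].
  - exists N. intros n hn. eapply Rle_trans; [apply (csum_tail u v N n hn)|apply B, hn].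
    intros; apply H; auto.
Qed.

Lemma is_series_clim (u : nat -> C) (l : C) : is_series u l <-> clim (csum u) l.
Proof.
  assert (forall n, sum_n u n = csum u (S n)) as E.
  { induction n.
    - rewrite sum_O. simpl. change (u O = 0 + u O)%C. ring.
    - rewrite sum_Sn, IHn. reflexivity. }
  unfold is_series. split.
  - intros H eps he. apply filterlim_locally_ball_norm with (eps := mkposreal _ he) in H.
    destruct H as [N h]. exists (S N). intros n hn. destruct n; [lia|].
    specialize (h n ltac:(lia)). unfold ball_norm in h. rewrite E in h. exact h.
  - intros H. apply filterlim_locally_ball_norm. intros eps. destruct (H eps (cond_pos eps)) as [N h].
    exists N. intros n hn. unfold ball_norm. rewrite E. apply h. lia.
Qed.

Lemma clim_filterlim (u : nat -> C) (l : C) :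
  filterlim u eventually (@locally C_UniformSpace l) <-> clim u l.
Proof.
  split.
  - intros H eps he.
    assert (filterlim u eventually (locally (l : C_NormedModule))) as H' by exact H.
    apply filterlim_locally_ball_norm with (eps := mkposreal _ he) in H'. exact H'.
  - intros H.
    assert (filterlim u eventually (locally (l : C_NormedModule))) as H'; [|exact H'].
    apply filterlim_locally_ball_norm. intros eps. exact (H eps (cond_pos eps)).
Qed.

Definition Cexp (z : C) : C := (exp (Re z) * cos (Im z), exp (Re z) * sin (Im z)).

Lemma Cexp_add a b : Cexp (a + b) = (Cexp a * Cexp b)%C.
Proof.
  destruct a as [x y], b as [x' y']. unfold Cexp; simpl.
  rewrite exp_plus, cos_plus, sin_plus. csolve.
Qed.

Lemma Cexp_0 : Cexp 0 = 1.
Proof. unfold Cexp; simpl. rewrite exp_0, cos_0, sin_0. csolve. Qed.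

Lemma Cmod_Cexp z : Cmod (Cexp z) = exp (Re z).
Proof.
  pose proof (exp_pos (Re z)). pose proof (Cmod_ge_0 (Cexp z)).
  pose proof (Cmod_sqr (Cexp z)). unfold Cexp in H1 at 3 4 5 6; simpl in H1.
  pose proof (sin2_cos2 (Im z)). unfold Rsqr in H2.
  assert (Cmod (Cexp z) * Cmod (Cexp z) = exp (Re z) * exp (Re z)).
  { rewrite H1. transitivity (exp (Re z) * exp (Re z) * (sin (Im z) * sin (Im z) + cos (Im z) * cos (Im z))); [ring|].
    rewrite H2. ring. }
  nra.
Qed.

Lemma npow_opp_exp n s : npow_opp n s = Cexp (RtoC (- ln (INR n)) * s).
Proof.
  destruct s as [x t]. unfold npow_opp, Cexp, Rpower; simpl.
  replace (- ln (INR n) * x - 0 * t) with (- x * ln (INR n)) by ring.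
  replace (- ln (INR n) * t + 0 * x) with (- (t * ln (INR n))) by ring.
  rewrite cos_neg, sin_neg. csolve.
Qed.

Lemma sin_le_abs (y : R) : Rabs (sin y) <= Rabs y.
Proof.
  assert (forall y, 0 <= y -> Rabs (sin y) <= y) as K.
  { intros t ht. destruct (Rle_lt_or_eq_dec 0 t ht) as [h|h].
    - destruct (Rle_lt_dec t 1).
      + pose proof (sin_lt_x t h). pose proof PI_4. pose proof PI2_3_2. pose proof (sin_ge_0 t ltac:(lra)).
        assert (0 <= sin t) by (apply sin_ge_0; unfold PI2 in *; lra).
        rewrite Rabs_pos_eq; lra.
      + pose proof (SIN_bound t). apply Rabs_le. lra.
    - subst. rewrite sin_0, Rabs_R0. lra. }
  destruct (Rle_lt_dec 0 y).
  - rewrite (Rabs_pos_eq y) by auto. apply K; auto.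
  - rewrite (Rabs_left y) by auto. replace y with (- - y) at 1 by ring.
    rewrite sin_neg, Rabs_Ropp. apply K. lra.
Qed.

Lemma cos_1_bound (y : R) : 0 <= 1 - cos y <= y * y / 2.
Proof.
  pose proof (COS_bound y). split; [lra|].
  pose proof (cos_2a_sin (y / 2)). replace (2 * (y / 2)) with y in H0 by field.
  pose proof (sin_le_abs (y/2)).
  assert (sin (y/2) * sin (y/2) <= y/2 * (y/2)).
  { apply Rsqr_le_abs_1 in H1. exact H1. }
  rewrite H0. nra.
Qed.

Lemma sin_quad (y : R) : Rabs (sin y - y) <= y * y.
Proof.
  assert (forall y, 0 <= y -> Rabs (sin y - y) <= y * y) as K.
  { intros t ht. destruct (Rle_lt_dec t 1).
    - assert (0 <= t <= 4) as h4 by lra.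
      pose proof (pre_sin_bound t 0 ltac:(lra) ltac:(lra)) as [h1 h2].
      clear h2. unfold sin_approx, sin_term in h1; simpl in h1.
      assert (sin t <= t) by (pose proof (sin_le_abs t) as h2; rewrite (Rabs_pos_eq t ht) in h2; apply Rabs_le_between in h2; lra).
      assert (t * t * t <= t * t) by nra.
      apply Rabs_le. split; [|nra].
      assert (1 * (t * 1 / 1) + -1 * 1 * (t * (t * (t * 1)) / (1 + 1 + 1 + 1 + 1 + 1)) = t - t * t * t / 6) as E by field.
      rewrite E in h1. nra.
    - pose proof (SIN_bound t) as B. assert (t <= t * t) by nra.
      apply Rabs_le. split; [|lra].
      destruct (Rlt_le_dec t 2) as [h|h].
      + pose proof PI2_3_2. unfold PI2 in *. pose proof (sin_ge_0 t ht ltac:(lra)). lra.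
      + assert (2 * t <= t * t) by nra. lra. }
  destruct (Rle_lt_dec 0 y); [apply K; auto|].
  replace y with (- - y) by ring. set (z := - y) in *. rewrite sin_neg.
  replace (- sin z - - z) with (- (sin z - z)) by ring. rewrite Rabs_Ropp.
  replace (- z * - z) with (z * z) by ring. apply K. unfold z; lra.
Qed.

Lemma exp_le_inv_bound (x : R) : exp x - 1 - x <= x * x * exp (Rabs x).
Proof.
  pose proof (exp_ineq1_le (-x)). pose proof (exp_ineq1_le x). pose proof (exp_pos x).
  assert (exp x * exp (-x) = 1) by (rewrite <- exp_plus; replace (x + - x) with 0 by ring; apply exp_0).
  (* exp x (1 - x) <= 1 gives exp x - 1 <= x exp x *)
  assert (exp x - 1 <= x * exp x) by nra.
  destruct (Rle_lt_dec 0 x).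
  - rewrite Rabs_pos_eq by auto.
    assert (x * (exp x - 1) <= x * (x * exp x)) by (apply Rmult_le_compat_l; lra). nra.
  - rewrite Rabs_left by auto.
    assert (1 <= exp (-x)) by lra.
    assert (exp x <= 1) by nra.
    assert (exp x - 1 - x <= x * (exp x - 1)) by nra.
    assert (x * (exp x - 1) <= x * x) by nra.
    assert (x * x * 1 <= x * x * exp (-x)) by (apply Rmult_le_compat_l; nra).
    lra.
Qed.

Lemma Cexp_quad (z : C) : Cmod (Cexp z - 1 - z) <= 4 * (Cmod z * Cmod z) * exp (Cmod z).
Proof.
  destruct z as [x y].
  pose proof (Re_le_Cmod (x, y)) as hx. pose proof (Im_le_Cmod (x, y)) as hy. simpl in hx, hy.
  set (r := Cmod (x, y)) in *.
  assert (0 <= r) by apply Cmod_ge_0.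
  assert (x * x + y * y = r * r) as hr by (unfold r; rewrite Cmod_sqr; reflexivity).
  eapply Rle_trans; [apply Cmod_le_sum|]. simpl.
  pose proof (exp_le_inv_bound x) as e1. pose proof (exp_ineq1_le x) as e2.
  pose proof (cos_1_bound y) as c1. pose proof (sin_quad y) as s1. pose proof (sin_le_abs y) as s2.
  pose proof (exp_pos x). pose proof (COS_bound y). pose proof (SIN_bound y).
  assert (exp (Rabs x) <= exp r) as e3.
  { destruct (Rle_lt_or_eq_dec _ _ hx) as [h|h]; [left; apply exp_increasing; auto|rewrite h; lra]. }
  assert (exp x <= exp (Rabs x)) as e4.
  { destruct (Rle_lt_or_eq_dec _ _ (Rle_abs x)) as [h|h]; [left; apply exp_increasing; auto|rewrite <- h; lra]. }
  assert (1 <= exp r) as e5.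
  { pose proof (exp_ineq1_le r). lra. }
  pose proof (Rabs_pos x). pose proof (Rabs_pos y).
  assert (Rabs (exp x * cos y + - (1) + - x) <= x * x * exp r + y * y / 2 * exp r) as A1.
  { apply Rabs_le.
    replace (exp x * cos y + - (1) + - x) with ((exp x - 1 - x) - exp x * (1 - cos y)) by ring.
    assert (0 <= exp x * (1 - cos y) <= exp r * (y * y / 2)).
    { split; [apply Rmult_le_pos; lra|]. apply Rmult_le_compat; lra. }
    assert (x * x * exp (Rabs x) <= x * x * exp r) by (apply Rmult_le_compat_l; nra).
    assert (0 <= x * x * exp r) by (apply Rmult_le_pos; nra).
    nra. }
  assert (Rabs (exp x * sin y + 0 + - y) <= r * r * exp r + y * y * exp r + 0) as A2.
  { replace (exp x * sin y + 0 + - y) with ((exp x - 1) * sin y + (sin y - y)) by ring.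
    eapply Rle_trans; [apply Rabs_triang|]. rewrite Rabs_mult.
    assert (Rabs (exp x - 1) <= Rabs x * exp r).
    { pose proof (exp_ineq1_le (-x)).
      assert (exp x * exp (-x) = 1) by (rewrite <- exp_plus; replace (x + - x) with 0 by ring; apply exp_0).
      assert (exp x - 1 <= x * exp x) by nra.
      apply Rabs_le. destruct (Rle_lt_dec 0 x).
      - rewrite (Rabs_pos_eq x) in * by auto. nra.
      - rewrite (Rabs_left x) in * by auto. nra. }
    assert (Rabs (exp x - 1) * Rabs (sin y) <= Rabs x * exp r * Rabs y).
    { apply Rmult_le_compat; auto; apply Rabs_pos. }
    assert (Rabs x * Rabs y <= r * r) by nra.
    assert (Rabs x * exp r * Rabs y <= r * r * exp r) by nra.
    assert (y * y <= y * y * exp r) by nra.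
    lra. }
  unfold Rminus. simpl in *.
  replace (exp x * sin y + - 0 + - y) with (exp x * sin y + 0 + - y) by ring.
  assert (x * x * exp r + y * y / 2 * exp r + (r * r * exp r + y * y * exp r + 0) <= 4 * (r * r) * exp r).
  { rewrite <- hr. nra. }
  lra.
Qed.

Lemma Cexp_lin (z : C) : Cmod (Cexp z - 1) <= 5 * Cmod z * exp (2 * Cmod z).
Proof.
  pose proof (Cexp_quad z). pose proof (Cmod_ge_0 z). set (r := Cmod z) in *.
  pose proof (Cmod_triangle (Cexp z - 1 - z) z).
  replace (Cexp z - 1 - z + z)%C with (Cexp z - 1)%C in H1 by ring.
  fold r in H1.
  assert (r * exp r <= exp (2 * r)).
  { replace (2 * r) with (r + r) by ring. rewrite exp_plus. apply Rmult_le_compat_r; [left; apply exp_pos|].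
    pose proof (exp_ineq1_le r). lra. }
  assert (1 <= exp (2 * r)) by (pose proof (exp_ineq1_le (2 * r)); lra).
  assert (4 * (r * r) * exp r <= 4 * r * exp (2 * r)) by nra.
  nra.
Qed.

Lemma CpowS (c : C) n : (c ^ S n = c * c ^ n)%C.
Proof. reflexivity. Qed.

Lemma Cexp_mult_nat (i : nat) (z : C) : Cexp (RtoC (INR i) * z) = (Cexp z ^ i)%C.
Proof.
  induction i.
  - replace (RtoC (INR 0) * z)%C with (RtoC 0) by csolve. apply Cexp_0.
  - rewrite CpowS, <- IHi, <- Cexp_add, S_INR. f_equal. csolve.
Qed.

(** * Mean values of almost periodic functions *)

Definition meanR (u : R -> R) (m : R) : Prop :=
  (forall t, continuous u t) /\ is_lim (fun T => / (2 * T) * RInt u (- T) T) p_infty m.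

Definition mean (u : R -> C) (m : C) : Prop :=
  meanR (fun t => Re (u t)) (Re m) /\ meanR (fun t => Im (u t)) (Im m).

Lemma ex_RInt_cont (u : R -> R) a b : (forall t, continuous u t) -> ex_RInt u a b.
Proof. intros H. apply (ex_RInt_continuous u). intros; apply H. Qed.

Lemma meanR_plus u v m m' : meanR u m -> meanR v m' -> meanR (fun t => u t + v t) (m + m').
Proof.
  intros [cu lu] [cv lv]. split.
  - intros t. apply (continuous_plus (V := R_NormedModule) u v); auto.
  - apply (is_lim_ext (fun T => / (2 * T) * RInt u (- T) T + / (2 * T) * RInt v (- T) T)).
    + intros T. rewrite (RInt_plus (V := R_CompleteNormedModule) u v); try (apply ex_RInt_cont; auto).
      unfold plus; simpl. ring.
    + apply is_lim_plus'; auto.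
Qed.

Lemma meanR_scal c u m : meanR u m -> meanR (fun t => c * u t) (c * m).
Proof.
  intros [cu lu]. split.
  - intros t. apply (continuous_scal_r (V := R_NormedModule) c u); auto.
  - apply (is_lim_ext (fun T => c * (/ (2 * T) * RInt u (- T) T))).
    + intros T. rewrite (RInt_scal (V := R_CompleteNormedModule) u); try (apply ex_RInt_cont; auto).
      unfold scal; simpl; unfold mult; simpl. ring.
    + apply (is_lim_scal_l _ c p_infty m lu).
Qed.

Lemma meanR_ext u v m : (forall t, u t = v t) -> meanR u m -> meanR v m.
Proof. intros E. replace v with u; auto. apply functional_extensionality, E. Qed.

Lemma meanR_const c : meanR (fun _ => c) c.
Proof.
  split.
  - intros t. apply continuous_const.
  - apply (is_lim_ext_loc (fun _ => c)).
    + exists 0. intros T hT. rewrite RInt_const. unfold scal; simpl; unfold mult; simpl. field. lra.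
    + apply is_lim_const.
Qed.

(** The integral over [-T, T] is an increment of the bounded function F. *)
Lemma meanR_derive (F u : R -> R) (B : R) :
  (forall t, is_derive F t (u t)) -> (forall t, continuous u t) -> (forall t, Rabs (F t) <= B) -> meanR u 0.
Proof.
  intros HF Hu HB. split; [exact Hu|].
  apply (is_lim_ext (fun T => / (2 * T) * (F T - F (- T)))).
  - intros T. f_equal. symmetry. apply is_RInt_unique.
    apply (is_RInt_derive (V := R_CompleteNormedModule) F u); intros; auto.
  - apply is_lim_spec. intros eps. simpl.
    exists (B / eps + 1). intros T hT.
    assert (0 <= B) by (eapply Rle_trans; [apply Rabs_pos|apply (HB 0)]).
    pose proof (cond_pos eps) as he.
    assert (0 <= B / eps) by (apply Rdiv_le_0_compat; lra).
    rewrite Rminus_0_r, Rabs_mult. rewrite (Rabs_pos_eq (/ (2 * T))) by (left; apply Rinv_0_lt_compat; lra).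
    pose proof (HB T). pose proof (HB (-T)).
    assert (Rabs (F T - F (-T)) <= 2 * B).
    { unfold Rminus. eapply Rle_trans; [apply Rabs_triang|]. rewrite Rabs_Ropp. lra. }
    apply Rle_lt_trans with (/ (2 * T) * (2 * B)).
    { apply Rmult_le_compat_l; [left; apply Rinv_0_lt_compat; lra|auto]. }
    replace (/ (2 * T) * (2 * B)) with (B / T) by (field; lra).
    apply Rmult_lt_reg_r with T; [lra|]. unfold Rdiv. rewrite Rmult_assoc, Rinv_l, Rmult_1_r by lra.
    assert (B = B / eps * eps) by (field; lra). nra.
Qed.

Lemma mean_ext u v m : (forall t, u t = v t) -> mean u m -> mean v m.
Proof. intros E. replace v with u; auto. apply functional_extensionality, E. Qed.

Lemma mean_plus u v m m' : mean u m -> mean v m' -> mean (fun t => u t + v t)%C (m + m')%C.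
Proof. intros [a b] [c d]. split; simpl; apply meanR_plus; auto. Qed.

Lemma mean_scal c u m : mean u m -> mean (fun t => c * u t)%C (c * m)%C.
Proof.
  intros [a b]. split.
  - apply meanR_ext with (u := fun t => Re c * Re (u t) + (- Im c) * Im (u t)).
    { intros; simpl. unfold Re, Im. ring. }
    replace (Re (c * m)) with (Re c * Re m + (- Im c) * Im m) by (simpl; unfold Re, Im; ring).
    apply meanR_plus; apply meanR_scal; auto.
  - apply meanR_ext with (u := fun t => Re c * Im (u t) + Im c * Re (u t)).
    { intros; simpl. unfold Re, Im. ring. }
    replace (Im (c * m)) with (Re c * Im m + Im c * Re m) by (simpl; unfold Re, Im; ring).
    apply meanR_plus; apply meanR_scal; auto.
Qed.

Lemma mean_const c : mean (fun _ => c) c.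
Proof. split; apply meanR_const. Qed.

Lemma mean_csum (u : nat -> R -> C) (m : nat -> C) n :
  (forall k, (k < n)%nat -> mean (u k) (m k)) -> mean (fun t => csum (fun k => u k t) n) (csum m n).
Proof.
  induction n; intros H; simpl; [apply mean_const|].
  apply mean_plus; auto.
Qed.

Definition chi (lam t : R) : C := Cexp (0, - (lam * t)).

Lemma chi_add a b t : chi (a + b) t = (chi a t * chi b t)%C.
Proof.
  unfold chi. rewrite <- Cexp_add. f_equal. csolve.
Qed.

Lemma chi_0 t : chi 0 t = RtoC 1.
Proof. unfold chi. rewrite <- Cexp_0. f_equal. csolve. Qed.

Lemma Cmod_chi a t : Cmod (chi a t) = 1.
Proof. unfold chi. rewrite Cmod_Cexp. simpl. apply exp_0. Qed.

Lemma chi_conj a t : Cconj (chi a t) = chi (- a) t.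
Proof.
  unfold chi, Cexp; simpl. replace (- (- a * t)) with (- - (a * t)) by ring. rewrite !cos_neg, !sin_neg. csolve.
Qed.

Lemma mean_chi lam : lam <> 0 -> mean (chi lam) (RtoC 0).
Proof.
  intros h. unfold mean, chi, Cexp; simpl. rewrite exp_0.
  assert (forall x, Rabs (x / lam) = Rabs x * / Rabs lam) as K.
  { intros x. unfold Rdiv. rewrite Rabs_mult, Rabs_inv. reflexivity. }
  assert (0 < / Rabs lam) by (apply Rinv_0_lt_compat, Rabs_pos_lt, h).
  split.
  - apply meanR_derive with (F := fun t => sin (lam * t) / lam) (B := / Rabs lam).
    + intros t. auto_derive; auto. rewrite cos_neg. field; auto.
    + intros t. apply (ex_derive_continuous (V := R_NormedModule)). auto_derive; auto.
    + intros t. rewrite K. rewrite <- (Rmult_1_l (/ Rabs lam)) at 2. apply Rmult_le_compat_r; [lra|].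
      apply Rabs_le, SIN_bound.
  - apply meanR_derive with (F := fun t => cos (lam * t) / lam) (B := / Rabs lam).
    + intros t. auto_derive; auto. rewrite sin_neg. field; auto.
    + intros t. apply (ex_derive_continuous (V := R_NormedModule)). auto_derive; auto.
    + intros t. rewrite K. rewrite <- (Rmult_1_l (/ Rabs lam)) at 2. apply Rmult_le_compat_r; [lra|].
      apply Rabs_le, COS_bound.
Qed.

(** Trigonometric polynomials, generated term by term so that statements about means and shifts go by
    induction. *)
Inductive trig (S : R -> Prop) : (R -> C) -> Prop :=
| trig_0 : trig S (fun _ => RtoC 0)
| trig_add c lam u : S lam -> trig S u -> trig S (fun t => u t + c * chi lam t)%C.

Lemma trig_plus S u v : trig S u -> trig S v -> trig S (fun t => u t + v t)%C.
Proof.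
  intros hu hv. induction hv.
  - replace (fun t => u t + 0)%C with u; auto. apply functional_extensionality. intros; ring.
  - replace (fun t => u t + (u0 t + c * chi lam t))%C with (fun t => (u t + u0 t) + c * chi lam t)%C.
    + apply trig_add; auto.
    + apply functional_extensionality. intros; ring.
Qed.

Lemma trig_shift (S S' : R -> Prop) a om u : (forall x, S x -> S' (om + x)) ->
  trig S u -> trig S' (fun t => a * chi om t * u t)%C.
Proof.
  intros h hu. induction hu.
  - replace (fun t => a * chi om t * 0)%C with (fun _ : R => RtoC 0); [apply trig_0|].
    apply functional_extensionality. intros; ring.
  - replace (fun t => a * chi om t * (u t + c * chi lam t))%C
      with (fun t => a * chi om t * u t + (a * c) * chi (om + lam) t)%C.
    + apply trig_add; auto.
    + apply functional_extensionality. intros; rewrite chi_add. ring.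
Qed.

Lemma trig_single (S : R -> Prop) c lam : S lam -> trig S (fun t => c * chi lam t)%C.
Proof.
  intros h. replace (fun t => c * chi lam t)%C with (fun t => 0 + c * chi lam t)%C.
  - apply trig_add; auto. apply trig_0.
  - apply functional_extensionality. intros; ring.
Qed.

Lemma trig_csum (S : R -> Prop) (u : nat -> R -> C) n :
  (forall k, (k < n)%nat -> trig S (u k)) -> trig S (fun t => csum (fun k => u k t) n).
Proof.
  induction n; intros h; simpl; [apply trig_0|].
  apply (trig_plus S (fun t => csum (fun k => u k t) n)); auto.
Qed.

Lemma trig_mean_0 (S : R -> Prop) u : (forall x, S x -> x <> 0) -> trig S u -> mean u (RtoC 0).
Proof.
  intros h hu. induction hu.
  - apply mean_const.
  - replace (RtoC 0) with (0 + c * 0)%C by ring. apply mean_plus; auto.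
    apply mean_scal, mean_chi. auto.
Qed.

Lemma trig_mean_ex (S : R -> Prop) u : trig S u -> exists m, mean u m.
Proof.
  intros hu. induction hu as [|c lam u hl hu [m hm]].
  - exists (RtoC 0). apply mean_const.
  - destruct (Req_dec lam 0) as [e|e].
    + exists (m + c * 1)%C. apply mean_plus; auto.
      apply mean_scal. apply mean_ext with (u := fun _ => RtoC 1); [|apply mean_const].
      intros t. subst. rewrite chi_0. auto.
    + exists (m + c * 0)%C. apply mean_plus; auto. apply mean_scal, mean_chi, e.
Qed.

(** The average of Re (th u) tends to |m| for the rotation th that makes th m positive, and it is at most the
    average of v. *)
Lemma mean_le (u : R -> C) (m : C) (v : R -> R) (mu : R) :
  mean u m -> (forall t, continuous v t) -> (forall t, Cmod (u t) <= v t) -> mu < Cmod m ->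
  exists T0, forall T, T0 < T -> 0 < T /\ mu < / (2 * T) * RInt v (- T) T.
Proof.
  intros H cv hv hmu.
  assert (exists th, Cmod th <= 1 /\ Re (th * m)%C = Cmod m) as [th [h1 h2]].
  { destruct (Req_dec (Cmod m) 0) as [e|e].
    - exists (RtoC 0). rewrite Cmod_0, e. split; [lra|]. simpl; ring.
    - exists (Cconj m / Cmod m)%C.
      assert (RtoC (Cmod m) <> 0) as ne.
      { intros K. apply e. apply (f_equal fst) in K. exact K. }
      rewrite Cmod_div, Cmod_conj, Cmod_R, Rabs_pos_eq by (auto; apply Cmod_ge_0). split.
      + right. field. auto.
      + unfold Cdiv. replace (Cconj m * / Cmod m * m)%C with (m * Cconj m * / Cmod m)%C by ring.
        rewrite <- Cmod2_conj.
        replace ((Cmod m ^ 2)%R : C) with (RtoC (Cmod m) * RtoC (Cmod m))%C by csolve.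
        replace (RtoC (Cmod m) * RtoC (Cmod m) * / RtoC (Cmod m))%C with (RtoC (Cmod m)) by (field; auto).
        reflexivity. }
  destruct (mean_scal th u m H) as [[cu lu] _]. rewrite h2 in lu.
  apply is_lim_spec in lu. simpl in lu.
  assert (0 < Cmod m - mu) as hp by lra.
  destruct (lu (mkposreal _ hp)) as [T0 K]. simpl in K.
  exists (Rmax T0 0). intros T hT. pose proof (Rmax_l T0 0). pose proof (Rmax_r T0 0).
  split; [lra|]. specialize (K T ltac:(lra)). apply Rabs_def2 in K.
  assert (/ (2 * T) * RInt (fun t => fst th * fst (u t) - snd th * snd (u t)) (- T) T <= / (2 * T) * RInt v (- T) T); [|lra].
  apply Rmult_le_compat_l; [left; apply Rinv_0_lt_compat; lra|].
  apply RInt_le; try (apply ex_RInt_cont; auto); [lra|].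
  intros x _. change (Re (th * u x)%C <= v x). eapply Rle_trans; [apply Rle_abs|]. eapply Rle_trans; [apply Re_le_Cmod|].
  rewrite Cmod_mult. pose proof (hv x). pose proof (Cmod_ge_0 (u x)).
  assert (0 <= (1 - Cmod th) * Cmod (u x)) by (apply Rmult_le_pos; lra). lra.
Qed.

(** * The norm of a Dirichlet polynomial *)

Definition lnS (n : nat) : R := ln (INR (S n)).

Definition dsum (a : nat -> C) (N : nat) (s : C) : C := csum (fun n => a n * Cexp (RtoC (- lnS n) * s))%C N.

Definition sqsum (a : nat -> C) (N : nat) : R := rsum (fun n => Cmod (a n) * Cmod (a n)) N.

Lemma dp_eval_dsum P s : dp_eval P s = dsum (fun n => dp_coef P (S n)) (dp_deg P) s.
Proof.
  unfold dp_eval, dsum.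
  assert (forall N (u : nat -> C), sum_n_m u 1 N = csum (fun n => u (S n)) N) as E.
  { intros N u. induction N.
    - rewrite sum_n_m_zero by lia. reflexivity.
    - rewrite sum_n_Sm by lia. rewrite IHN. reflexivity. }
  rewrite E. apply csum_ext. intros k _. rewrite npow_opp_exp. reflexivity.
Qed.

Lemma INR_S_pos n : 0 < INR (S n).
Proof. rewrite S_INR. pose proof (pos_INR n). lra. Qed.

Lemma lnS_inj n m : lnS n = lnS m -> n = m.
Proof. intros H. apply ln_inv in H; try apply INR_S_pos. apply INR_eq in H. lia. Qed.

Lemma lnS_pos n : 0 <= lnS n.
Proof.
  unfold lnS. rewrite <- ln_1. apply ln_le; [lra|]. rewrite S_INR. pose proof (pos_INR n). lra.
Qed.

Lemma Cexp_lnS n t : Cexp (RtoC (- lnS n) * (0, t)) = chi (lnS n) t.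
Proof. unfold chi. f_equal. csolve. Qed.

Lemma dsum_axis a N t : dsum a N (0, t) = csum (fun n => a n * chi (lnS n) t)%C N.
Proof. apply csum_ext. intros. rewrite Cexp_lnS. auto. Qed.

Lemma trig_dsum a N :
  trig (fun x => exists n, (n < N)%nat /\ x = lnS n) (fun t => csum (fun n => a n * chi (lnS n) t)%C N).
Proof.
  apply (trig_csum _ (fun n t => a n * chi (lnS n) t)%C). intros k hk. apply trig_single. eauto.
Qed.

Lemma dsum_cont_Re a N t : continuous (fun t => Re (dsum a N (0, t))) t.
Proof.
  destruct (trig_mean_ex _ _ (trig_dsum a N)) as [m [[H _] _]].
  apply (continuous_ext (fun t => Re (csum (fun n : nat => a n * chi (lnS n) t)%C N))); auto.
  intros. now rewrite dsum_axis.
Qed.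

Lemma dsum_cont_Im a N t : continuous (fun t => Im (dsum a N (0, t))) t.
Proof.
  destruct (trig_mean_ex _ _ (trig_dsum a N)) as [m [_ [H _]]].
  apply (continuous_ext (fun t => Im (csum (fun n : nat => a n * chi (lnS n) t)%C N))); auto.
  intros. now rewrite dsum_axis.
Qed.

Lemma dsum_cont_Cmod a N t : continuous (fun t => Cmod (dsum a N (0, t))) t.
Proof.
  unfold Cmod.
  apply (continuous_comp (fun t => fst (dsum a N (0, t)) ^ 2 + snd (dsum a N (0, t)) ^ 2) sqrt); [|apply continuous_sqrt].
  simpl.
  apply (continuous_plus (V := R_NormedModule)).
  - apply (continuous_mult (K := R_AbsRing)); [apply dsum_cont_Re|].
    apply (continuous_mult (K := R_AbsRing)); [apply dsum_cont_Re|apply continuous_const].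
  - apply (continuous_mult (K := R_AbsRing)); [apply dsum_cont_Im|].
    apply (continuous_mult (K := R_AbsRing)); [apply dsum_cont_Im|apply continuous_const].
Qed.

(** The functions n^{-it} are orthonormal for the mean. *)
Lemma mean_square a N :
  meanR (fun t => Cmod (dsum a N (0, t)) * Cmod (dsum a N (0, t))) (sqsum a N).
Proof.
  apply meanR_ext with (u := fun t => Cmod (csum (fun n => a n * chi (lnS n) t)%C N) * Cmod (csum (fun n => a n * chi (lnS n) t)%C N)).
  { intros. now rewrite dsum_axis. }
  unfold sqsum. induction N; simpl.
  - apply meanR_ext with (u := fun _ => 0); [|apply meanR_const]. intros. rewrite Cmod_0. ring.
  - set (u := fun t => csum (fun n => a n * chi (lnS n) t)%C N) in *.
    apply meanR_ext with (u := fun t => (Cmod (u t) * Cmod (u t) + Cmod (a N) * Cmod (a N))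
        + 2 * Re (Cconj (a N) * (1 * chi (- lnS N) t * u t))%C).
    { intros t. pose proof (Cmod_sqr (u t + a N * chi (lnS N) t)%C) as E.
      change (u t) with (csum (fun n => a n * chi (lnS n) t)%C N) in E.
      rewrite E. change (csum (fun n => a n * chi (lnS n) t)%C N) with (u t).
      assert (Cmod (a N * chi (lnS N) t)%C = Cmod (a N)) as E1 by (rewrite Cmod_mult, Cmod_chi; ring).
      rewrite <- E1, !Cmod_sqr.
      assert (Cconj (a N) * (1 * chi (- lnS N) t * u t) = Cconj (a N * chi (lnS N) t) * u t)%C as E2.
      { rewrite Cmult_conj, chi_conj. ring. }
      rewrite E2. simpl. unfold Re, Im. ring. }
    rewrite <- (Rplus_0_r (_ + _)). apply meanR_plus.
    + apply meanR_plus; [apply IHN|apply meanR_const].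
    + replace 0 with (2 * 0) by ring. apply meanR_scal.
      assert (mean (fun t => Cconj (a N) * (1 * chi (- lnS N) t * u t))%C (Cconj (a N) * 0)%C) as [H _].
      { apply mean_scal. apply (trig_mean_0 (fun x => exists n, (n < N)%nat /\ x = - lnS N + lnS n)).
        - intros x (n & hn & ->) h. assert (lnS n = lnS N) as e by lra. apply lnS_inj in e. lia.
        - apply trig_shift with (S := fun x => exists n, (n < N)%nat /\ x = lnS n); [|apply trig_dsum].
          intros x (n & hn & ->). eauto. }
      replace (Re (Cconj (a N) * 0)%C) with 0 in H by (simpl; ring). exact H.
Qed.

Lemma Rpower_ge_tangent z p : 0 < z -> 1 <= p -> 1 + p * (z - 1) <= Rpower z p.
Proof.
  intros hz hp. unfold Rpower.
  set (a := ln z). assert (z = exp a) as E by (unfold a; rewrite exp_ln; auto). rewrite E.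
  (* exp (p a) >= exp a (1 + (p-1) a)  and exp a * a >= exp a - 1 *)
  replace (p * a) with (a + (p - 1) * a) by ring. rewrite exp_plus.
  pose proof (exp_ineq1_le ((p - 1) * a)). pose proof (exp_ineq1_le (- a)). pose proof (exp_pos a).
  assert (exp a * exp (-a) = 1) by (rewrite <- exp_plus; replace (a + - a) with 0 by ring; apply exp_0).
  assert (exp a - 1 <= a * exp a) by nra.
  assert (exp a * (1 + (p - 1) * a) <= exp a * exp ((p - 1) * a)) by (apply Rmult_le_compat_l; lra).
  nra.
Qed.

Lemma Rpower_le_tangent z q : 0 < z -> 0 <= q <= 1 -> Rpower z q <= 1 + q * (z - 1).
Proof.
  intros hz hq. unfold Rpower.
  set (l := ln z). assert (z = exp l) as E by (unfold l; rewrite exp_ln; auto). rewrite E.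
  pose proof (exp_ineq1_le (l - q * l)). pose proof (exp_ineq1_le (- (q * l))). pose proof (exp_pos (q * l)).
  assert (exp l = exp (q * l) * exp (l - q * l)) by (rewrite <- exp_plus; f_equal; ring).
  assert (exp (q * l) * exp (- (q * l)) = 1) by (rewrite <- exp_plus; replace (q * l + - (q * l)) with 0 by ring; apply exp_0).
  assert (exp (q * l) * (1 + (l - q * l)) <= exp l) by (rewrite H2; apply Rmult_le_compat_l; lra).
  assert (exp (q * l) * (1 - q * l) <= 1) by (rewrite <- H3; apply Rmult_le_compat_l; lra).
  nra.
Qed.

Lemma rpow_pos x p : 0 < x -> rpow x p = Rpower x p.
Proof. intros h. unfold rpow. destruct (Rle_dec x 0); auto. lra. Qed.

Lemma rpow_nonpos x p : x <= 0 -> rpow x p = 0.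
Proof. intros h. unfold rpow. destruct (Rle_dec x 0); auto. lra. Qed.

Lemma Rpower_div x mu p : 0 < x -> 0 < mu -> Rpower x p = Rpower mu p * Rpower (x / mu) p.
Proof.
  intros. rewrite Rpower_mult_distr; auto; [|apply Rdiv_lt_0_compat; auto]. f_equal. field. lra.
Qed.

Lemma rpow_ge_tangent x mu p : 0 <= x -> 0 < mu -> 1 <= p ->
  Rpower mu p * (1 + p * (x / mu - 1)) <= rpow x p.
Proof.
  intros hx hmu hp. assert (0 < Rpower mu p) by apply exp_pos.
  destruct (Rle_lt_or_eq_dec 0 x hx) as [h|h].
  - rewrite rpow_pos, (Rpower_div x mu) by auto. apply Rmult_le_compat_l; [lra|].
    apply Rpower_ge_tangent; auto. apply Rdiv_lt_0_compat; auto.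
  - subst. rewrite rpow_nonpos by lra. unfold Rdiv. rewrite Rmult_0_l. nra.
Qed.

Lemma rpow_le_tangent x mu p : 0 <= x -> 0 < mu -> 1 <= p <= 2 ->
  rpow x p <= Rpower mu p * (1 + p / 2 * ((x * x) / (mu * mu) - 1)).
Proof.
  intros hx hmu hp. assert (0 < Rpower mu p) by apply exp_pos.
  destruct (Rle_lt_or_eq_dec 0 x hx) as [h|h].
  - rewrite rpow_pos, (Rpower_div x mu) by auto. apply Rmult_le_compat_l; [lra|].
    assert (0 < x / mu) by (apply Rdiv_lt_0_compat; auto).
    replace (x * x / (mu * mu)) with ((x / mu) * (x / mu)) by (field; lra).
    replace (Rpower (x / mu) p) with (Rpower (x / mu * (x / mu)) (p / 2)).
    + apply Rpower_le_tangent; [nra|lra].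
    + rewrite <- Rpower_mult_distr, <- Rpower_plus by auto. f_equal. field.
  - subst. rewrite rpow_nonpos by lra. unfold Rdiv. rewrite !Rmult_0_l. nra.
Qed.

Lemma rpow_continuous p x : 1 <= p -> continuous (fun x => rpow x p) x.
Proof.
  intros hp. destruct (total_order_T x 0) as [[h|h]|h].
  - apply (continuous_ext_loc _ (fun _ => 0)); [|apply continuous_const].
    exists (mkposreal (- x) ltac:(lra)). intros y hy. unfold ball in hy; simpl in hy; unfold AbsRing_ball, abs, minus, plus, opp in hy; simpl in hy.
    apply Rabs_def2 in hy. rewrite rpow_nonpos; auto. lra.
  - subst. apply continuity_pt_filterlim. unfold continuity_pt, continue_in, limit1_in, limit_in; simpl; unfold Rdist. intros eps he.
    exists (Rmin eps 1). split; [apply Rmin_pos; lra|].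
    intros y [_ hy]. rewrite (rpow_nonpos 0), Rminus_0_r by lra. rewrite Rminus_0_r in hy.
    pose proof (Rmin_l eps 1). pose proof (Rmin_r eps 1). apply Rabs_def2 in hy as hy2.
    destruct (Rle_lt_dec y 0).
    + rewrite rpow_nonpos, Rabs_R0; lra.
    + rewrite rpow_pos by auto. rewrite Rabs_pos_eq by (left; apply exp_pos).
      apply Rle_lt_trans with y; [|lra].
      rewrite <- (Rpower_1 y) at 2 by auto. unfold Rpower.
      assert (ln y <= 0) by (rewrite <- ln_1; apply ln_le; lra).
      assert (p * ln y <= 1 * ln y) as [K|K] by nra; [left; apply exp_increasing; auto|rewrite K; lra].
  - apply (continuous_ext_loc _ (fun x => exp (p * ln x))).
    + exists (mkposreal x h). intros y hy. unfold ball in hy; simpl in hy; unfold AbsRing_ball, abs, minus, plus, opp in hy; simpl in hy.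
      apply Rabs_def2 in hy. rewrite rpow_pos; auto. lra.
    + apply (ex_derive_continuous (V := R_NormedModule)). auto_derive; auto.
Qed.

Section Norm.

Variables (p : R) (hp : 1 <= p < 2).

Lemma rpow_inv_ge A mu : 0 < mu -> Rpower mu p <= A -> mu <= rpow A (/ p).
Proof.
  intros h hA. assert (0 < Rpower mu p) by apply exp_pos.
  rewrite rpow_pos by lra.
  replace mu with (Rpower (Rpower mu p) (/ p)).
  - apply Rle_Rpower_l; [left; apply Rinv_0_lt_compat; lra|lra].
  - rewrite Rpower_mult, Rinv_r, Rpower_1; lra.
Qed.

Lemma rpow_inv_le A mu : 0 < mu -> A <= Rpower mu p -> rpow A (/ p) <= mu.
Proof.
  intros h hA. destruct (Rle_lt_dec A 0); [rewrite rpow_nonpos; lra|].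
  rewrite rpow_pos by lra.
  replace mu with (Rpower (Rpower mu p) (/ p)).
  - apply Rle_Rpower_l; [left; apply Rinv_0_lt_compat; lra|lra].
  - rewrite Rpower_mult, Rinv_r, Rpower_1; lra.
Qed.

Lemma avg_affine (v : R -> R) (T a b : R) : 0 < T -> (forall t, continuous v t) ->
  / (2 * T) * RInt (fun t => a + b * v t) (- T) T = a + b * (/ (2 * T) * RInt v (- T) T).
Proof.
  intros hT hv.
  rewrite (RInt_plus (V := R_CompleteNormedModule) (fun _ => a) (fun t => b * v t)).
  - rewrite RInt_const, (RInt_scal (V := R_CompleteNormedModule) v).
    + unfold plus, scal; simpl; unfold mult; simpl. field. lra.
    + apply ex_RInt_cont; auto.
  - apply ex_RInt_cont. intros; apply continuous_const.
  - apply ex_RInt_cont. intros; apply (continuous_scal_r (V := R_NormedModule) b v); auto.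
Qed.

Lemma avg_le (u v : R -> R) (T : R) : 0 < T -> (forall t, continuous u t) -> (forall t, continuous v t) ->
  (forall t, u t <= v t) -> / (2 * T) * RInt u (- T) T <= / (2 * T) * RInt v (- T) T.
Proof.
  intros. apply Rmult_le_compat_l; [left; apply Rinv_0_lt_compat; lra|].
  apply RInt_le; try (apply ex_RInt_cont; auto); auto; lra.
Qed.

Definition avg_norm (P : dirichlet_poly) (T : R) : R :=
  rpow (/ (2 * T) * RInt (fun t => rpow (Cmod (dp_eval P (0, t))) p) (- T) T) (/ p).

Lemma eval_cont P t : continuous (fun t => Cmod (dp_eval P (0, t))) t.
Proof.
  apply (continuous_ext (fun t => Cmod (dsum (fun n => dp_coef P (S n)) (dp_deg P) (0, t)))); [|apply dsum_cont_Cmod].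
  intros. rewrite dp_eval_dsum. auto.
Qed.

Lemma eval_rpow_cont P t : continuous (fun t => rpow (Cmod (dp_eval P (0, t))) p) t.
Proof.
  apply (continuous_comp (fun t => Cmod (dp_eval P (0, t))) (fun x => rpow x p)).
  - apply eval_cont.
  - apply rpow_continuous; lra.
Qed.

Lemma avg_norm_ge P T mu : 0 < T -> 0 < mu ->
  mu <= / (2 * T) * RInt (fun t => Cmod (dp_eval P (0, t))) (- T) T -> mu <= avg_norm P T.
Proof.
  intros hT hmu H. apply rpow_inv_ge; auto.
  set (A := / (2 * T) * RInt (fun t => Cmod (dp_eval P (0, t))) (- T) T) in *.
  assert (0 < Rpower mu p) by apply exp_pos.
  apply Rle_trans with (Rpower mu p * (1 - p) + (Rpower mu p * p / mu) * A).
  - replace (Rpower mu p * (1 - p) + (Rpower mu p * p / mu) * A) with (Rpower mu p * (1 + p * (A / mu - 1))) by (field; lra).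
    assert (1 <= A / mu) by (apply Rmult_le_reg_r with mu; auto; unfold Rdiv; rewrite Rmult_assoc, Rinv_l; lra).
    assert (0 <= p * (A / mu - 1)) by (apply Rmult_le_pos; lra). nra.
  - unfold A. rewrite <- avg_affine by (auto; apply eval_cont).
    apply avg_le; auto.
    + intros t. apply (continuous_plus (V := R_NormedModule)); [apply continuous_const|].
      apply (continuous_scal_r (V := R_NormedModule) _ (fun t => Cmod (dp_eval P (0, t)))). apply eval_cont.
    + apply eval_rpow_cont.
    + intros t. eapply Rle_trans; [|apply (rpow_ge_tangent _ mu)]; auto; [|apply Cmod_ge_0|lra].
      right. field. lra.
Qed.

Lemma avg_norm_le P T mu : 0 < T -> 0 < mu ->
  / (2 * T) * RInt (fun t => Cmod (dp_eval P (0, t)) * Cmod (dp_eval P (0, t))) (- T) T <= mu * mu -> avg_norm P T <= mu.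
Proof.
  intros hT hmu H. apply rpow_inv_le; auto.
  set (A := / (2 * T) * RInt (fun t => Cmod (dp_eval P (0, t)) * Cmod (dp_eval P (0, t))) (- T) T) in *.
  assert (0 < Rpower mu p) by apply exp_pos.
  assert (forall t, continuous (fun t => Cmod (dp_eval P (0, t)) * Cmod (dp_eval P (0, t))) t) as cc.
  { intros t. apply (continuous_mult (K := R_AbsRing)); apply eval_cont. }
  apply Rle_trans with (Rpower mu p * (1 - p / 2) + (Rpower mu p * (p / 2) / (mu * mu)) * A).
  - unfold A. rewrite <- avg_affine by (auto; apply cc).
    apply avg_le; auto.
    + apply eval_rpow_cont.
    + intros t. apply (continuous_plus (V := R_NormedModule)); [apply continuous_const|].
      apply (continuous_scal_r (V := R_NormedModule) _ (fun t => Cmod (dp_eval P (0, t)) * Cmod (dp_eval P (0, t)))). apply cc.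
    + intros t. eapply Rle_trans; [apply (rpow_le_tangent _ mu)|]; auto; [apply Cmod_ge_0|lra|].
      right. field. lra.
  - replace (Rpower mu p * (1 - p / 2) + (Rpower mu p * (p / 2) / (mu * mu)) * A)
      with (Rpower mu p * (1 + p / 2 * (A / (mu * mu) - 1))) by (field; lra).
    assert (A / (mu * mu) <= 1) by (apply Rmult_le_reg_r with (mu * mu); [nra|]; unfold Rdiv; rewrite Rmult_assoc, Rinv_l; nra).
    assert (0 <= p / 2 * (1 - A / (mu * mu))) by (apply Rmult_le_pos; lra).
    rewrite <- (Rmult_1_r (Rpower mu p)) at 2. apply Rmult_le_compat_l; [lra|].
    replace (p / 2 * (A / (mu * mu) - 1)) with (- (p / 2 * (1 - A / (mu * mu)))) by ring. lra.
Qed.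

Lemma Lim_bounds (f : R -> R) (a b T0 : R) : (forall T, T0 < T -> a <= f T <= b) ->
  a <= real (Lim f p_infty) <= b.
Proof.
  intros H. unfold Lim.
  assert (eventually (fun n => a <= f (Rbar_loc_seq p_infty n) <= b)) as [N hN].
  { destruct (nfloor_ex (Rmax T0 0) (Rmax_r _ _)) as [N hN].
    exists (S N). intros n hn. apply H. simpl.
    apply Rle_lt_trans with (Rmax T0 0); [apply Rmax_l|]. apply Rlt_le_trans with (INR N + 1); [lra|].
    rewrite <- S_INR. apply le_INR; auto. }
  pose proof (Lim_seq_le_loc (fun _ => a) (fun n => f (Rbar_loc_seq p_infty n))) as L1.
  pose proof (Lim_seq_le_loc (fun n => f (Rbar_loc_seq p_infty n)) (fun _ => b)) as L2.
  rewrite Lim_seq_const in L1, L2.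
  specialize (L1 ltac:(exists N; intros; apply hN; auto)). specialize (L2 ltac:(exists N; intros; apply hN; auto)).
  destruct (Lim_seq (fun n => f (Rbar_loc_seq p_infty n))); simpl in *; try contradiction. lra.
Qed.

Definition psq (P : dirichlet_poly) : R := sqsum (fun n => dp_coef P (S n)) (dp_deg P).

Lemma avg_norm_eventually_le P mu : 0 < mu -> psq P < mu * mu ->
  exists T0, 0 < T0 /\ forall T, T0 < T -> avg_norm P T <= mu.
Proof.
  intros hmu H.
  destruct (mean_square (fun n => dp_coef P (S n)) (dp_deg P)) as [_ L].
  apply is_lim_spec in L. simpl in L.
  assert (0 < mu * mu - psq P) as hpos by lra.
  destruct (L (mkposreal _ hpos)) as [T0 K]. simpl in K.
  exists (Rmax T0 1). split; [apply Rlt_le_trans with 1; [lra|apply Rmax_r]|].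
  intros T hT. pose proof (Rmax_l T0 1). pose proof (Rmax_r T0 1).
  apply avg_norm_le; auto; [lra|].
  specialize (K T ltac:(lra)). apply Rabs_def2 in K. unfold psq in K.
  rewrite (RInt_ext _ (fun t => Cmod (dsum (fun n => dp_coef P (S n)) (dp_deg P) (0, t)) *
    Cmod (dsum (fun n => dp_coef P (S n)) (dp_deg P) (0, t)))).
  - unfold Rminus in K. lra.
  - intros t _. rewrite dp_eval_dsum. auto.
Qed.

Lemma Hp_norm_le P mu : 0 < mu -> psq P < mu * mu -> Hp_norm p P <= mu.
Proof.
  intros hmu H. destruct (avg_norm_eventually_le P mu hmu H) as (T0 & h0 & K).
  apply (Lim_bounds (avg_norm P) 0 mu T0). intros T hT. split; auto.
  unfold avg_norm, rpow at 1. destruct (Rle_dec _ 0); [lra|left; apply exp_pos].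
Qed.

(** The average of |P Phi| is at most B times that of |P|, which is at most the p-th power mean of |P|. *)
Lemma Hp_norm_ge P (Phi : R -> C) (m : C) (B : R) :
  mean (fun t => dp_eval P (0, t) * Phi t)%C m -> 0 < B -> (forall t, Cmod (Phi t) <= B) ->
  Cmod m <= B * Hp_norm p P.
Proof.
  intros H hB hPhi.
  assert (0 <= psq P) as hs by (apply rsum_pos; intros; pose proof (Cmod_ge_0 (dp_coef P (S k))); nra).
  destruct (avg_norm_eventually_le P (psq P + 1)) as (T1 & hT1 & K1); [lra|nra|].
  assert (0 <= Hp_norm p P) as hN.
  { apply (Lim_bounds (avg_norm P) 0 (psq P + 1) T1). intros T hT. split; auto.
    unfold avg_norm, rpow at 1. destruct (Rle_dec _ 0); [lra|left; apply exp_pos]. }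
  apply le_eps. intros eps he.
  destruct (Rle_lt_dec (Cmod m) eps) as [h|h]; [nra|].
  set (mu := (Cmod m - eps) / B). assert (0 < mu) as hmu by (apply Rdiv_lt_0_compat; lra).
  assert (Cmod m - eps = B * mu) as E by (unfold mu; field; lra).
  destruct (mean_le _ m (fun t => B * Cmod (dp_eval P (0, t))) (Cmod m - eps) H) as [T0 K0].
  - intros t. apply (continuous_scal_r (V := R_NormedModule) B (fun t => Cmod (dp_eval P (0, t)))), eval_cont.
  - intros t. rewrite Cmod_mult, Rmult_comm. apply Rmult_le_compat_r; [apply Cmod_ge_0|auto].
  - lra.
  - assert (mu <= Hp_norm p P); [|nra].
    apply (Lim_bounds (avg_norm P) mu (psq P + 1) (Rmax T0 T1)). intros T hT.
    pose proof (Rmax_l T0 T1). pose proof (Rmax_r T0 T1). split; [|apply K1; lra].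
    destruct (K0 T ltac:(lra)) as [hT0 K]. apply avg_norm_ge; auto.
    assert (/ (2 * T) * RInt (fun t => B * Cmod (dp_eval P (0, t))) (- T) T
      = B * (/ (2 * T) * RInt (fun t => Cmod (dp_eval P (0, t))) (- T) T)) as E2.
    { rewrite (RInt_scal (V := R_CompleteNormedModule) (fun t => Cmod (dp_eval P (0, t)))).
      - unfold scal; simpl; unfold mult; simpl. ring.
      - apply ex_RInt_cont, eval_cont. }
    rewrite E2, E in K. left. apply Rmult_lt_reg_l with B; auto.
Qed.

Lemma Hp_norm_pos P : 0 <= Hp_norm p P.
Proof.
  assert (0 <= psq P) as hs by (apply rsum_pos; intros; pose proof (Cmod_ge_0 (dp_coef P (S k))); nra).
  destruct (avg_norm_eventually_le P (psq P + 1)) as (T1 & hT1 & K1); [lra|nra|].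
  apply (Lim_bounds (avg_norm P) 0 (psq P + 1) T1). intros T hT. split; auto.
  unfold avg_norm, rpow at 1. destruct (Rle_dec _ 0); [lra|left; apply exp_pos].
Qed.

End Norm.

(** * Sums of powers *)

Definition npw (y : R) (n : nat) : R := Rpower (INR (S n)) (- y).

Lemma npw_pos y n : 0 < npw y n.
Proof. apply exp_pos. Qed.

Lemma npw_tail y N M : 1 < y -> (N <= M)%nat ->
  rsum (npw y) (S M) - rsum (npw y) (S N) <= (Rpower (INR (S N)) (1 - y) - Rpower (INR (S M)) (1 - y)) / (y - 1).
Proof.
  intros hy h. induction h as [|M h IH].
  - right. field. lra.
  - simpl rsum in *. unfold npw at 2.
    assert (Rpower (INR (S (S M))) (- y) <= (Rpower (INR (S M)) (1 - y) - Rpower (INR (S (S M))) (1 - y)) / (y - 1)).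
    { pose proof (INR_S_pos M) as p1. pose proof (INR_S_pos (S M)) as p2.
      set (u := INR (S M)) in *. assert (INR (S (S M)) = u + 1) as E by (rewrite S_INR; reflexivity).
      rewrite E in *.
      rewrite (Rpower_div u (u + 1) (1 - y)) by lra.
      assert (Rpower (u + 1) (1 - y) = (u + 1) * Rpower (u + 1) (- y)) as E1.
      { unfold Rminus. rewrite Rpower_plus, Rpower_1 by lra. auto. }
      rewrite E1. assert (0 < Rpower (u + 1) (- y)) as p3 by apply exp_pos.
      assert (1 + (y - 1) / (u + 1) <= Rpower (u / (u + 1)) (1 - y)) as T.
      { unfold Rpower. eapply Rle_trans; [|apply exp_ineq1_le].
        assert (0 < u / (u + 1)) as p4 by (apply Rdiv_lt_0_compat; lra).
        pose proof (exp_ineq1_le (ln (u / (u + 1)))) as K. rewrite exp_ln in K by auto.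
        replace ((y - 1) / (u + 1)) with ((1 - y) * (u / (u + 1) - 1)) by (field; lra).
        assert (0 <= (y - 1) * (u / (u + 1) - 1 - ln (u / (u + 1)))) by (apply Rmult_le_pos; lra). lra. }
      apply Rmult_le_reg_r with (y - 1); [lra|].
      unfold Rdiv at 1. rewrite Rmult_assoc, Rinv_l, Rmult_1_r by lra.
      apply Rle_trans with ((u + 1) * Rpower (u + 1) (- y) * (1 + (y - 1) / (u + 1)) - (u + 1) * Rpower (u + 1) (- y)).
      - right. field. lra.
      - apply Rplus_le_compat_r. apply Rmult_le_compat_l; [apply Rmult_le_pos; lra|auto]. }
    apply Rle_trans with ((Rpower (INR (S N)) (1 - y) - Rpower (INR (S M)) (1 - y)) / (y - 1) +
      (Rpower (INR (S M)) (1 - y) - Rpower (INR (S (S M))) (1 - y)) / (y - 1)).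
    + simpl rsum in IH. unfold npw in *. lra.
    + right. field. lra.
Qed.

(** A bound for zeta (y), from the comparison with the integral of x^{-y}. *)
Lemma npw_sum y N : 1 < y -> rsum (npw y) N <= y / (y - 1).
Proof.
  intros hy. assert (1 <= y / (y - 1)).
  { apply Rmult_le_reg_r with (y - 1); [lra|]. unfold Rdiv. rewrite Rmult_assoc, Rinv_l by lra. lra. }
  destruct N; simpl rsum; [lra|].
  pose proof (npw_tail y 0 N hy ltac:(lia)) as K. simpl rsum in K.
  assert (forall z, Rpower 1 z = 1) as E by (intros; unfold Rpower; rewrite ln_1, Rmult_0_r, exp_0; auto).
  assert (npw y 0 = 1) as E2 by (apply E).
  change (INR 1) with 1 in K. rewrite E2, E in K.
  assert (0 < Rpower (INR (S N)) (1 - y)) by apply exp_pos.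
  assert (1 / (y - 1) = y / (y - 1) - 1) by (field; lra).
  assert ((1 - Rpower (INR (S N)) (1 - y)) / (y - 1) <= 1 / (y - 1)).
  { unfold Rdiv. apply Rmult_le_compat_r; [left; apply Rinv_0_lt_compat|]; lra. }
  lra.
Qed.

(** * Point evaluations *)

Definition nprime (p : nat) : Prop := (2 <= p)%nat /\ forall d e, p = (d * e)%nat -> d = 1%nat \/ e = 1%nat.

(** The monoid generated by 1, ..., k, which makes the induction over the primes possible without
    factorisations. *)
Inductive smooth (k : nat) : nat -> Prop :=
| smooth_1 : smooth k 1
| smooth_mul d n : (1 <= d <= k)%nat -> smooth k n -> smooth k (d * n).

Lemma smooth_pos k n : smooth k n -> (1 <= n)%nat.
Proof. induction 1; nia. Qed.

Lemma smooth_mult k a b : smooth k a -> smooth k b -> smooth k (a * b).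
Proof.
  intros ha hb. induction ha.
  - now rewrite Nat.mul_1_l.
  - rewrite <- Nat.mul_assoc. apply smooth_mul; auto.
Qed.

Lemma smooth_S k n : smooth k n -> smooth (S k) n.
Proof. induction 1; [constructor|]. constructor; auto; lia. Qed.

Lemma smooth_self k d : (1 <= d <= k)%nat -> smooth k d.
Proof. intros. rewrite <- (Nat.mul_1_r d). constructor; auto. constructor. Qed.

Lemma smooth_pow k d j : (1 <= d <= k)%nat -> smooth k (d ^ j).
Proof. intros. induction j; simpl; [constructor|]. constructor; auto. Qed.

Lemma nprime_mult p a b : nprime p -> Nat.divide p (a * b) -> Nat.divide p a \/ Nat.divide p b.
Proof.
  intros [h2 hp] H. pose proof (Nat.gcd_divide_l p a) as [c hc].
  destruct (hp _ _ hc) as [e|e].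
  - left. rewrite e, Nat.mul_1_l in hc. rewrite hc. apply Nat.gcd_divide_r.
  - right. apply (Nat.gauss p a b); auto.
Qed.

Lemma smooth_ndiv k n : nprime (S k) -> smooth k n -> ~ Nat.divide (S k) n.
Proof.
  intros hp hn. induction hn as [|d n hd hn IH]; intros D.
  - apply Nat.divide_1_r in D. destruct hp. lia.
  - apply nprime_mult in D; auto. destruct D as [D|D]; auto. apply Nat.divide_pos_le in D; lia.
Qed.

Lemma smooth_not_prime k n : ~ nprime (S k) -> (1 <= k)%nat -> smooth (S k) n -> smooth k n.
Proof.
  intros hp hk hn.
  assert (smooth k (S k)) as K.
  { assert (exists d e, S k = (d * e)%nat /\ d <> 1%nat /\ e <> 1%nat) as (d & e & E & h1 & h2).
    { apply NNPP. intros HH. apply hp. split; [lia|]. intros d e E.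
      destruct (Nat.eq_dec d 1); auto. destruct (Nat.eq_dec e 1); auto. exfalso. apply HH. eauto. }
    rewrite E. apply smooth_mult; apply smooth_self; split; try nia;
      destruct d, e; try lia; nia. }
  induction hn; [constructor|].
  destruct (Nat.eq_dec d (S k)).
  - subst. apply smooth_mult; auto.
  - constructor; auto; lia.
Qed.

Lemma smooth_split k n : smooth (S k) n -> exists v m, n = (S k ^ v * m)%nat /\ smooth k m.
Proof.
  induction 1 as [|d n hd hn (v & m & E & hm)].
  - exists 0%nat, 1%nat. split; [reflexivity|constructor].
  - destruct (Nat.eq_dec d (S k)).
    + exists (S v), m. split; auto. subst. simpl. ring.
    + exists v, (d * m)%nat. split; [subst; ring|]. constructor; auto. lia.
Qed.

(** The instance of unique factorisation that separates the frequencies of different powers of a prime. *)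
Lemma prime_powers_neq k a b i j : nprime (S k) -> smooth k a -> smooth k b -> i <> j ->
  (S k ^ i * a)%nat <> (S k ^ j * b)%nat.
Proof.
  intros hp.
  assert (forall a b i j, smooth k a -> smooth k b -> (i < j)%nat -> (S k ^ i * a)%nat <> (S k ^ j * b)%nat) as K.
  { clear a b i j. intros a b i j ha hb hij E. apply (smooth_ndiv k a hp ha).
    replace j with (i + S (j - i - 1))%nat in E by lia.
    rewrite Nat.pow_add_r, <- Nat.mul_assoc in E. apply Nat.mul_cancel_l in E; [|apply Nat.pow_nonzero; lia].
    exists (S k ^ (j - i - 1) * b)%nat. rewrite E. rewrite Nat.pow_succ_r'. ring. }
  intros ha hb hij. destruct (Nat.lt_total i j) as [h|[h|h]]; [apply K; auto|lia|].
  apply not_eq_sym. apply K; auto.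
Qed.

Definition ratio_spec (k : nat) (x : R) : Prop :=
  exists a b, smooth k a /\ smooth k b /\ x = ln (INR a) - ln (INR b).

Lemma ln_mult_pow k i a : (1 <= a)%nat -> ln (INR (S k ^ i * a)) = INR i * ln (INR (S k)) + ln (INR a).
Proof.
  intros h. rewrite mult_INR, pow_INR, ln_mult, ln_pow; auto.
  - apply INR_S_pos.
  - apply pow_lt, INR_S_pos.
  - apply lt_0_INR; lia.
Qed.

Lemma prime_freq_neq k x i j : nprime (S k) -> ratio_spec k x -> i <> j ->
  (INR i - INR j) * ln (INR (S k)) + x <> 0.
Proof.
  intros hp (a & b & ha & hb & ->) hij H.
  apply (prime_powers_neq k a b i j hp ha hb hij).
  pose proof (smooth_pos _ _ ha). pose proof (smooth_pos _ _ hb).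
  apply INR_eq. apply ln_inv.
  - apply lt_0_INR. assert (S k ^ i <> 0)%nat by (apply Nat.pow_nonzero; lia). nia.
  - apply lt_0_INR. assert (S k ^ j <> 0)%nat by (apply Nat.pow_nonzero; lia). nia.
  - rewrite !ln_mult_pow by auto. lra.
Qed.

Lemma mean_geometric (l : R) (al : C) (u : R -> C) (m : C) L i :
  mean u m -> (forall i j : nat, i <> j -> mean (fun t => 1 * chi ((INR i - INR j) * l) t * u t)%C (RtoC 0)) ->
  mean (fun t => chi (INR i * l) t * csum (fun k => al ^ k * chi (- (INR k * l)) t)%C L * u t)%C
    (if (i <? L)%nat then al ^ i * m else 0)%C.
Proof.
  intros hu h0. induction L.
  - simpl. apply mean_ext with (u := fun _ => RtoC 0); [intros; ring|apply mean_const].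
  - simpl csum.
    apply mean_ext with (u := fun t => (chi (INR i * l) t * csum (fun k => al ^ k * chi (- (INR k * l)) t)%C L * u t
      + al ^ L * (1 * chi ((INR i - INR L) * l) t * u t))%C).
    { intros t. replace ((INR i - INR L) * l) with (INR i * l + - (INR L * l)) by ring. rewrite chi_add. ring. }
    destruct (Nat.eq_dec i L) as [e|e].
    + subst. replace (L <? S L)%nat with true by (symmetry; apply Nat.ltb_lt; lia).
      replace (L <? L)%nat with false in IHL by (symmetry; apply Nat.ltb_ge; lia).
      replace (al ^ L * m)%C with (0 + al ^ L * m)%C by ring. apply mean_plus; auto. apply mean_scal.
      apply mean_ext with (u := u); auto. intros. replace ((INR L - INR L) * l) with 0 by ring. rewrite chi_0. ring.
    + replace (i <? S L)%nat with (i <? L)%nat.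
      * replace (if (i <? L)%nat then (al ^ i * m)%C else RtoC 0)
          with ((if (i <? L)%nat then (al ^ i * m)%C else RtoC 0) + al ^ L * 0)%C by ring.
        apply mean_plus; auto. apply mean_scal. auto.
      * destruct (Nat.ltb_spec i L), (Nat.ltb_spec i (S L)); auto; lia.
Qed.

Lemma csum_geometric (q : C) L : ((1 - q) * csum (fun k => q ^ k) L = 1 - q ^ L)%C.
Proof. induction L; simpl; [ring|]. rewrite Cmult_plus_distr_l, IHL. ring. Qed.

Definition lsum (f : nat -> R) (l : list nat) : R := fold_right (fun n acc => f n + acc) 0 l.

Lemma lsum_cons f a l : lsum f (a :: l) = f a + lsum f l.
Proof. reflexivity. Qed.

Lemma lsum_app f l l' : lsum f (l ++ l') = lsum f l + lsum f l'.
Proof. induction l; simpl; [ring|]. rewrite IHl. ring. Qed.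

Lemma lsum_nodup (f : nat -> R) l : (forall n, 0 <= f n) -> NoDup l -> (forall n, In n l -> (1 <= n)%nat) ->
  exists X, lsum f l <= rsum (fun n => f (S n)) X.
Proof.
  intros hf hl h1.
  assert (forall X l, NoDup l -> (forall n, In n l -> (1 <= n <= X)%nat) -> lsum f l <= rsum (fun n => f (S n)) X) as K.
  { clear l hl h1. induction X; intros l hl hX.
    - destruct l; simpl; [lra|]. specialize (hX n (or_introl eq_refl)). lia.
    - destruct (in_dec Nat.eq_dec (S X) l) as [hi|hi].
      + apply in_split in hi. destruct hi as (l1 & l2 & ->).
        apply NoDup_remove in hl as [hl hn].
        assert (lsum f (l1 ++ l2) <= rsum (fun n => f (S n)) X).
        { apply IHX; auto. intros n hn'. assert (n <> S X) by (intros ->; auto).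
          assert (In n (l1 ++ S X :: l2)) as hn2 by (apply in_app_iff in hn'; apply in_app_iff; simpl; tauto).
          specialize (hX n hn2). lia. }
        rewrite lsum_app in *. simpl. lra.
      + assert (lsum f l <= rsum (fun n => f (S n)) X).
        { apply IHX; auto. intros n hn. assert (n <> S X) by (intros ->; auto). specialize (hX n hn). lia. }
        simpl. specialize (hf (S X)). lra. }
  exists (list_max l). apply K; auto. intros n hn. split; auto.
  pose proof (proj1 (list_max_le l (list_max l)) (le_n _)) as F. rewrite Forall_forall in F. auto.
Qed.

Section PointEval.

Variables (s : C) (hs : 1 / 2 < Re s) (N : nat).

Local Notation sg := (Re s).

Definition pw (n : nat) : C := Cexp (RtoC (- ln (INR n)) * s).

Lemma Cmod_pw n : Cmod (pw n) = Rpower (INR n) (- sg).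
Proof. unfold pw. rewrite Cmod_Cexp. unfold Rpower. f_equal. simpl. unfold Re, Im. ring. Qed.

Lemma pw_mult_pow k i a : (1 <= a)%nat -> pw (S k ^ i * a) = (pw (S k) ^ i * pw a)%C.
Proof.
  intros h. unfold pw. rewrite ln_mult_pow by auto.
  replace (RtoC (- (INR i * ln (INR (S k)) + ln (INR a))) * s)%C
    with (RtoC (INR i) * (RtoC (- ln (INR (S k))) * s) + RtoC (- ln (INR a)) * s)%C by csolve.
  rewrite Cexp_add, Cexp_mult_nat. reflexivity.
Qed.

(** The number N + 5 of terms exceeds the exponents of p in the integers up to N, and makes the truncation error
    p^{-(N + 5) sigma} at most p^{-2}. *)
Definition pfactor (p : nat) (t : R) : C :=
  ((1 - Cconj (pw p) * chi (ln (INR p)) t) *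
   csum (fun k => pw p ^ k * chi (- (INR k * ln (INR p))) t) (N + 5))%C.

Lemma chi_pow l k t : chi (- (INR k * l)) t = (chi (- l) t ^ k)%C.
Proof.
  induction k; [simpl; replace (- (0 * l)) with 0 by ring; apply chi_0|].
  rewrite S_INR, CpowS, <- IHk, <- chi_add. f_equal. ring.
Qed.

(** With al = p^{-s} and chi = p^{-it}, the factors 1 - conj(al) chi and 1 - al conj(chi) have the same modulus,
    and the second one telescopes the geometric sum, leaving 1 - (al conj(chi))^L. *)
Lemma pfactor_bound k t : (1 <= k)%nat -> Cmod (pfactor (S k) t) <= 1 + / (INR (S k) * INR (S k)).
Proof.
  intros hk. unfold pfactor.
  rewrite Cmod_mult.
  rewrite <- (Cmod_conj (1 - _)), Cminus_conj, Cmult_conj, Cconj_conj, chi_conj.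
  replace (Cconj 1) with (RtoC 1) by csolve.
  rewrite <- Cmod_mult.
  set (q := (pw (S k) * chi (- ln (INR (S k))) t)%C).
  assert (csum (fun i => pw (S k) ^ i * chi (- (INR i * ln (INR (S k)))) t)%C (N + 5) = csum (fun i => q ^ i)%C (N + 5)) as E.
  { apply csum_ext. intros i _. rewrite chi_pow. unfold q. rewrite Cpow_mult_l. auto. }
  rewrite E, csum_geometric.
  eapply Rle_trans; [apply Cmod_tri_minus|]. rewrite Cmod_1, Cmod_pow.
  apply Rplus_le_compat_l. unfold q. rewrite Cmod_mult, Cmod_chi, Cmod_pw, Rmult_1_r.
  assert (1 < INR (S k)) as h1 by (rewrite S_INR; apply le_INR in hk; simpl in hk; lra).
  rewrite <- Rpower_pow by apply exp_pos. rewrite Rpower_mult.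
  replace (/ (INR (S k) * INR (S k))) with (Rpower (INR (S k)) (- (1 + 1))).
  - apply Rle_Rpower; [lra|]. rewrite plus_INR. simpl (INR 5). pose proof (pos_INR N). nra.
  - rewrite Rpower_Ropp. f_equal. rewrite Rpower_plus, Rpower_1; lra.
Qed.

Lemma pow_gt v p : (2 <= p)%nat -> (v < p ^ v)%nat.
Proof. intros. apply Nat.pow_gt_lin_r. lia. Qed.

(** A prime p multiplies Phi by pfactor p and w by 1 - p^{-2 sigma}: in the mean of n^{-it} times the product,
    only the term of pfactor whose frequency cancels the power of p in n survives. The list l contains the
    squarefree smooth numbers, because 1 / (1 - x) is (1 + x) / (1 - x^2) and the product of the 1 - x^2 is
    at least that of the 1 - 1 / n^2 with 2 <= n <= k, which is (k + 1) / (2 k); so 1 / w is controlled by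
    zeta (2 sigma). *)
Lemma eval_kernel k : (1 <= k)%nat -> exists Phi w l,
  trig (ratio_spec k) Phi /\ (forall t, Cmod (Phi t) <= 2 * INR k / (INR k + 1)) /\ 0 < w /\ NoDup l /\
  (forall n, In n l -> smooth k n) /\
  (INR k + 1) / (2 * INR k) <= w * lsum (fun n => Rpower (INR n) (- (2 * sg))) l /\
  forall n, smooth k n -> (n <= N)%nat -> mean (fun t => chi (ln (INR n)) t * Phi t)%C (RtoC w * pw n)%C.
Proof.
  intros hk. induction hk as [|k hk (Phi & w & l & h1 & h2 & h3 & h4 & h5 & h6 & h7)].
  - exists (fun _ => RtoC 1), 1, (1%nat :: nil). refine (conj _ (conj _ (conj _ (conj _ (conj _ (conj _ _)))))).
    + replace (fun _ : R => RtoC 1) with (fun t => 1 * chi 0 t)%C.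
      * apply trig_single. exists 1%nat, 1%nat. repeat constructor. ring.
      * apply functional_extensionality. intros t. rewrite chi_0. ring.
    + intros t. rewrite Cmod_1. simpl. lra.
    + lra.
    + constructor; auto. constructor.
    + intros n [<-|[]]. constructor.
    + simpl. unfold Rpower. rewrite ln_1, Rmult_0_r, exp_0. lra.
    + intros n hn _.
      assert (n = 1%nat) by (induction hn; nia). subst.
      apply (mean_ext (fun _ => RtoC 1)).
      * intros. simpl INR. rewrite ln_1, chi_0. ring.
      * replace (1 * pw 1)%C with (RtoC 1); [apply mean_const|]. unfold pw. simpl INR. rewrite ln_1.
        replace (RtoC (- 0) * s)%C with (RtoC 0) by csolve. rewrite Cexp_0. ring.
  - assert (1 <= INR k) as hk' by (apply le_INR in hk; exact hk).
    destruct (classic (nprime (S k))) as [hp|hp].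
    2: { exists Phi, w, l. refine (conj _ (conj _ (conj _ (conj _ (conj _ (conj _ _)))))); auto.
      - clear - h1. induction h1; constructor; auto. destruct H as (a & b & ha & hb & E).
        exists a, b. repeat split; auto; apply smooth_S; auto.
      - intros t. eapply Rle_trans; [apply h2|]. rewrite S_INR.
        apply Rmult_le_reg_r with ((INR k + 1) * (INR k + 1 + 1)); [nra|].
        replace (2 * INR k / (INR k + 1) * ((INR k + 1) * (INR k + 1 + 1))) with (2 * INR k * (INR k + 2)) by (field; lra).
        replace (2 * (INR k + 1) / (INR k + 1 + 1) * ((INR k + 1) * (INR k + 1 + 1))) with (2 * (INR k + 1) * (INR k + 1)) by (field; lra).
        nra.
      - intros n hn. apply smooth_S; auto.
      - eapply Rle_trans; [|apply h6]. rewrite S_INR.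
        apply Rmult_le_reg_r with (2 * (INR k + 1) * INR k); [nra|].
        replace ((INR k + 1 + 1) / (2 * (INR k + 1)) * (2 * (INR k + 1) * INR k)) with (INR k * (INR k + 2)) by (field; lra).
        replace ((INR k + 1) / (2 * INR k) * (2 * (INR k + 1) * INR k)) with ((INR k + 1) * (INR k + 1)) by (field; lra).
        nra.
      - intros n hn hnN. apply h7; auto. apply smooth_not_prime; auto. }
    set (q := Rpower (INR (S k)) (- (2 * sg))).
    assert (1 < INR (S k)) as hk2 by (rewrite S_INR; lra).
    assert (Cmod (pw (S k)) * Cmod (pw (S k)) = q) as hq.
    { rewrite Cmod_pw, <- Rpower_plus. unfold q. f_equal. ring. }
    assert (0 < q) as hq0 by apply exp_pos.
    assert (q * q <= / (INR (S k) * INR (S k))) as hq2.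
    { unfold q. rewrite <- Rpower_plus. replace (/ (INR (S k) * INR (S k))) with (Rpower (INR (S k)) (- (1 + 1))).
      - apply Rle_Rpower; lra.
      - rewrite Rpower_Ropp. f_equal. rewrite Rpower_plus, Rpower_1; lra. }
    assert (/ (INR (S k) * INR (S k)) < 1) as hk3.
    { rewrite <- Rinv_1. apply Rinv_lt_contravar; nra. }
    assert (q < 1) as hq1 by nra.
    exists (fun t => pfactor (S k) t * Phi t)%C, (w * (1 - q)), (l ++ map (Nat.mul (S k)) l).
    assert (forall n v, smooth k n -> (v + 1 < N + 5)%nat -> (n <= N)%nat ->
      mean (fun t => chi (INR v * ln (INR (S k)) + ln (INR n)) t * (pfactor (S k) t * Phi t))%C
           (RtoC (w * (1 - q)) * (pw (S k) ^ v * pw n))%C) as KEY.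
    { intros n v hn hv hnN.
      pose proof (h7 n hn hnN) as hm. set (u := fun t => (chi (ln (INR n)) t * Phi t)%C) in *.
      set (ell := ln (INR (S k))).
      assert (forall i j, i <> j -> mean (fun t => 1 * chi ((INR i - INR j) * ell) t * u t)%C (RtoC 0)) as h0.
      { intros i j hij. apply (trig_mean_0 (fun x => exists y, ratio_spec k y /\ x = (INR i - INR j) * ell + y)).
        - intros x (y & hy & ->). apply prime_freq_neq; auto.
        - apply trig_shift with (S := ratio_spec k); eauto.
          replace u with (fun t => 1 * chi (ln (INR n)) t * Phi t)%C
            by (apply functional_extensionality; intros; unfold u; ring).
          apply (trig_shift (ratio_spec k) (ratio_spec k) 1 (ln (INR n)) Phi); auto.
          intros x (a & b & ha & hb & ->). exists (n * a)%nat, b. repeat split; auto.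
          { apply smooth_mult; auto. }
          rewrite mult_INR, ln_mult; [ring| |]; apply lt_0_INR; [apply smooth_pos in hn|apply smooth_pos in ha]; lia. }
      pose proof (mean_geometric ell (pw (S k)) u _ (N + 5) v hm h0) as M1.
      pose proof (mean_geometric ell (pw (S k)) u _ (N + 5) (S v) hm h0) as M2.
      replace (v <? N + 5)%nat with true in M1 by (symmetry; apply Nat.ltb_lt; lia).
      replace (S v <? N + 5)%nat with true in M2 by (symmetry; apply Nat.ltb_lt; lia).
      apply (mean_scal (- Cconj (pw (S k)))%C) in M2.
      pose proof (mean_plus _ _ _ _ M1 M2) as M.
      eapply mean_ext; [|replace (RtoC (w * (1 - q)) * (pw (S k) ^ v * pw n))%C with
         (pw (S k) ^ v * (w * pw n) + - Cconj (pw (S k)) * (pw (S k) ^ S v * (w * pw n)))%C; [apply M|]].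
      - intros t. unfold pfactor, u. fold ell.
        rewrite S_INR. replace ((INR v + 1) * ell) with (INR v * ell + ell) by ring. rewrite !chi_add. ring.
      - rewrite <- hq, CpowS.
        assert (RtoC (Cmod (pw (S k)) * Cmod (pw (S k))) = pw (S k) * Cconj (pw (S k)))%C as E.
        { rewrite <- Cmod2_conj. simpl. csolve. }
        rewrite RtoC_mult, RtoC_minus, E. ring. }
    refine (conj _ (conj _ (conj _ (conj _ (conj _ (conj _ _)))))).
    + assert (forall x, ratio_spec k x -> ratio_spec (S k) x) as e1.
      { intros x (a & b & ha & hb & E). exists a, b. repeat split; auto; apply smooth_S; auto. }
      assert (forall x, ratio_spec (S k) x -> ratio_spec (S k) (ln (INR (S k)) + x)) as e2.
      { intros x (a & b & ha & hb & ->). exists (S k * a)%nat, b. repeat split; auto.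
        - constructor; auto; lia.
        - rewrite mult_INR, ln_mult; [ring|lra|]. apply lt_0_INR. apply smooth_pos in ha; lia. }
      assert (forall i x, ratio_spec (S k) x -> ratio_spec (S k) (- (INR i * ln (INR (S k))) + x)) as e3.
      { intros i x (a & b & ha & hb & ->). exists a, (S k ^ i * b)%nat. repeat split; auto.
        - apply smooth_mult; auto. apply smooth_pow. lia.
        - rewrite ln_mult_pow; [ring|]. eapply smooth_pos; eauto. }
      assert (trig (ratio_spec (S k)) Phi) as hPhi.
      { clear - h1 e1. induction h1; constructor; auto. }
      assert (trig (ratio_spec (S k)) (fun t => csum (fun i => pw (S k) ^ i * chi (- (INR i * ln (INR (S k)))) t * Phi t) (N + 5))%C) as hG.
      { apply (trig_csum _ (fun i t => pw (S k) ^ i * chi (- (INR i * ln (INR (S k)))) t * Phi t)%C).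
        intros i _. apply trig_shift with (S := ratio_spec (S k)); auto. }
      pose proof (trig_shift _ _ (- Cconj (pw (S k)))%C _ _ e2 hG) as hG2.
      pose proof (trig_plus _ _ _ hG hG2) as hG3.
      refine (eq_ind _ (trig (ratio_spec (S k))) hG3 _ _).
      apply functional_extensionality. intros t. unfold pfactor.
      assert (csum (fun i => pw (S k) ^ i * chi (- (INR i * ln (INR (S k)))) t * Phi t)%C (N + 5)
        = Phi t * csum (fun i => pw (S k) ^ i * chi (- (INR i * ln (INR (S k)))) t) (N + 5))%C as E.
      { rewrite <- csum_scal. apply csum_ext. intros; ring. }
      rewrite E. ring.
    + intros t. rewrite Cmod_mult.
      pose proof (pfactor_bound k t hk) as b1. specialize (h2 t).
      pose proof (Cmod_ge_0 (Phi t)). pose proof (Cmod_ge_0 (pfactor (S k) t)).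
      eapply Rle_trans; [apply Rmult_le_compat; eauto|].
      rewrite S_INR. apply Rmult_le_reg_r with ((INR k + 1) * (INR k + 1) * (INR k + 1) * (INR k + 1 + 1)); [repeat apply Rmult_lt_0_compat; lra|].
      replace ((1 + / ((INR k + 1) * (INR k + 1))) * (2 * INR k / (INR k + 1)) * ((INR k + 1) * (INR k + 1) * (INR k + 1) * (INR k + 1 + 1)))
        with (((INR k + 1) * (INR k + 1) + 1) * (2 * (INR k * (INR k + 2)))) by (field; lra).
      replace (2 * (INR k + 1) / (INR k + 1 + 1) * ((INR k + 1) * (INR k + 1) * (INR k + 1) * (INR k + 1 + 1)))
        with (2 * ((INR k + 1) * (INR k + 1)) * ((INR k + 1) * (INR k + 1))) by (field; lra).
      nra.
    + apply Rmult_lt_0_compat; lra.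
    + apply NoDup_app; auto.
      * apply NoDup_map_NoDup_ForallPairs; auto. intros a b _ _ E. apply Nat.mul_cancel_l in E; lia.
      * intros n hn hn'. apply in_map_iff in hn'. destruct hn' as (b & <- & hb).
        apply (smooth_ndiv k _ hp (h5 _ hn)). apply Nat.divide_factor_l.
    + intros n hn. apply in_app_iff in hn. destruct hn as [hn|hn].
      * apply smooth_S; auto.
      * apply in_map_iff in hn. destruct hn as (b & <- & hb). constructor; [lia|]. apply smooth_S; auto.
    + rewrite lsum_app.
      assert (lsum (fun n => Rpower (INR n) (- (2 * sg))) (map (Nat.mul (S k)) l) = q * lsum (fun n => Rpower (INR n) (- (2 * sg))) l) as E.
      { assert (forall n, In n l -> (1 <= n)%nat) as hl by (intros n hn; eapply smooth_pos; eauto).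
        clear - hl hk2. induction l; [simpl; ring|]. rewrite map_cons, !lsum_cons. rewrite IHl by (intros; apply hl; simpl; auto).
        rewrite mult_INR, <- Rpower_mult_distr; [unfold q; ring|lra|].
        apply lt_0_INR. specialize (hl a (or_introl eq_refl)). lia. }
      rewrite E.
      replace (w * (1 - q) * (lsum (fun n => Rpower (INR n) (- (2 * sg))) l + q * lsum (fun n => Rpower (INR n) (- (2 * sg))) l))
        with (w * lsum (fun n => Rpower (INR n) (- (2 * sg))) l * (1 - q * q)) by ring.
      apply Rle_trans with ((INR k + 1) / (2 * INR k) * (1 - / (INR (S k) * INR (S k)))).
      * right. rewrite S_INR. field. lra.
      * apply Rmult_le_compat; auto; try lra. apply Rdiv_le_0_compat; lra.
    + intros n hn hnN. destruct (smooth_split k n hn) as (v & m & -> & hm).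
      pose proof (smooth_pos _ _ hm). rewrite pw_mult_pow, ln_mult_pow by auto.
      pose proof (pow_gt v (S k) (proj1 hp)).
      apply KEY; auto; nia.
Qed.

End PointEval.

(** Pairing P with the kernel gives w P(s), where the kernel is bounded by 2 and 1 / w by 2 zeta (2 sigma). *)
Lemma point_eval p P s : 1 <= p < 2 -> 1 / 2 < Re s ->
  Cmod (dp_eval P s) <= 4 * (2 * Re s / (2 * Re s - 1)) * Hp_norm p P.
Proof.
  intros hp hs. set (N := dp_deg P).
  destruct (eval_kernel s hs N (S N) ltac:(lia)) as (Phi & w & l & h1 & h2 & h3 & h4 & h5 & h6 & h7).
  assert (mean (fun t => dp_eval P (0, t) * Phi t)%C (RtoC w * dp_eval P s)%C) as M.
  { rewrite dp_eval_dsum. unfold dsum. rewrite <- csum_scal.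
    apply mean_ext with (u := fun t => csum (fun n => dp_coef P (S n) * (chi (ln (INR (S n))) t * Phi t))%C N).
    - intros t. rewrite dp_eval_dsum, dsum_axis, Cmult_comm, <- csum_scal. apply csum_ext. intros; unfold lnS; ring.
    - apply (mean_csum (fun n t => dp_coef P (S n) * (chi (ln (INR (S n))) t * Phi t))%C).
      intros n hn.
      replace (w * (dp_coef P (S n) * Cexp (RtoC (- lnS n) * s)))%C with (dp_coef P (S n) * (w * pw s (S n)))%C
        by (unfold pw, lnS; ring).
      apply mean_scal. apply h7; [|unfold N in *; lia]. apply smooth_self. unfold N in *; lia. }
  pose proof (Hp_norm_ge p hp P Phi _ 2 M ltac:(lra)) as K.
  pose proof (pos_INR N) as pN.
  assert (forall t, Cmod (Phi t) <= 2) as hPhi.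
  { intros t. eapply Rle_trans; [apply h2|]. rewrite S_INR. apply Rmult_le_reg_r with (INR N + 1 + 1); [lra|].
    unfold Rdiv. rewrite Rmult_assoc, Rinv_l; lra. }
  specialize (K hPhi). rewrite Cmod_mult, Cmod_R, Rabs_pos_eq in K by lra.
  destruct (lsum_nodup (fun n => Rpower (INR n) (- (2 * Re s))) l) as [X hX]; auto.
  { intros; left; apply exp_pos. }
  { intros n hn. eapply smooth_pos; eauto. }
  pose proof (npw_sum (2 * Re s) X ltac:(lra)) as hz. unfold npw in hz.
  set (z := 2 * Re s / (2 * Re s - 1)) in *.
  assert (1 / 2 <= w * z) as hw.
  { apply Rle_trans with ((INR (S N) + 1) / (2 * INR (S N))).
    - rewrite S_INR. apply Rmult_le_reg_r with (2 * (INR N + 1)); [lra|].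
      unfold Rdiv at 2. rewrite Rmult_assoc, Rinv_l; lra.
    - eapply Rle_trans; [apply h6|]. apply Rmult_le_compat_l; lra. }
  pose proof (Hp_norm_pos p hp P). pose proof (Cmod_ge_0 (dp_eval P s)).
  assert (0 < z) by (apply Rdiv_lt_0_compat; lra).
  assert (z * (w * Cmod (dp_eval P s)) <= z * (2 * Hp_norm p P)) by (apply Rmult_le_compat_l; lra).
  nra.
Qed.

(** Pairing with n^{it} extracts a coefficient. *)
Lemma coef_bound p P n : 1 <= p < 2 -> Cmod (dp_coef P (S n)) <= Hp_norm p P.
Proof.
  intros hp. pose proof (Hp_norm_pos p hp P).
  destruct (Nat.lt_ge_cases n (dp_deg P)) as [h|h].
  2: { unfold dp_coef. replace (S n <=? dp_deg P)%nat with false by (symmetry; apply Nat.leb_gt; lia).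
       rewrite Bool.andb_false_r, Cmod_0. lra. }
  assert (mean (fun t => dp_eval P (0, t) * chi (- lnS n) t)%C (dp_coef P (S n))) as M.
  { apply mean_ext with (u := fun t => csum (fun k => dp_coef P (S k) * (chi (lnS k - lnS n) t))%C (dp_deg P)).
    - intros t. rewrite dp_eval_dsum, dsum_axis, Cmult_comm, <- csum_scal. apply csum_ext. intros.
      unfold Rminus. rewrite chi_add. ring.
    - assert (forall N, (n < N)%nat -> csum (fun k => dp_coef P (S k) * (if (k =? n)%nat then 1 else 0))%C N = dp_coef P (S n)) as E.
      { intros N hN. induction hN.
        - simpl. rewrite Nat.eqb_refl. rewrite (csum_ext _ (fun _ => RtoC 0)).
          + rewrite csum_0. ring.
          + intros k hk. replace (k =? n)%nat with false by (symmetry; apply Nat.eqb_neq; lia). ring.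
        - simpl. rewrite IHhN. replace (m =? n)%nat with false by (symmetry; apply Nat.eqb_neq; lia). ring. }
      rewrite <- (E (dp_deg P) h).
      apply (mean_csum (fun k t => dp_coef P (S k) * (chi (lnS k - lnS n) t))%C).
      intros k hk. apply mean_scal. destruct (Nat.eqb_spec k n).
      + subst. apply mean_ext with (u := fun _ => RtoC 1); [|apply mean_const].
        intros. replace (lnS n - lnS n) with 0 by ring. now rewrite chi_0.
      + apply mean_chi. intros E2. apply n0. apply lnS_inj. lra. }
  pose proof (Hp_norm_ge p hp P _ _ 1 M ltac:(lra)) as K. rewrite Rmult_1_l in K. apply K.
  intros t. rewrite Cmod_chi. lra.
Qed.

(** * The disc algebra *)

Fixpoint peval (l : list C) (z : C) : C :=
  match l with nil => RtoC 0 | c :: l => (c + z * peval l z)%C end.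

Definition ispoly (f : C -> C) : Prop := exists l, forall z, f z = peval l z.

Lemma ispoly_const c : ispoly (fun _ => c).
Proof. exists (c :: nil). intros; simpl. ring. Qed.

Lemma ispoly_id : ispoly (fun z => z).
Proof. exists (RtoC 0 :: RtoC 1 :: nil). intros; simpl. ring. Qed.

Lemma ispoly_plus f g : ispoly f -> ispoly g -> ispoly (fun z => f z + g z)%C.
Proof.
  intros [l hl]. revert f hl g. induction l as [|c l IH]; intros f hl g [m hm].
  - exists m. intros z. rewrite hl, hm. simpl. ring.
  - destruct m as [|d m].
    + exists (c :: l). intros z. rewrite hl, hm. simpl. ring.
    + destruct (IH (peval l) (fun z => eq_refl) (peval m)) as [n hn]; [exists m; auto|].
      exists ((c + d)%C :: n). intros z. rewrite hl, hm. simpl. rewrite <- hn. ring.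
Qed.

Lemma ispoly_scal c f : ispoly f -> ispoly (fun z => c * f z)%C.
Proof.
  intros [l hl]. exists (map (Cmult c) l). intros z. rewrite hl. clear hl.
  induction l; simpl; [ring|]. rewrite <- IHl. ring.
Qed.

Lemma ispoly_mul_id f : ispoly f -> ispoly (fun z => z * f z)%C.
Proof. intros [l hl]. exists (RtoC 0 :: l). intros z. rewrite hl. simpl. ring. Qed.

Lemma ispoly_ext f g : (forall z, f z = g z) -> ispoly f -> ispoly g.
Proof. intros E [l hl]. exists l. intros. rewrite <- E. auto. Qed.

Lemma ispoly_mult f g : ispoly f -> ispoly g -> ispoly (fun z => f z * g z)%C.
Proof.
  intros [l hl] hg. apply ispoly_ext with (f := fun z => (peval l z * g z)%C); [intros; now rewrite hl|].
  clear f hl. induction l as [|c l IH]; simpl.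
  - apply ispoly_ext with (f := fun _ => RtoC 0); [intros; ring|apply ispoly_const].
  - apply ispoly_ext with (f := fun z => (c * g z + z * (peval l z * g z))%C); [intros; ring|].
    apply ispoly_plus; [apply ispoly_scal; auto|]. apply ispoly_mul_id; auto.
Qed.

Lemma ispoly_shift q f : ispoly f -> ispoly (fun z => f (q + z))%C.
Proof.
  intros [l hl]. apply ispoly_ext with (f := fun z => peval l (q + z)%C); [intros; now rewrite hl|].
  clear f hl. induction l as [|c l IH]; simpl; [apply ispoly_const|].
  apply ispoly_plus; [apply ispoly_const|]. apply ispoly_mult; auto.
  apply ispoly_plus; [apply ispoly_const|apply ispoly_id].
Qed.

Lemma mean_bound u m B : mean u m -> (forall t, Cmod (u t) <= B) -> Cmod m <= B.
Proof.
  intros hm hB. destruct (Rle_lt_dec (Cmod m) B) as [h|h]; auto. exfalso.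
  destruct (mean_le u m (fun _ => B) B hm) as [T0 K]; auto.
  { intros; apply continuous_const. }
  destruct (K (Rmax T0 0 + 1)) as [h0 h1].
  { pose proof (Rmax_l T0 0). lra. }
  rewrite RInt_const in h1. unfold scal in h1; simpl in h1; unfold mult in h1; simpl in h1.
  set (T := Rmax T0 0 + 1) in *.
  replace (/ (2 * T) * ((T - - T) * B)) with B in h1 by (field; lra). lra.
Qed.

Lemma trig_peval rho l : trig (fun x => exists k : nat, x = INR k) (fun t => peval l (RtoC rho * chi 1 t)%C).
Proof.
  induction l as [|c l IH]; simpl; [apply trig_0|].
  apply (trig_plus _ (fun _ => c) (fun t => rho * chi 1 t * peval l (rho * chi 1 t))%C).
  - replace (fun _ : R => c) with (fun t => c * chi 0 t)%C.
    + apply trig_single. exists 0%nat. reflexivity.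
    + apply functional_extensionality. intros. rewrite chi_0. ring.
  - eapply trig_shift; [|exact IH]. intros x (k & ->). exists (S k). rewrite S_INR. ring.
Qed.

(** The sum is the Cauchy kernel z / (z - z0) truncated beyond the degree of the polynomial; the terms cut off
    have frequencies that do not contribute to the mean. *)
Lemma cauchy_kernel rho z0 l L : 0 < rho -> (length l <= L)%nat ->
  mean (fun t => peval l (RtoC rho * chi 1 t) * csum (fun k => (z0 / rho) ^ k * chi (- (INR k)) t) L)%C (peval l z0).
Proof.
  intros hr. revert L. induction l as [|c l IH]; intros L hL; simpl length in hL.
  - simpl. apply mean_ext with (u := fun _ => RtoC 0); [intros; ring|apply mean_const].
  - destruct L as [|L]; [lia|]. specialize (IH L ltac:(lia)).
    assert (forall t L, csum (fun k => (z0 / rho) ^ k * chi (- (INR k)) t)%C (S L) =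
      1 + z0 / rho * chi (- 1) t * csum (fun k => (z0 / rho) ^ k * chi (- (INR k)) t)%C L)%C as E.
    { intros t M. generalize (z0 / rho)%C as y. intros y. induction M as [|M IHM].
      - simpl. replace (- 0) with 0 by ring. rewrite chi_0. ring.
      - change (csum (fun k => y ^ k * chi (- (INR k)) t)%C (S (S M))) with
          (csum (fun k => y ^ k * chi (- (INR k)) t) (S M) + y ^ (S M) * chi (- (INR (S M))) t)%C.
        rewrite IHM at 1. change (csum (fun k => y ^ k * chi (- (INR k)) t)%C (S M)) with
          (csum (fun k => y ^ k * chi (- (INR k)) t) M + y ^ M * chi (- (INR M)) t)%C.
        rewrite S_INR, CpowS. replace (- (INR M + 1)) with (- 1 + - INR M) by ring. rewrite chi_add. ring. }
    assert (RtoC rho <> 0) as hr0 by (intros K; apply (f_equal fst) in K; simpl in K; lra).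
    apply mean_ext with (u := fun t => (c * csum (fun k => (z0 / rho) ^ k * chi (- (INR k)) t) (S L) +
      (rho * chi 1 t * peval l (rho * chi 1 t) +
       z0 * (peval l (RtoC rho * chi 1 t) * csum (fun k => (z0 / rho) ^ k * chi (- (INR k)) t) L)))%C).
    { intros t. simpl peval. rewrite E.
      assert (chi (-1) t * chi 1 t = 1)%C as E1.
      { rewrite <- chi_add. replace (-1 + 1) with 0 by ring. apply chi_0. }
      transitivity (c * (1 + z0 / rho * chi (-1) t * csum (fun k => (z0 / rho) ^ k * chi (- INR k) t) L) +
        (rho * chi 1 t * peval l (rho * chi 1 t) +
         z0 * (chi (-1) t * chi 1 t) * (peval l (rho * chi 1 t) * csum (fun k => (z0 / rho) ^ k * chi (- INR k) t) L)))%C.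
      - rewrite E1. ring.
      - field. auto. }
    simpl peval. replace (c + z0 * peval l z0)%C with (c * 1 + (0 + z0 * peval l z0))%C by ring.
    apply mean_plus; [|apply mean_plus].
    + apply mean_scal. clear - hr0. induction L as [|M IHM].
      * apply mean_ext with (u := fun _ => RtoC 1); [|apply mean_const].
        intros; simpl. replace (- 0) with 0 by ring. rewrite chi_0. ring.
      * replace (RtoC 1) with (1 + (z0 / rho) ^ (S M) * 0)%C by ring.
        apply (mean_plus (fun t => csum (fun k => (z0 / rho) ^ k * chi (- INR k) t)%C (S M))); auto.
        apply mean_scal, mean_chi. rewrite S_INR. pose proof (pos_INR M). lra.
    + apply (trig_mean_0 (fun x => exists k : nat, x = 1 + INR k)).
      * intros x (k & ->). pose proof (pos_INR k). lra.
      * eapply trig_shift; [|apply trig_peval]. intros x (k & ->). eauto.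
    + apply mean_scal; auto.
Qed.

Lemma rsum_geometric r L : 0 <= r < 1 -> rsum (fun k => r ^ k) L <= / (1 - r).
Proof.
  intros hr. assert (rsum (fun k => r ^ k) L * (1 - r) = 1 - r ^ L) as E.
  { induction L; simpl; [ring|]. rewrite Rmult_plus_distr_r, IHL. ring. }
  apply Rmult_le_reg_r with (1 - r); [lra|]. rewrite E, Rinv_l by lra.
  assert (0 <= r ^ L) by (apply pow_le; lra). lra.
Qed.

Lemma poly_coarse rho z0 l M : Cmod z0 < rho -> (forall z, Cmod z = rho -> Cmod (peval l z) <= M) ->
  Cmod (peval l z0) <= M * / (1 - Cmod z0 / rho).
Proof.
  intros h hM. pose proof (Cmod_ge_0 z0). assert (0 < rho) as hr by lra.
  eapply mean_bound; [apply (cauchy_kernel rho z0 l (length l)); auto|].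
  intros t. cbv beta. rewrite Cmod_mult. apply Rmult_le_compat; try apply Cmod_ge_0.
  - apply hM. rewrite Cmod_mult, Cmod_chi, Cmod_R, Rabs_pos_eq; lra.
  - eapply Rle_trans; [|apply (rsum_geometric (Cmod z0 / rho) (length l))].
    + apply Cmod_csum_le. intros k _. rewrite Cmod_mult, Cmod_chi, Cmod_pow, Cmod_div, Cmod_R, (Rabs_pos_eq rho); try lra.
      intros K; apply (f_equal fst) in K; simpl in K; lra.
    + split; [apply Rdiv_le_0_compat; lra|]. apply Rmult_lt_reg_r with rho; auto.
      unfold Rdiv. rewrite Rmult_assoc, Rinv_l; lra.
Qed.

(** The disc algebra of |z - q| <= rho, as the uniform closure of the polynomials: products, limits, the maximum
    principle and division by z - z0 then reduce to polynomials, without integration. *)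
Definition Adisc (q : C) (rho : R) (f : C -> C) : Prop :=
  forall eps, 0 < eps -> exists g, ispoly g /\ forall z, Cmod (z - q) <= rho -> Cmod (f z - g z) <= eps.

Section Disc.

Variables (q : C) (rho : R) (hrho : 0 < rho).

Lemma A_poly f : ispoly f -> Adisc q rho f.
Proof.
  intros h eps he. exists f. split; auto. intros. replace (f z - f z)%C with (RtoC 0) by ring. rewrite Cmod_0. lra.
Qed.

Lemma A_ext f g : (forall z, Cmod (z - q) <= rho -> f z = g z) -> Adisc q rho f -> Adisc q rho g.
Proof. intros E h eps he. destruct (h eps he) as (p & hp & K). exists p. split; auto. intros. rewrite <- E; auto. Qed.

Lemma A_plus f g : Adisc q rho f -> Adisc q rho g -> Adisc q rho (fun z => f z + g z)%C.
Proof.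
  intros hf hg eps he. destruct (hf (eps/2)) as (p & hp & K); [lra|]. destruct (hg (eps/2)) as (p' & hp' & K'); [lra|].
  exists (fun z => p z + p' z)%C. split; [apply ispoly_plus; auto|]. intros z hz.
  specialize (K z hz). specialize (K' z hz).
  replace (f z + g z - (p z + p' z))%C with ((f z - p z) + (g z - p' z))%C by ring.
  pose proof (Cmod_triangle (f z - p z) (g z - p' z)). lra.
Qed.

Lemma poly_bounded f : ispoly f -> exists B, 0 <= B /\ forall z, Cmod (z - q) <= rho -> Cmod (f z) <= B.
Proof.
  intros [l hl]. assert (exists B, 0 <= B /\ forall z, Cmod (z - q) <= rho -> Cmod (peval l z) <= B) as (B & h0 & hB).
  { clear f hl. induction l as [|c l (B & h0 & hB)].
    - exists 0. split; [lra|]. intros. simpl. rewrite Cmod_0. lra.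
    - pose proof (Cmod_ge_0 c). pose proof (Cmod_ge_0 q).
      exists (Cmod c + (rho + Cmod q) * B). split; [nra|]. intros z hz. simpl.
      eapply Rle_trans; [apply Cmod_triangle|]. apply Rplus_le_compat_l. rewrite Cmod_mult.
      apply Rmult_le_compat; try apply Cmod_ge_0; auto.
      replace z with ((z - q) + q)%C by ring. eapply Rle_trans; [apply Cmod_triangle|]. lra. }
  exists B. split; auto. intros. rewrite hl. auto.
Qed.

Lemma A_bounded f : Adisc q rho f -> exists B, 0 <= B /\ forall z, Cmod (z - q) <= rho -> Cmod (f z) <= B.
Proof.
  intros hf. destruct (hf 1) as (p & hp & K); [lra|]. destruct (poly_bounded p hp) as (B & h0 & hB).
  exists (B + 1). split; [lra|]. intros z hz. specialize (K z hz). specialize (hB z hz).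
  pose proof (Cmod_tri_rev (f z) (p z)). lra.
Qed.

Lemma A_mult f g : Adisc q rho f -> Adisc q rho g -> Adisc q rho (fun z => f z * g z)%C.
Proof.
  intros hf hg eps he.
  destruct (A_bounded f hf) as (B & b0 & hB). destruct (A_bounded g hg) as (B' & b0' & hB').
  destruct (hf (Rmin 1 (eps / (2 * (B' + 1))))) as (p & hp & K).
  { apply Rmin_pos; [lra|]. apply Rdiv_lt_0_compat; lra. }
  destruct (hg (eps / (2 * (B + 1)))) as (p' & hp' & K').
  { apply Rdiv_lt_0_compat; lra. }
  exists (fun z => p z * p' z)%C. split; [apply ispoly_mult; auto|]. intros z hz.
  specialize (K z hz). specialize (K' z hz). specialize (hB z hz). specialize (hB' z hz).
  assert (Cmod (p z) <= B + 1).
  { pose proof (Cmod_tri_rev (p z) (f z)). rewrite Cmod_minus_sym in H. pose proof (Rmin_l 1 (eps / (2 * (B' + 1)))). lra. }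
  pose proof (Rmin_r 1 (eps / (2 * (B' + 1)))).
  replace (f z * g z - p z * p' z)%C with ((f z - p z) * g z + p z * (g z - p' z))%C by ring.
  eapply Rle_trans; [apply Cmod_triangle|]. rewrite !Cmod_mult.
  replace eps with (eps / (2 * (B' + 1)) * (B' + 1) + (B + 1) * (eps / (2 * (B + 1)))) by (field; lra).
  apply Rplus_le_compat; apply Rmult_le_compat; try apply Cmod_ge_0; lra.
Qed.

Lemma A_pow f n : Adisc q rho f -> Adisc q rho (fun z => f z ^ n)%C.
Proof.
  intros hf. induction n; [apply A_poly; apply (ispoly_const 1)|].
  apply A_ext with (f := fun z => (f z * f z ^ n)%C); auto. apply A_mult; auto.
Qed.

Lemma A_lim (f : nat -> C -> C) g : (forall n, Adisc q rho (f n)) ->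
  (forall eps, 0 < eps -> exists n, forall z, Cmod (z - q) <= rho -> Cmod (f n z - g z) <= eps) -> Adisc q rho g.
Proof.
  intros hf H eps he. destruct (H (eps / 2)) as [n hn]; [lra|]. destruct (hf n (eps/2)) as (p & hp & K); [lra|].
  exists p. split; auto. intros z hz. specialize (hn z hz). specialize (K z hz).
  pose proof (Cmod_tri3 (g z) (f n z) (p z)). rewrite (Cmod_minus_sym (g z) (f n z)) in H0. lra.
Qed.

Lemma A_complete (f : nat -> C -> C) : (forall n, Adisc q rho (f n)) ->
  (forall eps, 0 < eps -> exists N, forall n m, (N <= n)%nat -> (N <= m)%nat ->
     forall z, Cmod (z - q) <= rho -> Cmod (f n z - f m z) <= eps) ->
  exists g, Adisc q rho g /\ (forall z, Cmod (z - q) <= rho -> clim (fun n => f n z) (g z)) /\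
    (forall eps, 0 < eps -> exists N, forall n, (N <= n)%nat -> forall z, Cmod (z - q) <= rho -> Cmod (f n z - g z) <= eps).
Proof.
  intros hf H.
  assert (forall z, exists l, Cmod (z - q) <= rho -> clim (fun n => f n z) l) as K.
  { intros z. destruct (Rle_lt_dec (Cmod (z - q)) rho) as [h|h].
    - destruct (clim_cauchy (fun n => f n z)) as [l hl]; [|exists l; auto].
      intros eps he. destruct (H (eps/2)) as [N hN]; [lra|]. exists N. intros n m hn hm.
      specialize (hN n m hn hm z h). lra.
    - exists (RtoC 0). intros; lra. }
  destruct (choice _ K) as [g hg].
  assert (forall eps, 0 < eps -> exists N, forall n, (N <= n)%nat -> forall z, Cmod (z - q) <= rho -> Cmod (f n z - g z) <= eps) as U.
  { intros eps he. destruct (H eps he) as [N hN]. exists N. intros n hn z hz.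
    rewrite Cmod_minus_sym.
    apply clim_le with (u := fun m => (f m z - f n z)%C).
    - apply (clim_plus _ (fun _ => - f n z)%C); [apply hg; auto|apply clim_const].
    - exists N. intros m hm. apply hN; auto. }
  exists g. split; [|split; auto].
  apply A_lim with (f := f); auto. intros eps he. destruct (U eps he) as [N hN]. exists N. apply hN. auto.
Qed.

Lemma A_coarse f M z0 : Adisc q rho f -> Cmod (z0 - q) < rho -> (forall z, Cmod (z - q) = rho -> Cmod (f z) <= M) ->
  Cmod (f z0) <= M * / (1 - Cmod (z0 - q) / rho).
Proof.
  intros hf hz hM. set (k := / (1 - Cmod (z0 - q) / rho)).
  assert (0 < k) as hk.
  { apply Rinv_0_lt_compat. assert (Cmod (z0 - q) / rho < 1); [|lra].
    apply Rmult_lt_reg_r with rho; auto. unfold Rdiv. rewrite Rmult_assoc, Rinv_l; lra. }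
  apply le_eps. intros eps he.
  destruct (hf (eps / (k + 1))) as (p & hp & K); [apply Rdiv_lt_0_compat; lra|].
  destruct (ispoly_shift q p hp) as [l hl].
  assert (Cmod (peval l (z0 - q)) <= (M + eps / (k + 1)) * k).
  { apply poly_coarse; auto. intros z hz'. rewrite <- hl.
    assert (Cmod (q + z - q) = rho) as e by (replace (q + z - q)%C with z by ring; auto).
    specialize (K (q + z)%C ltac:(lra)). specialize (hM (q + z)%C e).
    pose proof (Cmod_tri_rev (p (q + z)%C) (f (q + z)%C)). rewrite Cmod_minus_sym in H. lra. }
  rewrite <- hl in H. replace (q + (z0 - q))%C with z0 in H by ring.
  specialize (K z0 ltac:(lra)). pose proof (Cmod_tri_rev (f z0) (p z0)).
  assert (eps / (k + 1) * k + eps / (k + 1) = eps) by (field; lra). lra.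
Qed.

Lemma bernoulli_unbounded x k : 1 < x -> exists n : nat, k < x ^ n.
Proof.
  intros hx. destruct (nfloor_ex (Rmax (k / (x - 1)) 0) (Rmax_r _ _)) as [n [_ hn]].
  exists (S n). pose proof (Rmax_l (k / (x - 1)) 0).
  pose proof (poly (S n) (x - 1) ltac:(lra)) as P. replace (1 + (x - 1)) with x in P by ring.
  rewrite S_INR in P. assert (k / (x - 1) * (x - 1) = k) by (field; lra). nra.
Qed.

(** The constant of the coarse bound disappears when that bound is applied to f^n and n tends to infinity. *)
Lemma A_max f M z0 : Adisc q rho f -> Cmod (z0 - q) <= rho -> (forall z, Cmod (z - q) = rho -> Cmod (f z) <= M) ->
  Cmod (f z0) <= M.
Proof.
  intros hf hz hM. destruct (Rle_lt_or_eq_dec _ _ hz) as [h|h]; [|auto].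
  apply le_eps. intros eps he.
  set (k := / (1 - Cmod (z0 - q) / rho)).
  assert (0 <= M) as hM0.
  { apply Rle_trans with (Cmod (f (q + RtoC rho)%C)); [apply Cmod_ge_0|apply hM].
    replace (q + rho - q)%C with (RtoC rho) by ring. rewrite Cmod_R, Rabs_pos_eq; lra. }
  destruct (Rle_lt_dec (Cmod (f z0)) (M + eps)) as [g|g]; auto. exfalso.
  destruct (bernoulli_unbounded (Cmod (f z0) / (M + eps)) k) as [n hn].
  { apply Rmult_lt_reg_r with (M + eps); [lra|]. unfold Rdiv. rewrite Rmult_assoc, Rinv_l; lra. }
  pose proof (A_coarse (fun z => f z ^ n)%C (M ^ n) z0 (A_pow f n hf) h) as K.
  fold k in K. cbv beta in K; rewrite Cmod_pow in K.
  specialize (K ltac:(intros; rewrite Cmod_pow; apply pow_incr; split; [apply Cmod_ge_0|auto])).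
  unfold Rdiv in hn. rewrite Rpow_mult_distr, pow_inv in hn.
  assert (0 < (M + eps) ^ n) as hp by (apply pow_lt; lra).
  assert (k * (M + eps) ^ n < Cmod (f z0) ^ n).
  { apply Rmult_lt_reg_r with (/ (M + eps) ^ n); [apply Rinv_0_lt_compat; auto|]. rewrite Rmult_assoc, Rinv_r; lra. }
  assert (M ^ n <= (M + eps) ^ n) by (apply pow_incr; lra).
  assert (0 < k).
  { apply Rinv_0_lt_compat. assert (Cmod (z0 - q) / rho < 1); [|lra].
    apply Rmult_lt_reg_r with rho; auto. unfold Rdiv. rewrite Rmult_assoc, Rinv_l; lra. }
  nra.
Qed.

Lemma poly_div p z0 : ispoly p -> exists g, ispoly g /\ forall z, p z = (p z0 + (z - z0) * g z)%C.
Proof.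
  intros [l hl].
  assert (exists g, ispoly g /\ forall z, peval l z = (peval l z0 + (z - z0) * g z)%C) as (g & hg & E).
  { clear p hl. induction l as [|c l (g & hg & E)].
    - exists (fun _ => RtoC 0). split; [apply ispoly_const|]. intros; simpl. ring.
    - exists (fun z => peval l z0 + z * g z)%C. split.
      + apply ispoly_plus; [apply ispoly_const|]. apply ispoly_mul_id; auto.
      + intros z. simpl. rewrite (E z). ring. }
  exists g. split; auto. intros. rewrite !hl. auto.
Qed.

Lemma dist_circle z0 z : Cmod (z - q) = rho -> rho - Cmod (z0 - q) <= Cmod (z - z0).
Proof. intros <-. replace (z - z0)%C with ((z - q) - (z0 - q))%C by ring. apply Cmod_tri_rev. Qed.

(** On the circle |z - z0| is at least rho - |z0 - q|, and the maximum principle carries the bound for the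
    quotient inside. *)
Lemma A_quot_bound h g z0 M : Adisc q rho g -> Cmod (z0 - q) < rho ->
  (forall z, Cmod (z - q) <= rho -> h z = ((z - z0) * g z)%C) -> (forall z, Cmod (z - q) = rho -> Cmod (h z) <= M) ->
  forall z, Cmod (z - q) <= rho -> Cmod (g z) <= M / (rho - Cmod (z0 - q)).
Proof.
  intros hg hz E hM z hzz. apply A_max; auto. intros w hw.
  pose proof (dist_circle z0 w hw) as D. specialize (hM w hw). rewrite E, Cmod_mult in hM by lra.
  apply Rmult_le_reg_r with (rho - Cmod (z0 - q)); [lra|].
  unfold Rdiv. rewrite Rmult_assoc, Rinv_l, Rmult_1_r by lra.
  pose proof (Cmod_ge_0 (g w)). nra.
Qed.

Lemma A_approx f : Adisc q rho f -> exists p : nat -> C -> C, (forall n, ispoly (p n)) /\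
  forall n z, Cmod (z - q) <= rho -> Cmod (f z - p n z) <= / INR (S n).
Proof.
  intros hf.
  assert (forall n, exists p, ispoly p /\ forall z, Cmod (z - q) <= rho -> Cmod (f z - p z) <= / INR (S n)) as K.
  { intros n. apply hf. apply Rinv_0_lt_compat. rewrite S_INR. pose proof (pos_INR n). lra. }
  destruct (choice _ K) as [p hp]. exists p. split; intros; apply hp; auto.
Qed.

Lemma inv_INR_small eps : 0 < eps -> exists N, forall n, (N <= n)%nat -> / INR (S n) <= eps.
Proof.
  intros he. destruct (nfloor_ex (/ eps)) as [N [_ hN]]; [left; apply Rinv_0_lt_compat; auto|].
  exists N. intros n hn. rewrite <- (Rinv_inv eps). apply Rinv_le_contravar; [apply Rinv_0_lt_compat; auto|].
  rewrite S_INR. apply le_INR in hn. lra.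
Qed.

(** The difference quotients of approximating polynomials are uniformly Cauchy by the bound for quotients. *)
Lemma A_div f z0 : Adisc q rho f -> Cmod (z0 - q) < rho -> f z0 = RtoC 0 ->
  exists g, Adisc q rho g /\ forall z, Cmod (z - q) <= rho -> f z = ((z - z0) * g z)%C.
Proof.
  intros hf hz h0. destruct (A_approx f hf) as (p & hp & K).
  destruct (choice _ (fun n => poly_div (p n) z0 (hp n))) as [g hg].
  set (d := rho - Cmod (z0 - q)). assert (0 < d) as hd by (unfold d; lra).
  destruct (A_complete g) as (G & hG & hlim & _).
  - intros n. apply A_poly, hg.
  - intros eps he. destruct (inv_INR_small (eps * d / 4)) as [N hN].
    { apply Rdiv_lt_0_compat; [apply Rmult_lt_0_compat; lra|lra]. }
    exists N. intros n m hn hm.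
    replace eps with (eps * d / d) by (field; lra).
    apply (A_quot_bound (fun z => (p n z - p m z) - (p n z0 - p m z0))%C (fun z => g n z - g m z)%C z0); auto.
    + apply A_poly. apply ispoly_ext with (f := fun z => (g n z + (- (1)) * g m z)%C); [intros; ring|].
      apply ispoly_plus; [apply hg|]. apply ispoly_scal, hg.
    + intros z _. rewrite (proj2 (hg n) z), (proj2 (hg m) z). ring.
    + intros z hzz. pose proof (K n z ltac:(lra)). pose proof (K m z ltac:(lra)).
      pose proof (K n z0 ltac:(lra)). pose proof (K m z0 ltac:(lra)).
      pose proof (hN n hn). pose proof (hN m hm).
      replace (p n z - p m z - (p n z0 - p m z0))%C with
        (((f z - p m z) - (f z - p n z)) - ((f z0 - p m z0) - (f z0 - p n z0)))%C by ring.
      pose proof (Cmod_tri_minus ((f z - p m z) - (f z - p n z)) ((f z0 - p m z0) - (f z0 - p n z0))).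
      pose proof (Cmod_tri_minus (f z - p m z) (f z - p n z)).
      pose proof (Cmod_tri_minus (f z0 - p m z0) (f z0 - p n z0)). lra.
  - exists G. split; auto. intros z hzz.
    assert (forall w, Cmod (w - q) <= rho -> clim (fun n => p n w) (f w)) as L.
    { intros w hw eps he. destruct (inv_INR_small (eps / 2)) as [N hN]; [lra|]. exists N. intros n hn.
      rewrite Cmod_minus_sym. pose proof (K n w hw). specialize (hN n hn). lra. }
    apply clim_unique with (u := fun n => p n z); [auto|].
    replace ((z - z0) * G z)%C with (f z0 + (z - z0) * G z)%C by (rewrite h0; ring).
    apply clim_ext with (u := fun n => (p n z0 + (z - z0) * g n z)%C).
    + intros n. symmetry. apply hg.
    + apply clim_plus; [apply L; lra|]. apply clim_scal. apply hlim; auto.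
Qed.

End Disc.

Lemma A_smaller q rho rho' f : rho' <= rho -> Adisc q rho f -> Adisc q rho' f.
Proof. intros h hf eps he. destruct (hf eps he) as (p & hp & K). exists p. split; auto. intros. apply K. lra. Qed.

(** * Complex derivatives and multiplicities *)

(** Complex differentiability with a quadratic error, the form in which it passes to uniform limits. *)
Definition cderq (f : C -> C) (z d : C) : Prop :=
  exists K delta, 0 < delta /\ 0 <= K /\
    forall w, Cmod (w - z) < delta -> Cmod (f w - f z - d * (w - z)) <= K * (Cmod (w - z) * Cmod (w - z)).

Lemma cderq_C_derive f z d : cderq f z d -> C_derive f z = d.
Proof.
  intros (K & delta & hd & hK & H).
  assert (forall eps : posreal, exists e : posreal, forall x, Rabs (x - fst z) < e -> x <> fst z ->
     Cmod ((f (x, snd z) - f z) / ((x, snd z) - z) - d) < eps) as L.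
  { intros eps. pose proof (cond_pos eps).
    assert (0 < Rmin delta (eps / (K + 1))) as hp.
    { apply Rmin_pos; auto. apply Rdiv_lt_0_compat; lra. }
    exists (mkposreal _ hp). intros x hx hne. simpl in hx.
    pose proof (Rmin_l delta (eps / (K + 1))). pose proof (Rmin_r delta (eps / (K + 1))).
    assert ((x, snd z) - z = RtoC (x - fst z))%C as E by csolve.
    assert (Cmod ((x, snd z) - z) = Rabs (x - fst z)) as E2 by (rewrite E, Cmod_R; auto).
    assert (0 < Rabs (x - fst z)) by (apply Rabs_pos_lt; lra).
    specialize (H (x, snd z)). rewrite E2 in H. specialize (H ltac:(lra)).
    assert (((x, snd z) - z)%C <> 0) as ne by (apply Cmod_gt_0; lra).
    replace ((f (x, snd z) - f z) / ((x, snd z) - z) - d)%C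
      with ((f (x, snd z) - f z - d * ((x, snd z) - z)) / ((x, snd z) - z))%C by (field; auto).
    rewrite Cmod_div, E2 by auto.
    apply Rmult_lt_reg_r with (Rabs (x - fst z)); auto. unfold Rdiv. rewrite Rmult_assoc, Rinv_l, Rmult_1_r by lra.
    apply Rle_lt_trans with (1 := H).
    rewrite <- Rmult_assoc. apply Rmult_lt_compat_r; auto.
    apply Rle_lt_trans with (K * (eps / (K + 1))).
    - apply Rmult_le_compat_l; lra.
    - apply Rmult_lt_reg_r with (K + 1); [lra|]. replace (K * (eps / (K + 1)) * (K + 1)) with (K * eps) by (field; lra). nra. }
  unfold C_derive, C_lim. apply injective_projections; simpl.
  - assert (is_lim (fun x => fst ((f (x, snd z) - f z) / ((x, snd z) - z))%C) (fst z) (Finite (fst d))) as M.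
    { apply is_lim_spec. intros eps. destruct (L eps) as [e he]. exists e. intros y hy hne.
      eapply Rle_lt_trans; [|apply (he y hy hne)].
      eapply Rle_trans; [|apply Re_le_Cmod]. right. reflexivity. }
    apply is_lim_unique in M. simpl in M. rewrite M. reflexivity.
  - assert (is_lim (fun x => snd ((f (x, snd z) - f z) / ((x, snd z) - z))%C) (fst z) (Finite (snd d))) as M.
    { apply is_lim_spec. intros eps. destruct (L eps) as [e he]. exists e. intros y hy hne.
      eapply Rle_lt_trans; [|apply (he y hy hne)].
      eapply Rle_trans; [|apply Im_le_Cmod]. right. reflexivity. }
    apply is_lim_unique in M. simpl in M. rewrite M. reflexivity.
Qed.

Lemma cderq_ext f g z d : (exists e, 0 < e /\ forall w, Cmod (w - z) < e -> f w = g w) -> cderq f z d -> cderq g z d.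
Proof.
  intros (e & he & E) (K & delta & hd & hK & H). exists K, (Rmin e delta).
  split; [apply Rmin_pos; auto|]. split; auto. intros w hw.
  pose proof (Rmin_l e delta). pose proof (Rmin_r e delta).
  rewrite <- (E w), <- (E z); [apply H; lra| |lra]. replace (z - z)%C with (RtoC 0) by ring. rewrite Cmod_0. auto.
Qed.

Lemma cderq_mul_lin f s0 z d : cderq f z d -> cderq (fun w => (w - s0) * f w)%C z (f z + (z - s0) * d)%C.
Proof.
  intros (K & delta & hd & hK & H).
  pose proof (Cmod_ge_0 (z - s0)). pose proof (Cmod_ge_0 d).
  exists (Cmod (z - s0) * K + (Cmod d + K * delta)), delta. split; auto. split; [nra|].
  intros w hw. specialize (H w hw). set (h := (w - z)%C) in *. pose proof (Cmod_ge_0 h).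
  set (r := (f w - f z - d * h)%C) in *.
  replace ((w - s0) * f w - (z - s0) * f z - (f z + (z - s0) * d) * h)%C with ((z - s0) * r + h * (d * h + r))%C
    by (unfold r, h; ring).
  eapply Rle_trans; [apply Cmod_triangle|]. rewrite !Cmod_mult.
  pose proof (Cmod_triangle (d * h) r) as T. rewrite Cmod_mult in T.
  assert (Cmod r <= K * delta * Cmod h).
  { eapply Rle_trans; [apply H|]. rewrite <- Rmult_assoc. apply Rmult_le_compat_r; auto. apply Rmult_le_compat_l; lra. }
  assert (Cmod h * Cmod (d * h + r)%C <= Cmod h * ((Cmod d + K * delta) * Cmod h)) by (apply Rmult_le_compat_l; lra).
  assert (Cmod (z - s0) * Cmod r <= Cmod (z - s0) * (K * (Cmod h * Cmod h))) by (apply Rmult_le_compat_l; auto).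
  lra.
Qed.

Lemma cderq_mul_pow g s0 z d k : cderq g z d ->
  cderq (fun w => (w - s0) ^ S k * g w)%C z ((z - s0) ^ k * (INR (S k) * g z + (z - s0) * d))%C.
Proof.
  intros H. induction k.
  - apply cderq_ext with (f := fun w => ((w - s0) * g w)%C).
    + exists 1. split; [lra|]. intros. simpl. ring.
    + replace ((z - s0) ^ 0 * (INR 1 * g z + (z - s0) * d))%C with (g z + (z - s0) * d)%C by (simpl; ring).
      apply cderq_mul_lin; auto.
  - apply cderq_ext with (f := fun w => ((w - s0) * ((w - s0) ^ S k * g w))%C).
    + exists 1. split; [lra|]. intros. rewrite (CpowS _ (S k)). ring.
    + replace ((z - s0) ^ S k * (INR (S (S k)) * g z + (z - s0) * d))%C with
        ((z - s0) ^ S k * g z + (z - s0) * ((z - s0) ^ k * (INR (S k) * g z + (z - s0) * d)))%C.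
      * apply (cderq_mul_lin (fun w => (w - s0) ^ S k * g w)%C); auto.
      * rewrite !S_INR, !RtoC_plus, !CpowS. ring.
Qed.

(** The values d z are the derivative; the second quotient r z is again a polynomial in w. *)
Lemma poly_quad l : exists d r, ispoly d /\ (forall z, ispoly (r z)) /\
  forall z w, peval l w = (peval l z + (w - z) * (d z + (w - z) * r z w))%C.
Proof.
  induction l as [|c l (d & r & hd & hr & E)].
  - exists (fun _ => RtoC 0), (fun _ _ => RtoC 0). repeat split; try (intros; apply ispoly_const). intros; simpl; ring.
  - exists (fun z => peval l z + z * d z)%C, (fun z w => d z + w * r z w)%C. split; [|split].
    + apply ispoly_plus; [exists l; auto|]. apply ispoly_mul_id; auto.
    + intros z'. apply ispoly_plus; [apply ispoly_const|]. apply ispoly_mul_id; auto.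
    + intros z' w. simpl. rewrite (E z' w). ring.
Qed.

(** Two successive difference quotients of an approximating polynomial obey Cauchy estimates on the smaller disc:
    the first gives the convergence of the derivatives, the second a uniform quadratic error. *)
Lemma A_derive q rho rho' f : 0 < rho' < rho -> Adisc q rho f ->
  exists d, Adisc q rho' d /\ forall z, Cmod (z - q) < rho' -> cderq f z (d z).
Proof.
  intros hr hf. assert (0 < rho) as hr0 by lra.
  destruct (A_approx q rho f hf) as (p & hp & K).
  assert (forall n, exists d r, ispoly d /\ (forall z, ispoly (r z)) /\
    forall z w, p n w = (p n z + (w - z) * (d z + (w - z) * r z w))%C) as D.
  { intros n. destruct (hp n) as [l hl]. destruct (poly_quad l) as (d & r & hd & hr' & E).
    exists d, r. repeat split; auto. intros. rewrite !hl. auto. }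
  destruct (choice _ D) as [d D']. destruct (choice _ D') as [r D'']. clear D D'.
  set (e := rho - rho'). assert (0 < e) as he by (unfold e; lra).
  (* Cauchy estimates on the smaller disc *)
  assert (forall h d r M z, ispoly h -> ispoly (r z) -> (forall w, h w = (h z + (w - z) * (d + (w - z) * r z w))%C) ->
     (forall w, Cmod (w - q) <= rho -> Cmod (h w) <= M) -> Cmod (z - q) <= rho' ->
     Cmod d <= 2 * M / e /\ forall w, Cmod (w - q) <= rho -> Cmod (r z w) <= 4 * M / (e * e)) as EST.
  { clear - hr hr0 he. intros h d r M z hh hr' E hM hz.
    assert (0 <= M) as hM0 by (eapply Rle_trans; [apply Cmod_ge_0|apply (hM z); lra]).
    assert (forall w, Cmod (w - q) <= rho -> Cmod (d + (w - z) * r z w) <= 2 * M / e) as B1.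
    { intros w hw.
      eapply Rle_trans; [apply (A_quot_bound q rho hr0 (fun w => h w - h z)%C (fun w => d + (w - z) * r z w)%C z (2 * M)); auto|].
      - apply A_poly. apply ispoly_plus; [apply ispoly_const|]. apply ispoly_mult; auto.
        apply ispoly_plus; [apply ispoly_id|apply ispoly_const].
      - lra.
      - intros x _. rewrite (E x). ring.
      - intros x hx. pose proof (Cmod_tri_minus (h x) (h z)). pose proof (hM x ltac:(lra)). pose proof (hM z ltac:(lra)). lra.
      - unfold Rdiv. apply Rmult_le_compat_l; [lra|]. apply Rinv_le_contravar; unfold e; lra. }
    assert (Cmod d <= 2 * M / e) as B0.
    { specialize (B1 z ltac:(lra)). replace (d + (z - z) * r z z)%C with d in B1 by ring. auto. }
    split; auto. intros w hw.
    eapply Rle_trans; [apply (A_quot_bound q rho hr0 (fun w => (d + (w - z) * r z w) - d)%C (r z) z (4 * M / e)); auto|].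
    - apply A_poly; auto.
    - lra.
    - intros x _. ring.
    - intros x hx. pose proof (Cmod_tri_minus (d + (x - z) * r z x) d). specialize (B1 x ltac:(lra)).
      replace (4 * M / e) with (2 * M / e + 2 * M / e) by (field; lra). lra.
    - replace (4 * M / (e * e)) with (4 * M / e * / e) by (field; lra). unfold Rdiv at 1.
      apply Rmult_le_compat_l; [apply Rdiv_le_0_compat; lra|]. apply Rinv_le_contravar; unfold e; lra. }
  destruct (A_complete q rho' d) as (G & hG & hlim & _).
  - intros n. apply A_poly, D''.
  - intros eps heps. destruct (inv_INR_small (eps * e / 4)) as [N hN].
    { apply Rdiv_lt_0_compat; [apply Rmult_lt_0_compat; lra|lra]. }
    exists N. intros n m hn hm z hz.
    destruct (D'' n) as (h1 & h2 & h3). destruct (D'' m) as (h1' & h2' & h3').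
    replace eps with (2 * (eps * e / 4 + eps * e / 4) / e) by (field; lra).
    refine (proj1 (EST (fun w => p n w - p m w)%C (d n z - d m z)%C (fun z w => r n z w - r m z w)%C _ z _ _ _ _ hz)).
    + apply ispoly_ext with (f := fun w => (p n w + (- (1)) * p m w)%C); [intros; ring|].
      apply ispoly_plus; auto. apply ispoly_scal; auto.
    + apply ispoly_ext with (f := fun w => (r n z w + (- (1)) * r m z w)%C); [intros; ring|].
      apply ispoly_plus; auto. apply ispoly_scal; auto.
    + intros w. rewrite (h3 z w), (h3' z w). ring.
    + intros w hw. replace (p n w - p m w)%C with ((f w - p m w) - (f w - p n w))%C by ring.
      pose proof (Cmod_tri_minus (f w - p m w) (f w - p n w)). pose proof (K n w hw). pose proof (K m w hw).
      pose proof (hN n hn). pose proof (hN m hm). lra.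
  - exists G. split; auto. intros z hz.
    destruct (A_bounded q rho hr0 f hf) as (B & hB0 & hB).
    exists (4 * (B + 1) / (e * e)), e. split; auto. split; [apply Rdiv_le_0_compat; nra|].
    intros w hw.
    assert (Cmod (w - q) <= rho) as hw'.
    { pose proof (Cmod_triangle (w - z) (z - q)). replace (w - z + (z - q))%C with (w - q)%C in H by ring. unfold e in *. lra. }
    assert (forall w, Cmod (w - q) <= rho -> clim (fun n => p n w) (f w)) as L.
    { intros x hx eps heps. destruct (inv_INR_small (eps / 2)) as [N hN]; [lra|]. exists N. intros n hn.
      rewrite Cmod_minus_sym. pose proof (K n x hx). specialize (hN n hn). lra. }
    apply clim_le with (u := fun n => (p n w + (- (1)) * p n z + (- (w - z)) * d n z)%C).
    + replace (f w - f z - G z * (w - z))%C with (f w + - (1) * f z + (- (w - z)) * G z)%C by ring.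
      apply clim_plus; [apply clim_plus; [apply L; auto|apply clim_scal, L; lra]|]. apply clim_scal, hlim. lra.
    + exists 0%nat. intros n _. destruct (D'' n) as (h1 & h2 & h3).
      replace (p n w + - (1) * p n z + (- (w - z)) * d n z)%C with (((w - z) * (w - z)) * r n z w)%C by (rewrite (h3 z w); ring).
      rewrite !Cmod_mult, Rmult_comm. apply Rmult_le_compat_r; [apply Rmult_le_pos; apply Cmod_ge_0|].
      refine (proj2 (EST (p n) (d n z) (r n) (B + 1) z _ _ _ _ _) w hw'); auto; [|lra].
      intros x hx. pose proof (Cmod_tri_rev (p n x) (f x)). rewrite Cmod_minus_sym in H. pose proof (K n x hx).
      pose proof (hB x hx). assert (/ INR (S n) <= 1).
      { rewrite <- Rinv_1. apply Rinv_le_contravar; [lra|]. rewrite S_INR. pose proof (pos_INR n). lra. }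
      lra.
Qed.

Lemma C_derive_local f g z : (exists e, 0 < e /\ forall w, Cmod (w - z) < e -> f w = g w) -> C_derive f z = C_derive g z.
Proof.
  intros (e & he & E). unfold C_derive, C_lim.
  assert (forall x, Rabs (x - fst z) < e -> f (x, snd z) = g (x, snd z)) as K.
  { intros x hx. apply E. replace ((x, snd z) - z)%C with (RtoC (x - fst z)) by csolve. rewrite Cmod_R. auto. }
  assert (f z = g z) as K0.
  { apply E. replace (z - z)%C with (RtoC 0) by ring. rewrite Cmod_0. auto. }
  f_equal; f_equal; apply Lim_ext_loc; exists (mkposreal e he); intros y hy _; rewrite K, K0; auto.
Qed.

Lemma ball_open q rho z : Cmod (z - q) < rho -> exists e, 0 < e /\ forall w, Cmod (w - z) < e -> Cmod (w - q) < rho.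
Proof.
  intros h. exists (rho - Cmod (z - q)). split; [lra|]. intros w hw.
  pose proof (Cmod_triangle (w - z) (z - q)). replace (w - z + (z - q))%C with (w - q)%C in H by ring. lra.
Qed.

Lemma iter_derive_power k : forall q rho f g s0, Cmod (s0 - q) < rho -> Adisc q rho g ->
  (forall z, Cmod (z - q) < rho -> f z = ((z - s0) ^ k * g z)%C) -> Nat.iter k C_derive f s0 = (INR (fact k) * g s0)%C.
Proof.
  induction k; intros q rho f g s0 h hg E.
  - simpl. rewrite E by auto. simpl. ring.
  - rewrite Nat.iter_succ_r.
    set (rho' := (rho + Cmod (s0 - q)) / 2). pose proof (Cmod_ge_0 (s0 - q)).
    assert (0 < rho') as hr' by (unfold rho'; lra).
    destruct (A_derive q rho rho' g) as (d & hd & hD); [unfold rho'; lra|auto|].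
    rewrite (IHk q rho' (C_derive f) (fun z => INR (S k) * g z + (z - s0) * d z)%C).
    + rewrite fact_simpl, mult_INR, RtoC_mult. ring.
    + unfold rho'; lra.
    + apply A_plus.
      * apply (A_mult q rho' hr'); [apply A_poly, ispoly_const|]. apply A_smaller with rho; auto. unfold rho'; lra.
      * apply (A_mult q rho' hr'); auto. apply A_poly. apply ispoly_plus; [apply ispoly_id|apply ispoly_const].
    + intros z hz. apply cderq_C_derive.
      apply cderq_ext with (f := fun w => ((w - s0) ^ S k * g w)%C).
      * destruct (ball_open q rho z) as (e & he & K); [unfold rho' in hz; lra|]. exists e. split; auto.
        intros. symmetry. apply E. auto.
      * apply cderq_mul_pow. apply hD. auto.
Qed.

(** The k-th derivative of (z - s0)^k g at s0 is k! g(s0); if it vanishes, a further factor z - s0 can be divided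
    out of g. *)
Lemma zero_order_div q rho f s0 k : Adisc q rho f -> Cmod (s0 - q) < rho -> zero_of_order_ge f s0 k ->
  exists g, Adisc q rho g /\ forall z, Cmod (z - q) <= rho -> f z = ((z - s0) ^ k * g z)%C.
Proof.
  intros hf h. assert (0 < rho) as hr by (pose proof (Cmod_ge_0 (s0 - q)); lra).
  induction k as [|k IH]; intros hz.
  - exists f. split; auto. intros. simpl. ring.
  - destruct IH as (g & hg & E). { intros i hi. apply hz. lia. }
    assert (g s0 = RtoC 0) as g0.
    { pose proof (iter_derive_power k q rho f g s0 h hg ltac:(intros; apply E; lra)) as K.
      rewrite hz in K by lia.
      assert (RtoC (INR (fact k)) <> 0) as ne.
      { intros e. apply (f_equal fst) in e. simpl in e. apply (INR_fact_neq_0 k). auto. }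
      replace (g s0) with (/ INR (fact k) * (INR (fact k) * g s0))%C by (field; auto). rewrite <- K. ring. }
    destruct (A_div q rho hr g s0 hg h g0) as (g' & hg' & E').
    exists g'. split; auto. intros z hz'. rewrite E, E', CpowS by auto. ring.
Qed.

(** * Zeros of bounded analytic functions *)

Definition lprod (u : nat -> C) (l : list nat) : C := fold_right (fun j acc => u j * acc)%C (RtoC 1) l.

Lemma A_lprod q rho (u : nat -> C -> C) l : 0 < rho -> (forall j, Adisc q rho (u j)) -> Adisc q rho (fun z => lprod (fun j => u j z) l).
Proof.
  intros hr hu. induction l as [|j l IH].
  - apply A_poly. exact (ispoly_const 1).
  - apply (A_mult q rho hr (u j)); auto.
Qed.

Lemma lprod_filter (b : nat -> bool) u l :
  lprod u l = (lprod u (filter b l) * lprod u (filter (fun j => negb (b j)) l))%C.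
Proof.
  induction l as [|j l IH]; simpl; [ring|]. destruct (b j); simpl; rewrite IH; ring.
Qed.

Lemma lprod_const (u : nat -> C) x l : (forall j, In j l -> u j = x) -> lprod u l = (x ^ length l)%C.
Proof.
  induction l as [|j l IH]; intros H; simpl; [reflexivity|].
  rewrite (H j), IH; simpl; auto. intros; apply H; simpl; auto.
Qed.

Lemma lprod_neq0 (u : nat -> C) l : (forall j, In j l -> u j <> RtoC 0) -> lprod u l <> RtoC 0.
Proof.
  induction l as [|j l IH]; intros H; simpl.
  - intros E. apply (f_equal fst) in E. simpl in E. lra.
  - apply Cmult_neq_0; [apply H; simpl; auto|]. apply IH. intros; apply H; simpl; auto.
Qed.

Lemma Cmult_reg_l (a b c : C) : a <> RtoC 0 -> (a * b = a * c)%C -> b = c.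
Proof.
  intros ha E. transitivity (/ a * (a * b))%C; [field; auto|]. rewrite E. field. auto.
Qed.

Lemma Cpow_neq_0 (a : C) n : a <> RtoC 0 -> (a ^ n)%C <> RtoC 0.
Proof.
  intros h. induction n; [intros E; apply (f_equal fst) in E; simpl in E; lra|]. apply Cmult_neq_0; auto.
Qed.

(** Induction on the list: if s0 occurs k times among the earlier points, then f has a zero of order k + 1 at
    s0, so the quotient of f by the earlier factors still vanishes there. *)
Lemma divide_zeros q rho f Z P : Adisc q rho f -> vanishes_on f Z -> forall js, NoDup js ->
  (forall j, In j js -> Z j = Some (P j) /\ Cmod (P j - q) < rho) ->
  exists H, Adisc q rho H /\ forall z, Cmod (z - q) <= rho -> f z = (lprod (fun j => z - P j) js * H z)%C.
Proof.
  intros hf hv js. induction js as [|j0 js IH]; intros hn hj.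
  - exists f. split; auto. intros. simpl. ring.
  - apply NoDup_cons_iff in hn as [hn1 hn2].
    destruct (hj j0 (or_introl eq_refl)) as [hZ0 hd0]. set (s0 := P j0) in *.
    assert (0 < rho) as hr by (pose proof (Cmod_ge_0 (s0 - q)); lra).
    destruct IH as (H & hH & E); auto. { intros; apply hj; simpl; auto. }
    set (b := fun j => if Ceq_dec (P j) s0 then true else false).
    set (js1 := filter b js). set (js2 := filter (fun j => negb (b j)) js).
    assert (forall j, In j js1 -> P j = s0) as e1.
    { intros j hj'. apply filter_In in hj' as [_ hb]. unfold b in hb. destruct (Ceq_dec (P j) s0); auto; discriminate. }
    assert (forall j, In j js2 -> P j <> s0) as e2.
    { intros j hj'. apply filter_In in hj' as [_ hb]. unfold b in hb. destruct (Ceq_dec (P j) s0); auto; discriminate. }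
    assert (zero_of_order_ge f s0 (S (length js1))) as ord.
    { apply (hv s0 (j0 :: js1)).
      - constructor; [|apply NoDup_filter; auto]. intros hi. apply filter_In in hi. tauto.
      - intros j [<-|hi]; auto. rewrite <- (e1 j hi). apply hj. right. apply filter_In in hi. tauto. }
    destruct (zero_order_div q rho f s0 _ hf hd0 ord) as (K & hK & EK).
    set (G := fun z => (lprod (fun j => z - P j) js2 * H z + (- (1)) * ((z - s0) * K z))%C).
    assert (forall j, Adisc q rho (fun z => z - P j)%C) as hl.
    { intros j. apply A_poly. apply ispoly_plus; [apply ispoly_id|apply ispoly_const]. }
    assert (Adisc q rho G) as hG.
    { apply A_plus. 
      - apply (A_mult q rho hr); auto. apply (A_lprod q rho (fun j z => z - P j)%C); auto.
      - apply (A_mult q rho hr); [apply A_poly, ispoly_const|]. apply (A_mult q rho hr); auto.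
        apply A_poly. apply ispoly_plus; [apply ispoly_id|apply ispoly_const]. }
    assert (G s0 = RtoC 0) as G0.
    { apply Cmod_small_0. intros eps he. apply (A_max q rho hr); auto; [lra|].
      intros z hz. 
      assert (z - s0 <> 0)%C as ne.
      { intros e. replace z with s0 in hz; [lra|]. replace z with (z - s0 + s0)%C by ring. rewrite e. ring. }
      assert (lprod (fun j => z - P j) js2 * H z = (z - s0) * K z)%C as C0.
      { apply Cmult_reg_l with ((z - s0) ^ length js1)%C; [apply Cpow_neq_0; auto|].
        rewrite <- (lprod_const (fun j => z - P j)%C _ js1) by (intros j hj'; rewrite (e1 j hj'); auto).
        rewrite Cmult_assoc. unfold js1, js2. rewrite <- lprod_filter, <- E by lra.
        rewrite EK, CpowS by lra. rewrite (lprod_const _ (z - s0)%C) by (intros j hj'; rewrite (e1 j hj'); auto).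
        unfold js1. ring. }
      unfold G. rewrite C0. replace ((z - s0) * K z + - (1) * ((z - s0) * K z))%C with (RtoC 0) by ring.
      rewrite Cmod_0. lra. }
    assert (H s0 = RtoC 0) as H0.
    { apply Cmult_reg_l with (lprod (fun j => s0 - P j)%C js2).
      - apply lprod_neq0. intros j hj' e. apply (e2 j hj'). replace (P j) with (s0 - (s0 - P j))%C by ring. rewrite e. ring.
      - rewrite Cmult_0_r. etransitivity; [|exact G0]. unfold G. replace (s0 - s0)%C with (RtoC 0) by ring. ring. }
    destruct (A_div q rho hr H s0 hH hd0 H0) as (H' & hH' & E').
    exists H'. split; auto. intros z hz. rewrite E, E' by auto. simpl. fold s0. ring.
Qed.

Lemma blaschke_identity r (a w : C) :
  Cmod (RtoC (r * r) - Cconj a * w) * Cmod (RtoC (r * r) - Cconj a * w) - r * r * (Cmod (w - a) * Cmod (w - a)) =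
  (r * r - Cmod a * Cmod a) * (r * r - Cmod w * Cmod w).
Proof. rewrite !Cmod_sqr. destruct a, w; simpl. ring. Qed.

(** Comparison of f h with a finite Blaschke product, whose factors b_j have modulus 1 on the circle and satisfy
    |b_j(s)|^2 <= 1 - c_j <= exp (- c_j); this is Jensen's inequality without logarithmic integrals. The
    multiplier h compensates the growth of f at the boundary. *)
Lemma jensen q rho f h Z P js M s c : Adisc q rho f -> Adisc q rho h -> vanishes_on f Z -> NoDup js ->
  (forall j, In j js -> Z j = Some (P j) /\ Cmod (P j - q) < rho) ->
  (forall z, Cmod (z - q) = rho -> Cmod (f z * h z) <= M) -> Cmod (s - q) < rho ->
  (forall j, In j js -> c j * (Cmod (RtoC (rho * rho) - Cconj (P j - q) * (s - q)) * Cmod (RtoC (rho * rho) - Cconj (P j - q) * (s - q)))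
     <= (rho * rho - Cmod (P j - q) * Cmod (P j - q)) * (rho * rho - Cmod (s - q) * Cmod (s - q))) ->
  exp (lsum c js / 2) * Cmod (f s * h s) <= M.
Proof.
  intros hf hh hv hn hj hM hs hc.
  assert (0 < rho) as hr by (pose proof (Cmod_ge_0 (s - q)); lra).
  assert (RtoC rho <> 0) as hr0 by (intros e; apply (f_equal fst) in e; simpl in e; lra).
  destruct (divide_zeros q rho f Z P hf hv js hn hj) as (H & hH & E).
  set (D := fun (j : nat) (z : C) => (/ rho * (RtoC (rho * rho) + (- Cconj (P j - q)) * (z + - q)))%C).
  assert (forall j, Adisc q rho (D j)) as hD.
  { intros j. apply A_poly. apply ispoly_scal. apply ispoly_plus; [apply ispoly_const|]. apply ispoly_scal.
    apply ispoly_plus; [apply ispoly_id|apply ispoly_const]. }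
  assert (forall j z, Cmod (D j z) = / rho * Cmod (RtoC (rho * rho) - Cconj (P j - q) * (z - q))) as hDm.
  { intros j z. unfold D. rewrite Cmod_mult, Cmod_inv, Cmod_R, Rabs_pos_eq by (auto; lra). f_equal. f_equal. ring. }
  assert (Cmod ((lprod (fun j => D j s) js * H s) * h s) <= M) as K.
  { apply (A_max q rho hr (fun z => (lprod (fun j => D j z) js * H z) * h z)%C); [|lra|].
    - apply (A_mult q rho hr); auto. apply (A_mult q rho hr); auto. apply (A_lprod q rho D); auto.
    - intros z hz. eapply Rle_trans; [|apply (hM z hz)]. rewrite E by lra. rewrite !Cmod_mult.
      apply Rmult_le_compat_r; [apply Cmod_ge_0|]. apply Rmult_le_compat_r; [apply Cmod_ge_0|].
      right. clear - hDm hz hr. induction js as [|j js IH]; simpl; auto. rewrite !Cmod_mult, IH. f_equal.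
      rewrite hDm. pose proof (blaschke_identity rho (P j - q) (z - q)) as B. rewrite hz in B.
      replace (z - q - (P j - q))%C with (z - P j)%C in B by ring.
      replace ((rho * rho - Cmod (P j - q) * Cmod (P j - q)) * (rho * rho - rho * rho)) with 0 in B by ring.
      set (x := Cmod (RtoC (rho * rho) - Cconj (P j - q) * (z - q))) in *.
      pose proof (Cmod_ge_0 (z - P j)). assert (0 <= x) by apply Cmod_ge_0.
      assert (x = rho * Cmod (z - P j)) as e.
      { assert (x * x = (rho * Cmod (z - P j)) * (rho * Cmod (z - P j))) by lra.
        apply Rsqr_inj; auto. apply Rmult_le_pos; lra. }
      rewrite e. field. lra. }
  eapply Rle_trans; [|apply K]. rewrite E by lra. rewrite !Cmod_mult.
  rewrite <- !Rmult_assoc. apply Rmult_le_compat_r; [apply Cmod_ge_0|]. apply Rmult_le_compat_r; [apply Cmod_ge_0|].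
  clear - hDm hr hc. induction js as [|j js IH]; simpl.
  - unfold Rdiv. rewrite Rmult_0_l, exp_0. lra.
  - rewrite !Cmod_mult. replace ((c j + lsum c js) / 2) with (c j / 2 + lsum c js / 2) by field.
    rewrite exp_plus.
    replace (exp (c j / 2) * exp (lsum c js / 2) * (Cmod (s - P j) * Cmod (lprod (fun j => s - P j)%C js)))
      with ((exp (c j / 2) * Cmod (s - P j)) * (exp (lsum c js / 2) * Cmod (lprod (fun j => s - P j)%C js))) by ring.
    pose proof (exp_pos (c j / 2)). pose proof (exp_pos (lsum c js / 2)).
    apply Rmult_le_compat.
    + apply Rmult_le_pos; [lra|apply Cmod_ge_0].
    + apply Rmult_le_pos; [lra|apply Cmod_ge_0].
    + rewrite hDm. pose proof (blaschke_identity rho (P j - q) (s - q)) as B.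
      replace (s - q - (P j - q))%C with (s - P j)%C in B by ring.
      specialize (hc j (or_introl eq_refl)).
      set (x := Cmod (RtoC (rho * rho) - Cconj (P j - q) * (s - q))) in *.
      assert (0 <= x) by apply Cmod_ge_0. pose proof (Cmod_ge_0 (s - P j)).
      pose proof (exp_ineq1_le (- c j)) as e1.
      assert (exp (c j / 2) * exp (c j / 2) * exp (- c j) = 1) as e2.
      { rewrite <- !exp_plus. replace (c j / 2 + c j / 2 + - c j) with 0 by field. apply exp_0. }
      set (y := exp (c j / 2)) in *. set (d := Cmod (s - P j)) in *.
      assert ((rho * d) * (rho * d) <= x * x * exp (- c j)).
      { assert (x * x * (1 - c j) <= x * x * exp (- c j)) by (apply Rmult_le_compat_l; nra). nra. }
      assert ((rho * d * y) * (rho * d * y) <= x * x).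
      { replace ((rho * d * y) * (rho * d * y)) with ((y * y) * ((rho * d) * (rho * d))) by ring.
        apply Rle_trans with ((y * y) * (x * x * exp (- c j))); [apply Rmult_le_compat_l; nra|].
        right. transitivity (x * x * (y * y * exp (- c j))); [ring|]. rewrite e2. ring. }
      assert (rho * d * y <= x).
      { apply Rsqr_incr_0; auto. repeat apply Rmult_le_pos; lra. }
      apply Rmult_le_reg_l with rho; auto. replace (rho * (/ rho * x)) with x by (field; lra). lra.
    + apply IH. intros; apply hc; simpl; auto.
Qed.

(** * Functions in the Hardy space *)

Lemma Cpow_diff (x y : C) (m : R) n : Cmod x <= m -> Cmod y <= m -> 1 <= m ->
  Cmod (x ^ n - y ^ n) <= INR n * (m ^ n * Cmod (x - y)).
Proof.
  intros hx hy hm. induction n.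
  - simpl. replace (RtoC 1 - 1)%C with (RtoC 0) by ring. rewrite Cmod_0. lra.
  - rewrite !CpowS. replace (x * x ^ n - y * y ^ n)%C with (x * (x ^ n - y ^ n) + y ^ n * (x - y))%C by ring.
    eapply Rle_trans; [apply Cmod_triangle|]. rewrite !Cmod_mult, Cmod_pow, S_INR.
    pose proof (Cmod_ge_0 x). pose proof (Cmod_ge_0 y). pose proof (Cmod_ge_0 (x - y)).
    assert (Cmod y ^ n <= m ^ n) by (apply pow_incr; lra).
    assert (1 <= m ^ n) by (apply pow_R1_Rle; auto).
    assert (Cmod x * Cmod (x ^ n - y ^ n) <= m * (INR n * (m ^ n * Cmod (x - y)))).
    { apply Rmult_le_compat; auto. apply Cmod_ge_0. }
    assert (Cmod y ^ n * Cmod (x - y) <= m ^ n * Cmod (x - y)) by (apply Rmult_le_compat_r; auto).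
    assert (m ^ n * Cmod (x - y) <= m * (m ^ n * Cmod (x - y))).
    { rewrite <- (Rmult_1_l (m ^ n * _)) at 1. apply Rmult_le_compat_r; auto. apply Rmult_le_pos; lra. }
    simpl. lra.
Qed.

(** The polynomials (1 + lam z / N)^N converge uniformly on the disc. *)
Lemma A_Cexp q rho lam : 0 < rho -> Adisc q rho (fun z => Cexp (RtoC lam * z)).
Proof.
  intros hr. set (r := Rabs lam * (rho + Cmod q)).
  assert (0 <= r) as hr0 by (apply Rmult_le_pos; [apply Rabs_pos|pose proof (Cmod_ge_0 q); lra]).
  apply A_lim with (f := fun n z => ((1 + RtoC (lam / INR (S n)) * z) ^ S n)%C).
  - intros n. apply A_pow; auto. apply A_poly. apply ispoly_plus; [apply ispoly_const|].
    apply ispoly_scal, ispoly_id.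
  - intros eps he.
    set (B := 4 * (r * r) * exp (2 * r)).
    assert (0 <= B) as hB by (unfold B; pose proof (exp_pos (2 * r)); apply Rmult_le_pos; nra).
    destruct (inv_INR_small (eps / (B + 1))) as [n hn]; [apply Rdiv_lt_0_compat; lra|].
    exists n. specialize (hn n (le_n _)). intros z hz.
    pose proof (INR_S_pos n) as hN. set (N := INR (S n)) in *.
    set (u := (RtoC (lam / N) * z)%C).
    assert (Cmod u <= r / N) as hu.
    { unfold u. rewrite Cmod_mult, Cmod_R. unfold Rdiv. rewrite Rabs_mult, (Rabs_pos_eq (/ N)) by (left; apply Rinv_0_lt_compat; auto).
      unfold r. assert (Cmod z <= rho + Cmod q).
      { replace z with ((z - q) + q)%C by ring. eapply Rle_trans; [apply Cmod_triangle|]. lra. }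
      replace (Rabs lam * (rho + Cmod q) * / N) with (Rabs lam * / N * (rho + Cmod q)) by ring.
      apply Rmult_le_compat_l; auto. apply Rmult_le_pos; [apply Rabs_pos|left; apply Rinv_0_lt_compat; auto]. }
    assert (Cexp (RtoC lam * z) = Cexp u ^ S n)%C as E.
    { rewrite <- Cexp_mult_nat. f_equal. unfold u, N. rewrite Cmult_assoc, <- RtoC_mult. f_equal. f_equal. field.
      apply not_0_INR; lia. }
    rewrite E.
    assert (0 <= r / N) as hrN by (apply Rdiv_le_0_compat; auto).
    assert (r / N <= r) as hrN2.
    { unfold Rdiv. rewrite <- (Rmult_1_r r) at 2. apply Rmult_le_compat_l; auto.
      rewrite <- Rinv_1. apply Rinv_le_contravar; [lra|]. unfold N. rewrite S_INR. pose proof (pos_INR n). lra. }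
    assert (forall x y, x <= y -> exp x <= exp y) as expm.
    { intros x y h. destruct h as [h|h]; [left; apply exp_increasing; auto|rewrite h; lra]. }
    rewrite Cmod_minus_sym.
    eapply Rle_trans; [apply (Cpow_diff _ _ (exp (r / N)))|].
    + rewrite Cmod_Cexp. apply expm. eapply Rle_trans; [apply Rle_abs|]. eapply Rle_trans; [apply Re_le_Cmod|auto].
    + eapply Rle_trans; [apply Cmod_triangle|]. rewrite Cmod_1. pose proof (exp_ineq1_le (r / N)). lra.
    + pose proof (exp_ineq1_le (r / N)). lra.
    + assert (exp (r / N) ^ S n = exp r) as E2.
      { rewrite <- Rpower_pow by apply exp_pos. unfold Rpower. rewrite ln_exp. f_equal. fold N. field. lra. }
      rewrite E2. fold N.
      pose proof (Cexp_quad u) as Q.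
      replace (Cexp u - (1 + u))%C with (Cexp u - 1 - u)%C by ring.
      assert (Cmod (Cexp u - 1 - u) <= 4 * (r / N * (r / N)) * exp r).
      { eapply Rle_trans; [apply Q|]. pose proof (Cmod_ge_0 u). apply Rmult_le_compat; [nra|left; apply exp_pos|nra|apply expm; lra]. }
      apply Rle_trans with (N * (exp r * (4 * (r / N * (r / N)) * exp r))).
      * apply Rmult_le_compat_l; [lra|]. apply Rmult_le_compat_l; [left; apply exp_pos|auto].
      * assert (exp r * exp r = exp (2 * r)) as E3 by (rewrite <- exp_plus; f_equal; ring).
        replace (N * (exp r * (4 * (r / N * (r / N)) * exp r))) with (4 * (r * r) * (exp r * exp r) * / N) by (field; lra).
        rewrite E3. fold B.
        apply Rle_trans with (B * (eps / (B + 1))); [apply Rmult_le_compat_l; auto|].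
        apply Rmult_le_reg_r with (B + 1); [lra|]. replace (B * (eps / (B + 1)) * (B + 1)) with (B * eps) by (field; lra). nra.
Qed.

Lemma A_dsum q rho a N : 0 < rho -> Adisc q rho (dsum a N).
Proof.
  intros hr. unfold dsum. induction N; simpl.
  - apply A_poly. apply (ispoly_const 0).
  - apply (A_plus q rho (fun s => csum (fun n => a n * Cexp (RtoC (- lnS n) * s))%C N)); auto.
    apply (A_mult q rho hr); [apply A_poly, ispoly_const|]. apply A_Cexp; auto.
Qed.

Lemma Cmod_Cexp_lnS n s : Cmod (Cexp (RtoC (- lnS n) * s)) = npw (Re s) n.
Proof. rewrite Cmod_Cexp. unfold npw, Rpower, lnS. f_equal. simpl. unfold Re, Im. ring. Qed.

Lemma lnS_step n : 0 <= lnS (S n) - lnS n <= / INR (S n).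
Proof.
  pose proof (INR_S_pos n). pose proof (INR_S_pos (S n)). unfold lnS. split.
  - assert (ln (INR (S n)) <= ln (INR (S (S n)))); [|lra]. apply ln_le; auto. apply le_INR. lia.
  - pose proof (exp_ineq1_le (ln (INR (S (S n))) - ln (INR (S n)))) as K.
    unfold Rminus in K. rewrite exp_plus, exp_Ropp, !exp_ln in K by auto.
    assert (INR (S (S n)) * / INR (S n) = 1 + / INR (S n)).
    { rewrite (S_INR (S n)). field. lra. }
    lra.
Qed.

Lemma npw_anti x y n : x <= y -> npw y n <= npw x n.
Proof.
  intros h. unfold npw. apply Rle_Rpower; [|lra]. rewrite S_INR. pose proof (pos_INR n). lra.
Qed.

Lemma npw_le_1 y n : 0 <= y -> npw y n <= 1.
Proof.
  intros h. eapply Rle_trans; [apply (npw_anti 0 y n h)|]. unfold npw. rewrite Ropp_0, Rpower_O; [lra|apply INR_S_pos].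
Qed.

Lemma npw_plus x y n : npw (x + y) n = npw x n * npw y n.
Proof. unfold npw. rewrite <- Rpower_plus. f_equal. ring. Qed.

Lemma npw_1 n : npw 1 n = / INR (S n).
Proof. unfold npw. rewrite Rpower_Ropp, Rpower_1; auto. apply INR_S_pos. Qed.

(** Abel summation against n^{-(s - s0)}, whose increments are of order n^{-1-eta}, uniformly in s. *)
Lemma dsum_abel a s0 l eta W : clim (fun N => dsum a N s0) l -> 0 < eta -> 0 <= W ->
  forall eps, 0 < eps -> exists N, forall m s, (N <= m)%nat -> Re s0 + eta <= Re s -> Cmod (s - s0) <= W ->
    Cmod (dsum a m s - dsum a N s) <= eps.
Proof.
  intros hl heta hW eps he.
  set (C0 := 5 * W * exp (2 * W)). assert (0 <= C0) as hC0 by (unfold C0; pose proof (exp_pos (2 * W)); nra).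
  set (z := (1 + eta) / (1 + eta - 1)). assert (0 <= z) as hz by (apply Rdiv_le_0_compat; lra).
  set (e := eps / (1 + C0 * z)). assert (0 <= C0 * z) as hCz by (apply Rmult_le_pos; auto).
  assert (0 < e) as he0 by (apply Rdiv_lt_0_compat; lra).
  destruct (hl (e / 2)) as [N hN]; [lra|]. exists N. intros m s hm hs hW'.
  set (T := fun n => (dsum a n s0 - dsum a N s0)%C).
  assert (forall n, (N <= n)%nat -> Cmod (T n) <= e) as hT.
  { intros n hn. unfold T. pose proof (hN n hn). pose proof (hN N (le_n _)).
    pose proof (Cmod_tri3 (dsum a n s0) l (dsum a N s0)). rewrite (Cmod_minus_sym l) in H1. lra. }
  set (w := (s - s0)%C). set (v := fun n => Cexp (RtoC (- lnS n) * w)).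
  set (X := fun n => (T (S n) * (v n - v (S n)))%C).
  assert (eta <= Re w) as hw by (unfold w; simpl; unfold Re in *; lra).
  assert (forall m, (N <= m)%nat -> dsum a m s - dsum a N s = T m * v m + (csum X m - csum X N))%C as E.
  { clear m hm. intros m hm. induction hm as [|m hm IH].
    - unfold T. ring.
    - assert (dsum a (S m) s = dsum a m s + a m * (Cexp (RtoC (- lnS m) * s0) * v m))%C as E1.
      { unfold dsum; simpl. f_equal. f_equal. unfold v, w. rewrite <- Cexp_add. f_equal. ring. }
      assert (T (S m) = T m + a m * Cexp (RtoC (- lnS m) * s0))%C as E2.
      { unfold T, dsum; simpl. ring. }
      simpl csum. rewrite E1.
      transitivity ((dsum a m s - dsum a N s) + a m * (Cexp (RtoC (- lnS m) * s0) * v m))%C; [ring|].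
      rewrite IH. assert (X m = T (S m) * (v m - v (S m)))%C as EX by reflexivity. rewrite EX, E2. ring. }
  rewrite E by auto. eapply Rle_trans; [apply Cmod_triangle|].
  assert (Cmod (T m * v m) <= e * 1).
  { rewrite Cmod_mult. apply Rmult_le_compat; try apply Cmod_ge_0; auto. unfold v. rewrite Cmod_Cexp_lnS. apply npw_le_1. lra. }
  assert (Cmod (csum X m - csum X N) <= e * C0 * z).
  { eapply Rle_trans; [apply (csum_tail X (fun n => e * C0 * npw (1 + eta) n) N m hm)|].
    - intros n hn. unfold X. rewrite Cmod_mult, Rmult_assoc. apply Rmult_le_compat; try apply Cmod_ge_0; [apply hT; lia|].
      pose proof (lnS_step n) as [d0 d1]. set (d := lnS (S n) - lnS n) in *.
      assert (v n - v (S n) = v n * (- (Cexp (RtoC (- d) * w) - 1)))%C as E1.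
      { replace (v (S n)) with (v n * Cexp (RtoC (- d) * w))%C; [ring|]. unfold v. rewrite <- Cexp_add. f_equal.
        unfold d. csolve. }
      rewrite E1, Cmod_mult, Cmod_opp.
      assert (Cmod (RtoC (- d) * w) <= W * / INR (S n)) as dw.
      { rewrite Cmod_mult, Cmod_R, Rabs_Ropp, Rabs_pos_eq by auto. rewrite Rmult_comm. apply Rmult_le_compat; auto. apply Cmod_ge_0. }
      assert (/ INR (S n) <= 1) as i1.
      { rewrite <- Rinv_1. apply Rinv_le_contravar; [lra|]. rewrite S_INR. pose proof (pos_INR n). lra. }
      pose proof (INR_S_pos n) as i0. apply Rinv_0_lt_compat in i0.
      assert (Cmod (Cexp (RtoC (- d) * w) - 1) <= C0 * / INR (S n)).
      { eapply Rle_trans; [apply Cexp_lin|]. unfold C0.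
        replace (5 * W * exp (2 * W) * / INR (S n)) with (5 * (W * / INR (S n)) * exp (2 * W)) by ring.
        apply Rmult_le_compat.
        - pose proof (Cmod_ge_0 (RtoC (- d) * w)). lra.
        - left; apply exp_pos.
        - lra.
        - assert (2 * Cmod (RtoC (- d) * w) <= 2 * W) as [h|h] by nra; [left; apply exp_increasing; auto|rewrite h; lra]. }
      rewrite npw_plus, npw_1.
      replace (C0 * (/ INR (S n) * npw eta n)) with (npw eta n * (C0 * / INR (S n))) by ring.
      apply Rmult_le_compat; try apply Cmod_ge_0; auto. unfold v. rewrite Cmod_Cexp_lnS. apply npw_anti; auto.
    - rewrite !rsum_scal. pose proof (npw_sum (1 + eta) m ltac:(lra)) as K. fold z in K.
      assert (0 <= rsum (npw (1 + eta)) N) by (apply rsum_pos; intros; left; apply npw_pos).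
      assert (0 <= e * C0) by (apply Rmult_le_pos; lra). nra. }
  assert (e * (1 + C0 * z) = eps) by (unfold e; field; lra). nra.
Qed.

Section DirichletSeries.

Variables (a : nat -> C) (f : C -> C).
Hypothesis conv : forall s, in_half_plane s -> clim (fun N => dsum a N s) (f s).

(** On the disc the partial sums converge uniformly, by Abel summation. *)
Lemma series_A q rho : 0 < rho -> rho < Re q - 1 / 2 -> Adisc q rho f.
Proof.
  intros hr hq. set (eta := (Re q - 1 / 2 - rho) / 2). assert (0 < eta) as heta by (unfold eta; lra).
  set (s0 := (1 / 2 + eta, 0) : C).
  assert (in_half_plane s0) as hs0 by (unfold in_half_plane, s0; simpl; lra).
  assert (forall s, Cmod (s - q) <= rho -> Re s0 + eta <= Re s) as hre.
  { intros s hs. pose proof (Re_le_Cmod (s - q)) as K. apply Rabs_le_between in K. simpl in K. unfold s0, eta. simpl. unfold Re in *. lra. }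
  apply A_lim with (f := fun N => dsum a N); [intros; apply A_dsum; auto|].
  intros eps he.
  destruct (dsum_abel a s0 (f s0) eta (rho + Cmod (q - s0)) (conv s0 hs0) heta) with (eps := eps) as [N hN]; auto.
  { pose proof (Cmod_ge_0 (q - s0)). lra. }
  exists N. intros s hs. rewrite Cmod_minus_sym.
  apply clim_le with (u := fun m => (dsum a m s - dsum a N s)%C).
  - apply (clim_plus _ (fun _ => - dsum a N s)%C); [|apply clim_const]. apply conv.
    unfold in_half_plane. specialize (hre s hs). unfold s0 in hre. simpl in hre. lra.
  - exists N. intros m hm. apply hN; auto.
    pose proof (Cmod_triangle (s - q) (q - s0)) as T. replace (s - q + (q - s0))%C with (s - s0)%C in T by ring. lra.
Qed.

Lemma coef_growth : exists A, 0 < A /\ forall n, Cmod (a n) <= A * INR (S n).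
Proof.
  assert (in_half_plane (1, 0)) as h1 by (unfold in_half_plane; simpl; lra).
  destruct (conv (1, 0) h1 1) as [N hN]; [lra|].
  set (B := rsum (fun n => Cmod (a n)) N).
  assert (forall n, (n < N)%nat -> Cmod (a n) <= B) as hB.
  { intros n hn. apply Rle_trans with (rsum (fun n => Cmod (a n)) (S n)).
    - simpl. pose proof (rsum_pos (fun n => Cmod (a n)) n (fun k => Cmod_ge_0 (a k))). lra.
    - apply rsum_mono; auto. intros; apply Cmod_ge_0. }
  assert (0 <= B) by (apply rsum_pos; intros; apply Cmod_ge_0).
  exists (B + 2). split; [lra|]. intros n.
  assert (1 <= INR (S n)) by (rewrite S_INR; pose proof (pos_INR n); lra).
  destruct (Nat.lt_ge_cases n N) as [h|h].
  - specialize (hB n h). nra.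
  - pose proof (hN n h) as k1. pose proof (hN (S n) ltac:(lia)) as k2.
    assert (Cmod (a n * Cexp (RtoC (- lnS n) * (1, 0))) <= 2) as K.
    { replace (a n * Cexp (RtoC (- lnS n) * (1, 0)))%C with (dsum a (S n) (1, 0) - dsum a n (1, 0))%C by (unfold dsum; simpl; ring).
      pose proof (Cmod_tri3 (dsum a (S n) (1, 0)) (f (1, 0)) (dsum a n (1, 0))) as T.
      rewrite (Cmod_minus_sym (f (1, 0))) in T. lra. }
    rewrite Cmod_mult, Cmod_Cexp_lnS in K. simpl Re in K. rewrite npw_1 in K.
    assert (Cmod (a n) = Cmod (a n) * / INR (S n) * INR (S n)) by (field; lra).
    rewrite H1. apply Rmult_le_compat_r; lra.
Qed.

(** The first non-zero term dominates far to the right. *)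
Lemma nonvanishing_right : (exists n, a n <> RtoC 0) -> exists s1, 1 / 2 < s1 /\ forall s, s1 <= Re s -> f s <> RtoC 0.
Proof.
  intros hex.
  assert (exists m, a m <> RtoC 0 /\ forall n, (n < m)%nat -> a n = RtoC 0) as (m & hm & hmin).
  { destruct hex as [n hn]. revert hn. induction n as [n IH] using (well_founded_induction lt_wf). intros hn.
    destruct (classic (exists k, (k < n)%nat /\ a k <> RtoC 0)) as [(k & hk & hk')|h].
    - eauto.
    - exists n. split; auto. intros k hk. destruct (Ceq_dec (a k) (RtoC 0)); auto. exfalso. eauto. }
  destruct coef_growth as (A & hA & hgr).
  assert (0 < Cmod (a m)) as ham by (apply Cmod_gt_0; auto).
  set (dl := lnS (S m) - lnS m).
  assert (0 < dl) as hdl.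
  { unfold dl, lnS. assert (ln (INR (S m)) < ln (INR (S (S m)))); [|lra]. apply ln_increasing; [apply INR_S_pos|].
    rewrite (S_INR (S m)). lra. }
  set (Kc := 2 * A / (Cmod (a m) * npw 3 m)).
  assert (0 < Kc) as hKc by (apply Rdiv_lt_0_compat; [lra|apply Rmult_lt_0_compat; auto; apply npw_pos]).
  exists (3 + Rmax 0 (Kc / dl)). split; [pose proof (Rmax_l 0 (Kc / dl)); lra|].
  intros s hs h0. set (tau := Re s - 3).
  pose proof (Rmax_l 0 (Kc / dl)). pose proof (Rmax_r 0 (Kc / dl)).
  assert (0 <= tau) as htau by (unfold tau; lra).
  assert (Kc <= tau * dl) as hK.
  { apply Rle_trans with (Kc / dl * dl); [right; field; lra|]. apply Rmult_le_compat_r; unfold tau; lra. }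
  assert (dsum a (S m) s = a m * Cexp (RtoC (- lnS m) * s))%C as E.
  { unfold dsum. simpl. rewrite (csum_ext _ (fun _ => RtoC 0)), csum_0; [ring|]. intros k hk. rewrite hmin by auto. ring. }
  assert (Cmod (f s - dsum a (S m) s) <= A * (npw tau (S m) * 2)) as T.
  { assert (in_half_plane s) as hh by (unfold in_half_plane, tau in *; lra).
    apply (clim_tail _ (fun n => A * (npw tau (S m) * npw 2 n)) (f s) _ (S m)); [| |exact (conv s hh)].
    - intros k hk. rewrite Cmod_mult, Cmod_Cexp_lnS.
      replace (Re s) with (tau + (2 + 1)) by (unfold tau; ring). rewrite !npw_plus, npw_1.
      assert (npw tau k <= npw tau (S m)).
      { unfold npw. rewrite !Rpower_Ropp. apply Rinv_le_contravar; [apply exp_pos|]. apply Rle_Rpower_l; auto.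
        split; [apply INR_S_pos|]. apply le_INR. lia. }
      pose proof (npw_pos tau k). pose proof (npw_pos 2 k). specialize (hgr k). pose proof (INR_S_pos k).
      replace (Cmod (a k) * (npw tau k * (npw 2 k * / INR (S k)))) with (Cmod (a k) * / INR (S k) * (npw tau k * npw 2 k)) by ring.
      pose proof (Rinv_0_lt_compat _ H4).
      apply Rmult_le_compat.
      + apply Rmult_le_pos; [apply Cmod_ge_0|lra].
      + apply Rmult_le_pos; lra.
      + apply Rmult_le_reg_r with (INR (S k)); auto. rewrite Rmult_assoc, Rinv_l; lra.
      + apply Rmult_le_compat_r; lra.
    - intros n hn. rewrite !rsum_scal.
      pose proof (npw_sum 2 n ltac:(lra)) as K.
      assert (0 <= rsum (npw 2) (S m)) by (apply rsum_pos; intros; left; apply npw_pos).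
      pose proof (npw_pos tau (S m)).
      assert (npw tau (S m) * (rsum (npw 2) n - rsum (npw 2) (S m)) <= npw tau (S m) * 2) by (apply Rmult_le_compat_l; lra).
      assert (A * (npw tau (S m) * (rsum (npw 2) n - rsum (npw 2) (S m))) <= A * (npw tau (S m) * 2)) by (apply Rmult_le_compat_l; lra).
      lra. }
  rewrite h0, E in T. rewrite Cmod_minus_sym in T.
  replace (a m * Cexp (RtoC (- lnS m) * s) - 0)%C with (a m * Cexp (RtoC (- lnS m) * s))%C in T by ring.
  rewrite Cmod_mult, Cmod_Cexp_lnS in T. replace (Re s) with (3 + tau) in T by (unfold tau; ring). rewrite npw_plus in T.
  assert (npw tau m = exp (tau * dl) * npw tau (S m)) as E2.
  { unfold npw, Rpower. rewrite <- exp_plus. f_equal. unfold dl, lnS. ring. }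
  rewrite E2 in T. pose proof (npw_pos tau (S m)) as pp. pose proof (npw_pos 3 m) as p3.
  assert (Cmod (a m) * npw 3 m * exp (tau * dl) <= 2 * A).
  { apply Rmult_le_reg_r with (npw tau (S m)); auto. lra. }
  pose proof (exp_ineq1_le (tau * dl)).
  assert (Cmod (a m) * npw 3 m * Kc = 2 * A) by (unfold Kc; field; lra).
  assert (0 < Cmod (a m) * npw 3 m) by (apply Rmult_lt_0_compat; auto).
  nra.
Qed.

Lemma nontrivial_coef : nontrivial f -> exists n, a n <> RtoC 0.
Proof.
  intros (s & hs & hne). apply NNPP. intros H. apply hne.
  apply clim_unique with (u := fun N => dsum a N s); [auto|].
  apply clim_ext with (u := fun _ => RtoC 0); [|apply clim_const].
  intros N. unfold dsum. rewrite (csum_ext _ (fun _ => RtoC 0)), csum_0; auto.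
  intros k _. destruct (Ceq_dec (a k) (RtoC 0)) as [->|ne]; [ring|]. exfalso. eauto.
Qed.

End DirichletSeries.

(** The identity theorem: h is divisible by (z - q)^k for every k, and the quotient is bounded by a constant
    times rho^{-k}. *)
Lemma A_identity q rho r h : 0 < r < rho -> Adisc q rho h -> (forall z, Cmod (z - q) <= r -> h z = RtoC 0) ->
  forall z, Cmod (z - q) < rho -> h z = RtoC 0.
Proof.
  intros hr hh h0 z hz. assert (0 < rho) as hrho by lra.
  destruct (A_bounded q rho hrho h hh) as (B & hB0 & hB).
  assert (Cmod (q - q) = 0) as Eq by (replace (q - q)%C with (RtoC 0) by ring; apply Cmod_0).
  assert (forall k, exists g, Adisc q rho g /\ forall z, Cmod (z - q) <= rho -> h z = ((z - q) ^ k * g z)%C) as K.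
  { induction k as [|k (g & hg & E)].
    - exists h. split; auto. intros; simpl; ring.
    - assert (g q = RtoC 0) as gq.
      { apply Cmod_small_0. intros eps he. apply (A_max q r ltac:(lra)); [apply A_smaller with rho; auto; lra|lra|].
        intros w hw. assert (g w = RtoC 0) as ->; [|rewrite Cmod_0; lra].
        apply Cmult_reg_l with ((w - q) ^ k)%C; [apply Cpow_neq_0, Cmod_gt_0; lra|].
        rewrite <- E, h0 by lra. ring. }
      destruct (A_div q rho hrho g q hg ltac:(lra) gq) as (g' & hg' & E').
      exists g'. split; auto. intros w hw. rewrite E, E', CpowS by auto. ring. }
  apply Cmod_small_0. intros eps he.
  set (x := Cmod (z - q)) in *. assert (0 <= x) as hx by apply Cmod_ge_0.
  destruct (bernoulli_unbounded (2 * rho / (rho + x)) (B / eps)) as [n hn].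
  { apply Rmult_lt_reg_r with (rho + x); [lra|]. unfold Rdiv. rewrite Rmult_assoc, Rinv_l; lra. }
  destruct (K n) as (g & hg & E). rewrite E by (fold x; lra). rewrite Cmod_mult, Cmod_pow. fold x.
  assert (Cmod (g z) <= B / rho ^ n) as Kg.
  { apply (A_max q rho hrho); auto; [fold x; lra|]. intros w hw.
    assert (0 < rho ^ n) by (apply pow_lt; auto).
    specialize (hB w ltac:(lra)). rewrite E, Cmod_mult, Cmod_pow, hw in hB by lra.
    apply Rmult_le_reg_l with (rho ^ n); auto. replace (rho ^ n * (B / rho ^ n)) with B by (field; lra). auto. }
  assert (0 < rho ^ n) by (apply pow_lt; auto). assert (0 <= x ^ n) by (apply pow_le; auto).
  apply Rle_trans with (x ^ n * (B / rho ^ n)); [apply Rmult_le_compat_l; auto|].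
  assert (B < eps * (2 * rho / (rho + x)) ^ n).
  { apply Rmult_lt_reg_r with (/ eps); [apply Rinv_0_lt_compat; auto|].
    replace (eps * (2 * rho / (rho + x)) ^ n * / eps) with ((2 * rho / (rho + x)) ^ n) by (field; lra). exact hn. }
  assert (x ^ n * (2 * rho / (rho + x)) ^ n <= rho ^ n).
  { rewrite <- Rpow_mult_distr. apply pow_incr. split.
    - apply Rmult_le_pos; auto. apply Rdiv_le_0_compat; lra.
    - apply Rmult_le_reg_r with (rho + x); [lra|]. replace (x * (2 * rho / (rho + x)) * (rho + x)) with (2 * rho * x) by (field; lra). nra. }
  apply Rmult_le_reg_r with (rho ^ n); auto. replace (x ^ n * (B / rho ^ n) * rho ^ n) with (x ^ n * B) by (field; lra).
  assert (x ^ n * B <= x ^ n * (eps * (2 * rho / (rho + x)) ^ n)) by (apply Rmult_le_compat_l; lra). nra.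
Qed.

Lemma dp_coef_big P n : (dp_deg P <= n)%nat -> dp_coef P (S n) = RtoC 0.
Proof.
  intros h. unfold dp_coef. replace (S n <=? dp_deg P)%nat with false by (symmetry; apply Nat.leb_gt; lia).
  rewrite Bool.andb_false_r. auto.
Qed.

Lemma dp_eval_big P s M : (dp_deg P <= M)%nat -> dp_eval P s = dsum (fun n => dp_coef P (S n)) M s.
Proof.
  intros h. rewrite dp_eval_dsum. induction h; auto. unfold dsum in *. simpl. rewrite <- IHh, dp_coef_big by auto. ring.
Qed.

Lemma dp_coef_minus P Q n : dp_coef (dp_minus P Q) (S n) = (dp_coef P (S n) - dp_coef Q (S n))%C.
Proof.
  unfold dp_coef at 1. simpl dp_deg. simpl dp_seq.
  destruct (Nat.leb_spec (S n) (Nat.max (dp_deg P) (dp_deg Q))) as [h|h]; simpl andb; auto.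
  rewrite !dp_coef_big by lia. ring.
Qed.

Lemma dp_eval_minus P Q s : dp_eval (dp_minus P Q) s = (dp_eval P s - dp_eval Q s)%C.
Proof.
  set (M := Nat.max (dp_deg P) (dp_deg Q)).
  rewrite (dp_eval_big P s M), (dp_eval_big Q s M), (dp_eval_big (dp_minus P Q) s M) by (unfold M; simpl; lia).
  unfold dsum. rewrite <- csum_minus. apply csum_ext. intros. rewrite dp_coef_minus. ring.
Qed.

Lemma zeta_factor x c : 0 < c <= x -> 1 / 2 < x + 1 / 2 -> 2 * (x + 1 / 2) / (2 * (x + 1 / 2) - 1) <= 1 + / c.
Proof.
  intros h _. replace (2 * (x + 1 / 2) / (2 * (x + 1 / 2) - 1)) with (1 + / (2 * x)) by (field; lra).
  apply Rplus_le_compat_l. apply Rinv_le_contravar; lra.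
Qed.

(** By the bound for point evaluations, the Dirichlet polynomials P_k converge locally uniformly on the half-plane.
    Far to the right their limit is f, because the coefficients converge uniformly, and the identity
    theorem extends this to the half-plane. The growth of f is that of f - P_K for one fixed K. *)
Lemma Hp_function p f : 1 <= p < 2 -> in_Hp p f -> nontrivial f ->
  (forall q rho, 0 < rho -> rho < Re q - 1 / 2 -> Adisc q rho f) /\
  (exists G, 0 < G /\ forall s, in_half_plane s -> Cmod (f s) <= G * (1 + / (Re s - 1 / 2))) /\
  (exists s1, 1 / 2 < s1 /\ forall s, s1 <= Re s -> f s <> RtoC 0).
Proof.
  intros hp (a' & (P & hP & ha) & hf) hnt.
  set (a := fun n => a' (S n)).
  assert (forall s, in_half_plane s -> clim (fun N => dsum a N s) (f s)) as conv.
  { intros s hs. pose proof (proj1 (is_series_clim _ _) (hf s hs)) as K.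
    eapply clim_ext; [|exact K]. intros n. apply csum_ext. intros k _. rewrite npow_opp_exp. auto. }
  pose proof (series_A a f conv) as hA.
  split; [exact hA|]. split; [|apply (nonvanishing_right a f conv), (nontrivial_coef a f conv hnt)].
  assert (forall k l s c, 0 < c <= Re s - 1 / 2 ->
    Cmod (dp_eval (P k) s - dp_eval (P l) s) <= 4 * (1 + / c) * Hp_norm p (dp_minus (P k) (P l))) as hdiff.
  { intros k l s c hc. rewrite <- dp_eval_minus. eapply Rle_trans; [apply (point_eval p); auto; lra|].
    apply Rmult_le_compat_r; [apply Hp_norm_pos; auto|]. apply Rmult_le_compat_l; [lra|].
    replace (Re s) with ((Re s - 1 / 2) + 1 / 2) by ring. apply zeta_factor; lra. }
  (* far to the right the convergence of coefficients is enough *)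
  assert (forall s, 2 <= Re s -> clim (fun k => dp_eval (P k) s) (f s)) as right.
  { intros s hs eps he. destruct (hP (eps / 4)) as [K hK]; [lra|]. exists K. intros k hk.
    apply Rle_lt_trans with (eps / 2); [|lra]. rewrite Cmod_minus_sym.
    assert (in_half_plane s) as hh by (unfold in_half_plane; lra).
    apply clim_le with (u := fun N => (dsum a N s - dsum (fun n => dp_coef (P k) (S n)) (Nat.max N (dp_deg (P k))) s)%C).
    - apply (clim_plus _ (fun N => - dsum (fun n => dp_coef (P k) (S n)) (Nat.max N (dp_deg (P k))) s)%C); [apply conv; auto|].
      apply clim_ext with (u := fun _ => (- dp_eval (P k) s)%C); [|apply clim_const].
      intros N. rewrite <- dp_eval_big by lia. auto.
    - exists (dp_deg (P k)). intros N hN. replace (Nat.max N (dp_deg (P k))) with N by lia.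
      unfold dsum. rewrite <- csum_minus.
      apply Rle_trans with (rsum (fun n => eps / 4 * npw 2 n) N).
      + apply Cmod_csum_le. intros n _.
        replace (a n * Cexp (RtoC (- lnS n) * s) - dp_coef (P k) (S n) * Cexp (RtoC (- lnS n) * s))%C
          with ((a n - dp_coef (P k) (S n)) * Cexp (RtoC (- lnS n) * s))%C by ring.
        rewrite Cmod_mult, Cmod_Cexp_lnS. apply Rmult_le_compat; try apply Cmod_ge_0; try (left; apply npw_pos); try (apply npw_anti; auto).
        apply clim_le with (u := fun l => (dp_coef (P l) (S n) - dp_coef (P k) (S n))%C).
        * apply (clim_plus _ (fun _ => - dp_coef (P k) (S n))%C); [|apply clim_const].
          apply clim_filterlim. apply ha. lia.
        * exists K. intros l hl. rewrite <- dp_coef_minus. eapply Rle_trans; [apply (coef_bound p); auto|]. left. apply hK; auto.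
      + rewrite rsum_scal. pose proof (npw_sum 2 N ltac:(lra)). nra. }
  assert (forall s, in_half_plane s -> clim (fun k => dp_eval (P k) s) (f s)) as lim.
  { intros s hs. unfold in_half_plane in hs. set (x := Re s - 1 / 2). assert (0 < x) as hx by (unfold x; lra).
    set (R := x + 4). set (q := (1 / 2 + R, Im s) : C). set (rho := R - x / 2).
    assert (0 < rho) as hr by (unfold rho, R; lra).
    assert (forall z r, Cmod (z - q) <= r -> R - r <= Re z - 1 / 2) as hre.
    { intros z r hz. pose proof (Re_le_Cmod (z - q)) as K. apply Rabs_le_between in K. unfold q in K. simpl in K. fold q in K. unfold Re in *. lra. }
    destruct (A_complete q rho (fun k => dp_eval (P k))) as (G & hG & hlim & _).
    - intros k. apply A_ext with (f := dsum (fun n => dp_coef (P k) (S n)) (dp_deg (P k))); [intros; now rewrite dp_eval_dsum|].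
      apply A_dsum; auto.
    - intros eps he. set (c := 4 * (1 + / (x / 2))).
      assert (0 < / (x / 2)) by (apply Rinv_0_lt_compat; lra).
      assert (0 < c) as hc by (unfold c; lra).
      destruct (hP (eps / c)) as [K hK]; [apply Rdiv_lt_0_compat; lra|].
      exists K. intros n m hn hm z hz. eapply Rle_trans; [apply (hdiff n m z (x / 2))|].
      + specialize (hre z rho hz). unfold rho in hre. lra.
      + fold c. specialize (hK n m hn hm). apply Rle_trans with (c * (eps / c)); [apply Rmult_le_compat_l; lra|].
        right. field. lra.
    - assert (Cmod (s - q) = 4) as Es.
      { replace (s - q)%C with (RtoC (-4)) by (apply C_ext; simpl; unfold R, x, Re, Im in *; ring).
        rewrite Cmod_R, Rabs_left; lra. }
      assert (Cmod (s - q) < rho) as hs' by (unfold rho, R in *; lra).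
      assert (G s + (- (1)) * f s = RtoC 0)%C as Z0.
      { apply (A_identity q rho 1 (fun z => G z + (- (1)) * f z)%C); [unfold rho, R; lra| | |auto].
        - apply A_plus; auto. apply (A_mult q rho hr); [apply A_poly, ispoly_const|]. apply hA; auto.
          simpl. unfold rho, R. lra.
        - intros z hz. assert (G z = f z) as ->; [|ring].
          apply clim_unique with (u := fun k => dp_eval (P k) z); [apply hlim; unfold rho, R; lra|].
          apply right. specialize (hre z 1 hz). unfold R in hre. lra. }
      replace (f s) with (G s) by (replace (G s) with ((G s + (- (1)) * f s) + f s)%C by ring; rewrite Z0; ring).
      apply hlim. lra. }
  destruct (hP 1) as [K hK]; [lra|].
  set (c := rsum (fun n => Cmod (dp_coef (P K) (S n))) (dp_deg (P K))).
  assert (0 <= c) as hc by (apply rsum_pos; intros; apply Cmod_ge_0).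
  exists (c + 4). split; [lra|]. intros s hs. unfold in_half_plane in hs.
  assert (0 < / (Re s - 1 / 2)) as hi by (apply Rinv_0_lt_compat; lra).
  assert (Cmod (dp_eval (P K) s) <= c) as h1.
  { rewrite dp_eval_dsum. apply Cmod_csum_le. intros n _. rewrite Cmod_mult, Cmod_Cexp_lnS.
    rewrite <- (Rmult_1_r (Cmod (dp_coef (P K) (S n)))) at 2. apply Rmult_le_compat_l; [apply Cmod_ge_0|]. apply npw_le_1. lra. }
  assert (Cmod (f s - dp_eval (P K) s) <= 4 * (1 + / (Re s - 1 / 2))) as h2.
  { apply clim_le with (u := fun k => (dp_eval (P k) s - dp_eval (P K) s)%C).
    - apply (clim_plus _ (fun _ => - dp_eval (P K) s)%C); [apply lim; auto|apply clim_const].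
    - exists K. intros k hk. eapply Rle_trans; [apply (hdiff k K s (Re s - 1 / 2)); lra|].
      specialize (hK k K hk (le_n _)). rewrite <- (Rmult_1_r (4 * _)) at 2. apply Rmult_le_compat_l; lra. }
  pose proof (Cmod_tri_rev (f s) (dp_eval (P K) s)). nra.
Qed.

(** * Necessity of the zero conditions *)

Lemma sum_n_rsum (u : nat -> R) n : sum_n u n = rsum u (S n).
Proof.
  induction n; [rewrite sum_O; simpl; ring|]. rewrite sum_Sn, IHn. reflexivity.
Qed.

Lemma ex_series_bounded (u : nat -> R) B : (forall n, 0 <= u n) -> (forall n, rsum u n <= B) -> ex_series u.
Proof.
  intros hu hB. destruct (ex_finite_lim_seq_incr (sum_n u) B) as [l hl].
  - intros n. rewrite sum_Sn. unfold plus; simpl. specialize (hu (S n)). lra.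
  - intros n. rewrite sum_n_rsum. auto.
  - exists l. exact hl.
Qed.

Lemma ex_series_bound (u : nat -> R) : (forall n, 0 <= u n) -> ex_series u -> exists B, forall n, rsum u n <= B.
Proof.
  intros hu [l hl]. exists l. intros n. apply Rle_trans with (sum_n u n).
  - rewrite sum_n_rsum. simpl. specialize (hu n). lra.
  - apply is_lim_seq_incr_compare; [exact hl|]. intros k. rewrite sum_Sn. unfold plus; simpl. specialize (hu (S k)). lra.
Qed.

Section Necessity.

Variables (Z : point_seq) (f : C -> C) (G s1 M0 : R).
Hypotheses (hZ : all_points Z in_half_plane)
  (hbd : all_points Z (fun s => Cmod s <= M0)) (hM0 : 0 <= M0)
  (hv : vanishes_on f Z)
  (hA : forall q rho, 0 < rho -> rho < Re q - 1 / 2 -> Adisc q rho f)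
  (hG0 : 0 < G) (hG : forall s, in_half_plane s -> Cmod (f s) <= G * (1 + / (Re s - 1 / 2)))
  (hs1 : 1 / 2 < s1) (hne : forall s, s1 <= Re s -> f s <> RtoC 0).

Definition pt (j : nat) : C := match Z j with Some s => s | None => RtoC 0 end.

Definition far (eta : R) (j : nat) : bool :=
  match Z j with Some s => if Rle_dec eta (Re s - 1 / 2) then true else false | None => false end.

Definition far_sum (eta : R) (n : nat) : R :=
  lsum (fun j => Re (pt j) - 1 / 2) (filter (far eta) (seq 0 n)).

Lemma far_points eta n j : In j (filter (far eta) (seq 0 n)) ->
  Z j = Some (pt j) /\ eta <= Re (pt j) - 1 / 2 /\ 0 < Re (pt j) - 1 / 2 /\ Cmod (pt j) <= M0.
Proof.
  intros h. apply filter_In in h as [_ h]. unfold far, pt in *. destruct (Z j) as [s|] eqn:E; [|discriminate].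
  destruct (Rle_dec eta (Re s - 1 / 2)); [|discriminate]. pose proof (hZ j s E) as K. unfold in_half_plane in K.
  pose proof (hbd j s E). repeat split; auto; lra.
Qed.

Lemma far_sum_eq eta n : far_sum eta n = rsum (fun j => if far eta j then Re (pt j) - 1 / 2 else 0) n.
Proof.
  unfold far_sum. induction n; [reflexivity|].
  rewrite seq_S, filter_app, lsum_app, IHn. simpl. destruct (far eta n); simpl; ring.
Qed.

Lemma lsum_scal (c : R) u l : lsum (fun j => c * u j) l = c * lsum u l.
Proof. induction l; simpl; [ring|]. rewrite IHl. ring. Qed.

(** Jensen's inequality on a disc tangent to the line Re s = 1/2 + delta, with a base point ss independent of
    delta. For a large radius R the Blaschke factors are close to those of the half-plane, so that
    1 - |b_j(ss)|^2 is at least a fixed multiple of Re s_j - 1/2. *)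
Lemma far_sum_log : exists kap v, 0 < kap /\ 0 < v /\ forall delta n, 0 < delta <= M0 + 1 ->
  exp (kap * far_sum (2 * delta) n) * v <= / delta.
Proof.
  set (K0 := M0 + 1). set (xs := s1 + 2 * K0). set (K := M0 + 2 + K0 + xs). set (ss := (1 / 2 + xs, 0) : C).
  assert (1 <= K0) by (unfold K0; lra). assert (2 * K0 < xs) as hxs by (unfold xs; lra). assert (0 < K) as hK by (unfold K; lra).
  assert (0 < Cmod (f ss)) as hv0.
  { apply Cmod_gt_0, hne. unfold ss, xs. simpl. lra. }
  exists (xs / (36 * (K * K)) / 2), (Cmod (f ss) / (G * (K0 + 1))).
  assert (0 < K * K) as hKK by nra.
  split; [apply Rdiv_lt_0_compat; [|lra]; apply Rdiv_lt_0_compat; lra|].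
  split; [apply Rdiv_lt_0_compat; auto; apply Rmult_lt_0_compat; lra|].
  intros delta n hd. fold K0 in hd.
  set (R := K * K / delta + K). set (q := (1 / 2 + delta + R, 0) : C).
  assert (0 < K * K / delta) as hKd by (apply Rdiv_lt_0_compat; lra).
  assert (K <= R) as hRK by (unfold R; lra).
  assert (K * K <= R * delta) as hRd.
  { unfold R. replace ((K * K / delta + K) * delta) with (K * K + K * delta) by (field; lra). nra. }
  assert (0 < R) as hR by lra.
  set (ust := RtoC (xs - delta)).
  assert (0 < xs - delta <= K) as hust by (unfold K in *; lra).
  assert (ss - q = ust - RtoC R)%C as ews by (unfold ss, q, ust; csolve).
  assert (R * R - Cmod (ss - q) * Cmod (ss - q) >= R * (xs / 2)) as hws.
  { rewrite ews, Cmod_sqr. simpl. assert (xs / 2 <= xs - delta) by lra. 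
    assert ((xs - delta) * (xs - delta) <= R * (xs - delta)) by nra.
    assert (R * (xs / 2) <= R * (xs - delta)) by nra. nra. }
  assert (forall j, In j (filter (far (2 * delta)) (seq 0 n)) ->
    R * R - Cmod (pt j - q) * Cmod (pt j - q) >= R * ((Re (pt j) - 1 / 2) / 2) /\
    Cmod (RtoC (R * R) - Cconj (pt j - q) * (ss - q)) <= 3 * R * K /\ 0 < Re (pt j) - 1 / 2) as hpt.
  { intros j hj. destruct (far_points _ _ _ hj) as (_ & h1 & h2 & h3).
    set (u := (pt j - RtoC (1 / 2 + delta))%C).
    assert (Cmod u <= K) as hu.
    { unfold u. eapply Rle_trans; [apply Cmod_tri_minus|]. rewrite Cmod_R, Rabs_pos_eq by lra. unfold K. lra. }
    assert (pt j - q = u - RtoC R)%C as eu by (unfold u, q; csolve).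
    assert (Re u = Re (pt j) - 1 / 2 - delta) as eru by (unfold u; simpl; unfold Re; ring).
    pose proof (Cmod_ge_0 u) as hu0. pose proof (Cmod_sqr u) as hus.
    assert (Cmod u * Cmod u <= K * K) by (apply Rmult_le_compat; auto).
    split; [|split; auto].
    - rewrite eu, Cmod_sqr.
      replace (R * R - (Re (u - R) * Re (u - R) + Im (u - R) * Im (u - R))) with (2 * R * Re u - Cmod u * Cmod u).
      + rewrite eru. assert (R * delta <= R * (Re (pt j) - 1 / 2 - delta)) by (apply Rmult_le_compat_l; lra).
        assert (R * ((Re (pt j) - 1 / 2) / 2) <= R * (Re (pt j) - 1 / 2 - delta)) by (apply Rmult_le_compat_l; lra). nra.
      + rewrite hus. simpl. unfold Re, Im. ring.
    - rewrite eu, ews.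
      replace (RtoC (R * R) - Cconj (u - R) * (ust - R))%C with (RtoC R * (Cconj u + ust) - Cconj u * ust)%C.
      + eapply Rle_trans; [apply Cmod_tri_minus|]. rewrite !Cmod_mult, Cmod_conj, Cmod_R, (Rabs_pos_eq R) by lra.
        assert (Cmod ust <= K) as hk by (unfold ust; rewrite Cmod_R, Rabs_pos_eq; lra).
        pose proof (Cmod_triangle (Cconj u) ust) as T. rewrite Cmod_conj in T. pose proof (Cmod_ge_0 ust).
        assert (R * Cmod (Cconj u + ust) <= R * (K + K)) by (apply Rmult_le_compat_l; lra).
        assert (Cmod u * Cmod ust <= K * K) by (apply Rmult_le_compat; auto).
        assert (K * K <= R * K) by (apply Rmult_le_compat_r; lra). lra.
      + rewrite Cminus_conj. replace (Cconj (RtoC R)) with (RtoC R) by csolve. rewrite RtoC_mult. ring. }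
  assert (forall x y, 0 <= y -> x * x < y * y -> x < y) as sqlt.
  { intros x y hy h. destruct (Rlt_le_dec x y); auto. nra. }
  pose proof (jensen q R f (fun _ => RtoC 1) Z pt (filter (far (2 * delta)) (seq 0 n)) (G * (1 + / delta)) ss
    (fun j => xs / (36 * (K * K)) * (Re (pt j) - 1 / 2))) as J.
  rewrite !Cmult_1_r, lsum_scal in J.
  assert (exp (xs / (36 * (K * K)) * far_sum (2 * delta) n / 2) * Cmod (f ss) <= G * (1 + / delta)) as J'.
  { apply J; clear J.
    - apply hA; auto. unfold q; simpl; lra.
    - apply A_poly, ispoly_const.
    - exact hv.
    - apply NoDup_filter, seq_NoDup.
    - intros j hj. split; [apply (far_points _ _ _ hj)|].
      destruct (hpt j hj) as (h1 & _ & h3). apply sqlt; [lra|]. 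
      assert (0 < R * ((Re (pt j) - 1 / 2) / 2)) by (apply Rmult_lt_0_compat; lra). lra.
    - intros z hz. rewrite Cmult_1_r.
      assert (delta <= Re z - 1 / 2) as hzd.
      { pose proof (Re_le_Cmod (z - q)) as T. rewrite hz in T. apply Rabs_le_between in T. unfold q in T. simpl in T. unfold Re in *. lra. }
      eapply Rle_trans; [apply hG; unfold in_half_plane; lra|].
      apply Rmult_le_compat_l; [lra|]. apply Rplus_le_compat_l. apply Rinv_le_contravar; lra.
    - apply sqlt; [lra|]. assert (0 < R * (xs / 2)) by (apply Rmult_lt_0_compat; lra). lra.
    - intros j hj. destruct (hpt j hj) as (h1 & h2 & h3).
      set (x := Re (pt j) - 1 / 2) in *. set (D := Cmod (RtoC (R * R) - Cconj (pt j - q) * (ss - q))) in *.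
      assert (0 <= D) by apply Cmod_ge_0.
      assert (D * D <= 3 * R * K * (3 * R * K)) by (apply Rmult_le_compat; auto).
      apply Rle_trans with ((R * (x / 2)) * (R * (xs / 2))).
      + apply Rle_trans with (xs / (36 * (K * K)) * x * (3 * R * K * (3 * R * K))).
        * apply Rmult_le_compat_l; auto. apply Rmult_le_pos; [|lra]. apply Rdiv_le_0_compat; lra.
        * right. field. lra.
      + apply Rmult_le_compat; try lra; apply Rmult_le_pos; lra. }
  assert (/ delta * (K0 + 1) >= 1 + / delta) as hdd.
  { assert (/ delta * delta = 1) by (field; lra). assert (0 < / delta) by (apply Rinv_0_lt_compat; lra). nra. }
  replace (xs / (36 * (K * K)) / 2 * far_sum (2 * delta) n) with (xs / (36 * (K * K)) * far_sum (2 * delta) n / 2) by (field; lra).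
  assert (0 < G * (K0 + 1)) as hGK by (apply Rmult_lt_0_compat; lra).
  apply Rmult_le_reg_r with (G * (K0 + 1)); auto.
  replace (exp (xs / (36 * (K * K)) * far_sum (2 * delta) n / 2) * (Cmod (f ss) / (G * (K0 + 1))) * (G * (K0 + 1)))
    with (exp (xs / (36 * (K * K)) * far_sum (2 * delta) n / 2) * Cmod (f ss)) by (field; lra).
  eapply Rle_trans; [apply J'|]. nra.
Qed.

Lemma ln_le_Rpower y e : 0 < y -> 0 < e -> ln y <= / e * Rpower y e.
Proof.
  intros hy he. unfold Rpower. pose proof (exp_ineq1_le (e * ln y)).
  apply Rmult_le_reg_l with e; auto. rewrite <- Rmult_assoc, Rinv_r, Rmult_1_l by lra. lra.
Qed.

Lemma Rpower_le_base a b e : 0 < a <= b -> 0 <= e -> Rpower a e <= Rpower b e.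
Proof. intros. apply Rle_Rpower_l; auto. Qed.

(** Dyadic summation: the points at distance about 2^{-k} from the line contribute at most a multiple of
    2^{-k eps} k, since f is bounded by a multiple of 2^k on the corresponding disc. *)
Lemma necessity_eps eps : 0 < eps -> ex_sum_over Z (fun s => Rpower (Re s - 1 / 2) (1 + eps)).
Proof.
  intros he. destruct far_sum_log as (kap & v & hk & hv0 & HS).
  set (e := eps / 2). assert (0 < e) as he0 by (unfold e; lra).
  set (K0 := M0 + 1) in *. assert (1 <= K0) as hK0 by (unfold K0; lra).
  set (C1 := / kap * (/ e * Rpower (/ v) e)).
  assert (forall x y, 0 < Rpower x y) as rp by (intros; apply exp_pos).
  assert (0 < C1) as hC1.
  { unfold C1. apply Rmult_lt_0_compat; [apply Rinv_0_lt_compat; auto|]. apply Rmult_lt_0_compat; auto. apply Rinv_0_lt_compat; auto. }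
  assert (forall delta n, 0 < delta <= K0 -> far_sum (2 * delta) n <= C1 * Rpower delta (- e)) as HS2.
  { intros delta n hd. specialize (HS delta n hd).
    assert (0 < / v) as hiv by (apply Rinv_0_lt_compat; auto). assert (0 < / delta) as hid by (apply Rinv_0_lt_compat; lra).
    assert (kap * far_sum (2 * delta) n <= ln (/ v * / delta)) as L.
    { rewrite <- (ln_exp (kap * _)). apply ln_le; [apply exp_pos|].
      apply Rmult_le_reg_r with v; auto. replace (/ v * / delta * v) with (/ delta) by (field; lra). auto. }
    pose proof (ln_le_Rpower (/ v * / delta) e ltac:(apply Rmult_lt_0_compat; auto) he0) as L2.
    rewrite <- Rpower_mult_distr in L2 by auto.
    assert (Rpower (/ delta) e = Rpower delta (- e)) as E.
    { unfold Rpower. f_equal. rewrite ln_Rinv by lra. ring. }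
    rewrite E in L2. unfold C1. apply Rmult_le_reg_l with kap; auto.
    replace (kap * (/ kap * (/ e * Rpower (/ v) e) * Rpower delta (- e))) with (/ e * (Rpower (/ v) e * Rpower delta (- e))) by (field; lra).
    lra. }
  set (th := fun k => K0 * / 2 ^ k).
  assert (forall k, 0 < th k <= K0) as hth.
  { intros k. unfold th. assert (1 <= 2 ^ k) by (apply pow_R1_Rle; lra).
    assert (0 < / 2 ^ k <= 1) by (split; [apply Rinv_0_lt_compat; lra|]; rewrite <- Rinv_1; apply Rinv_le_contravar; lra). nra. }
  set (x := fun j => Re (pt j) - 1 / 2).
  set (r := Rpower 2 (- e)).
  assert (0 < r < 1) as hr.
  { split; [apply rp|]. unfold r. rewrite <- (Rpower_O 2) by lra. apply Rpower_lt; lra. }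
  assert (forall k, Rpower (th k) e = Rpower K0 e * r ^ k) as hthr.
  { intros k. unfold th. rewrite <- Rpower_mult_distr; [|lra|apply Rinv_0_lt_compat, pow_lt; lra]. f_equal.
    unfold r. rewrite <- (Rpower_pow k (Rpower 2 (- e))) by apply rp. rewrite Rpower_mult.
    rewrite <- (Rpower_pow k 2) by lra. rewrite <- Rpower_Ropp, Rpower_mult. f_equal. ring. }
  set (B := C1 * Rpower 4 e * Rpower K0 e * / (1 - r)).
  assert (forall n L, rsum (fun j => match Z j with Some s => Rpower (Re s - 1 / 2) (1 + eps) | None => 0 end) n
     <= B + INR n * K0 * Rpower (th L) eps) as KEY.
  { intros n L.
    assert (forall y, 0 < y <= K0 -> forall L, Rpower y eps <= rsum (fun k => if Rle_dec (th (S k)) y then Rpower (th k) eps else 0) L + Rpower (th L) eps) as dy.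
    { intros y hy M. induction M as [|M IH].
      - simpl. rewrite Rplus_0_l. apply Rpower_le_base; [|lra]. unfold th. simpl. rewrite Rinv_1. lra.
      - assert (0 <= rsum (fun k => if Rle_dec (th (S k)) y then Rpower (th k) eps else 0) M).
        { apply rsum_pos. intros. destruct (Rle_dec _ _); [left; apply rp|lra]. }
        simpl rsum. destruct (Rle_dec (th (S M)) y) as [h|h].
        + pose proof (rp (th (S M)) eps). lra.
        + assert (Rpower y eps <= Rpower (th (S M)) eps) by (apply Rpower_le_base; lra). lra. }
    assert (forall n, rsum (fun j => match Z j with Some s => Rpower (Re s - 1 / 2) (1 + eps) | None => 0 end) n
      <= rsum (fun k => Rpower (th k) eps * far_sum (th (S k)) n) L + INR n * K0 * Rpower (th L) eps) as S1.
    { clear n. induction n as [|n IH].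
      - simpl. rewrite (rsum_ext _ (fun k => 0 * Rpower (th k) eps)) by (intros; unfold far_sum; simpl; ring).
        rewrite rsum_scal. lra.
      - simpl rsum at 1. rewrite S_INR.
        rewrite (rsum_ext (fun k => Rpower (th k) eps * far_sum (th (S k)) (S n))
          (fun k => Rpower (th k) eps * far_sum (th (S k)) n + Rpower (th k) eps * (if far (th (S k)) n then x n else 0))).
        2: { intros k _. rewrite !far_sum_eq. simpl. unfold x. ring. }
        rewrite rsum_plus.
        assert (match Z n with Some s => Rpower (Re s - 1 / 2) (1 + eps) | None => 0 end <=
          rsum (fun k => Rpower (th k) eps * (if far (th (S k)) n then x n else 0)) L + K0 * Rpower (th L) eps); [|lra].
        unfold far, x, pt. destruct (Z n) as [s|] eqn:E.
        + pose proof (hZ n s E) as h1. unfold in_half_plane in h1. pose proof (hbd n s E) as h2.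
          set (y := Re s - 1 / 2) in *.
          assert (0 < y <= K0) as hy.
          { pose proof (Re_le_Cmod s) as T. apply Rabs_le_between in T. unfold y, K0. lra. }
          rewrite Rpower_plus, Rpower_1 by lra.
          rewrite (rsum_ext _ (fun k => y * (if Rle_dec (th (S k)) y then Rpower (th k) eps else 0))).
          2: { intros k _. destruct (Rle_dec (th (S k)) y); ring. }
          rewrite rsum_scal. pose proof (dy y hy L) as D. pose proof (rp (th L) eps).
          apply Rle_trans with (y * (rsum (fun k => if Rle_dec (th (S k)) y then Rpower (th k) eps else 0) L + Rpower (th L) eps)).
          * apply Rmult_le_compat_l; lra.
          * rewrite Rmult_plus_distr_l. apply Rplus_le_compat_l. apply Rmult_le_compat_r; lra.
        + rewrite (rsum_ext _ (fun k => 0 * Rpower (th k) eps)) by (intros; ring). rewrite rsum_scal.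
          pose proof (rp (th L) eps). nra. }
    eapply Rle_trans; [apply S1|]. apply Rplus_le_compat_r.
    apply Rle_trans with (rsum (fun k => C1 * Rpower 4 e * Rpower K0 e * r ^ k) L).
    - apply rsum_le. intros k _.
      assert (th (S k) = 2 * (th k / 4)) as E by (unfold th; simpl; field; apply pow_nonzero; lra).
      rewrite E. pose proof (hth k). specialize (HS2 (th k / 4) n ltac:(lra)).
      eapply Rle_trans; [apply Rmult_le_compat_l; [left; apply rp|apply HS2]|].
      assert (Rpower (th k / 4) (- e) = Rpower 4 e * Rpower (th k) (- e)) as E2.
      { unfold Rdiv. rewrite <- Rpower_mult_distr by lra. rewrite Rmult_comm. f_equal. unfold Rpower. f_equal. rewrite ln_Rinv by lra. ring. }
      rewrite E2. right.
      transitivity (C1 * Rpower 4 e * (Rpower (th k) eps * Rpower (th k) (- e))); [ring|].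
      rewrite <- Rpower_plus. replace (eps + - e) with e by (unfold e; field). rewrite hthr. ring.
    - rewrite rsum_scal. unfold B. apply Rmult_le_compat_l.
      + left. apply Rmult_lt_0_compat; [apply Rmult_lt_0_compat|]; auto.
      + apply rsum_geometric. lra. }
  apply ex_series_bounded with B.
  - intros j. destruct (Z j); [left; apply rp|lra].
  - intros n. apply le_eps. intros ep hep.
    (* let L tend to infinity *)
    set (c := INR n * K0 * (Rpower K0 e * Rpower K0 e) + 1).
    assert (0 < c) as hc.
    { unfold c. pose proof (pos_INR n). pose proof (rp K0 e). assert (0 <= INR n * K0 * (Rpower K0 e * Rpower K0 e)) by (repeat apply Rmult_le_pos; lra). lra. }
    destruct (pow_lt_1_zero r) with (y := ep / c) as [L hL].
    { rewrite Rabs_pos_eq; lra. } { apply Rdiv_lt_0_compat; auto. }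
    specialize (hL L (le_n _)). assert (0 < r ^ L) as hrL by (apply pow_lt; lra). rewrite Rabs_pos_eq in hL by lra.
    eapply Rle_trans; [apply (KEY n L)|]. apply Rplus_le_compat_l.
    replace eps with (e + e) by (unfold e; field). rewrite Rpower_plus, !hthr.
    assert (r ^ L <= 1) by (rewrite <- (pow1 L); apply pow_incr; lra).
    apply Rle_trans with (c * r ^ L).
    + assert (r ^ L * r ^ L <= r ^ L) by nra.
      replace (INR n * K0 * (Rpower K0 e * r ^ L * (Rpower K0 e * r ^ L))) with ((c - 1) * (r ^ L * r ^ L)) by (unfold c; ring).
      assert (0 <= c - 1).
      { unfold c. pose proof (pos_INR n). pose proof (rp K0 e). assert (0 <= INR n * K0 * (Rpower K0 e * Rpower K0 e)) by (repeat apply Rmult_le_pos; lra). lra. }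
      nra.
    + apply Rmult_lt_compat_l with (r := c) in hL; auto. replace (c * (ep / c)) with ep in hL by (field; lra). lra.
Qed.

(** Points of the cone stay well inside a disc tangent to the line Re s = 1/2 at the vertex b. On such a disc
    |z - b|^2 is at most a multiple of Re z - 1/2, so that f times (z - b)^2 is bounded and Jensen's
    inequality loses no logarithm. *)
Lemma necessity_cone t0 c : 0 < c -> all_points Z (in_cone t0 c) -> ex_sum_over Z (fun s => Re s - 1 / 2).
Proof.
  intros hc hcone.
  set (R := (1 + c * c) * (M0 + 1) + s1 + 1). set (q := (1 / 2 + R, t0) : C). set (b := (1 / 2, t0) : C).
  assert (1 < R) as hR.
  { unfold R. assert (0 <= (1 + c * c) * (M0 + 1)) by (apply Rmult_le_pos; nra). lra. }
  set (h := fun z : C => ((z - b) * (z - b))%C).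
  assert (h q = RtoC (R * R)) as hq by (unfold h, q, b; csolve).
  assert (0 < Cmod (f q)) as hfq by (apply Cmod_gt_0, hne; unfold q; simpl; unfold R; assert (0 <= (1 + c * c) * (M0 + 1)) by (apply Rmult_le_pos; nra); lra).
  set (v := Cmod (f q * h q)).
  assert (0 < v) as hv0 by (unfold v; rewrite Cmod_mult, hq, Cmod_R, Rabs_pos_eq by nra; apply Rmult_lt_0_compat; [auto|nra]).
  set (M := G * (2 * R * (2 * R + 1))).
  assert (forall eta n, 0 < eta <= 1 -> far_sum eta n <= 4 * R * (M / v)) as SB.
  { intros eta n he. set (rho := sqrt (R * R - R * (eta / 2))).
    assert (0 < R * R - R * (eta / 2)) as hp by nra.
    assert (rho * rho = R * R - R * (eta / 2)) as hrr by (apply sqrt_sqrt; lra).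
    assert (0 < rho) as hr by (apply sqrt_lt_R0; auto).
    assert (forall x y, 0 <= y -> x * x < y * y -> x < y) as sqlt.
    { intros x y hy hh. destruct (Rlt_le_dec x y); auto. nra. }
    assert (rho < R) as hrR by (apply sqlt; nra).
    assert (forall j, In j (filter (far eta) (seq 0 n)) ->
      rho * rho - Cmod (pt j - q) * Cmod (pt j - q) >= R * ((Re (pt j) - 1 / 2) / 2) /\ 0 < Re (pt j) - 1 / 2) as hpt.
    { intros j hj. destruct (far_points _ _ _ hj) as (h1 & h2 & h3 & h4). split; auto.
      destruct (hcone j _ h1) as [_ hcn].
      set (x := Re (pt j) - 1 / 2) in *. set (tau := Im (pt j) - t0) in *.
      assert (tau * tau <= c * c * (x * x)) as htau.
      { assert (Rabs tau * Rabs tau <= (c * x) * (c * x)) by (apply Rmult_le_compat; auto; apply Rabs_pos).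
        rewrite <- Rabs_mult, Rabs_pos_eq in H by nra. lra. }
      assert (x <= M0) as hx.
      { pose proof (Re_le_Cmod (pt j)) as T. apply Rabs_le_between in T. unfold x. lra. }
      assert (Cmod (pt j - q) * Cmod (pt j - q) = (x - R) * (x - R) + tau * tau) as E.
      { rewrite Cmod_sqr. unfold q, x, tau. simpl. unfold Re, Im. ring. }
      rewrite E, hrr. assert ((1 + c * c) * (x * x) <= R * x).
      { assert ((1 + c * c) * x <= R) by (unfold R; nra). nra. }
      nra. }
    pose proof (jensen q rho f h Z pt (filter (far eta) (seq 0 n)) M q (fun j => / (2 * R) * (Re (pt j) - 1 / 2))) as J.
    assert (Cmod (q - q) = 0) as Eq by (replace (q - q)%C with (RtoC 0) by ring; apply Cmod_0).
    assert (exp (/ (2 * R) * far_sum eta n / 2) * v <= M) as J'.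
    { rewrite lsum_scal in J. apply J; clear J.
      - apply hA; auto. unfold q. simpl. lra.
      - apply A_poly. apply ispoly_mult; (apply ispoly_plus; [apply ispoly_id|apply ispoly_const]).
      - exact hv.
      - apply NoDup_filter, seq_NoDup.
      - intros j hj. split; [apply (far_points _ _ _ hj)|].
        destruct (hpt j hj) as (h1 & h3). apply sqlt; [lra|].
        assert (0 < R * ((Re (pt j) - 1 / 2) / 2)) by (apply Rmult_lt_0_compat; lra). lra.
      - intros z hz.
        set (X := Re z - 1 / 2). set (tau := Im z - t0).
        assert ((X - R) * (X - R) + tau * tau = rho * rho) as E.
        { rewrite <- hz, Cmod_sqr. unfold q, X, tau. simpl. unfold Re, Im. ring. }
        assert (0 < X) as hX by nra.
        assert (X <= 2 * R) as hX2 by nra.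
        assert (Cmod (h z) = X * X + tau * tau) as Eh.
        { unfold h. rewrite Cmod_mult, Cmod_sqr. unfold b, X, tau. simpl. unfold Re, Im. ring. }
        assert (X * X + tau * tau <= 2 * R * X) as hXX by nra.
        rewrite Cmod_mult, Eh. unfold M.
        apply Rle_trans with ((G * (1 + / X)) * (2 * R * X)).
        + apply Rmult_le_compat; auto; [apply Cmod_ge_0|nra|]. apply hG. unfold in_half_plane, X in *. lra.
        + replace ((G * (1 + / X)) * (2 * R * X)) with (G * (2 * R * (X + 1))) by (field; lra).
          apply Rmult_le_compat_l; [lra|]. apply Rmult_le_compat_l; lra.
      - rewrite Eq. auto.
      - intros j hj. destruct (hpt j hj) as (h1 & h3).
        replace (q - q)%C with (RtoC 0) by ring. rewrite Cmod_0.
        replace (RtoC (rho * rho) - Cconj (pt j - q) * 0)%C with (RtoC (rho * rho)) by ring.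
        rewrite Cmod_R, Rabs_pos_eq by nra.
        set (x := Re (pt j) - 1 / 2) in *.
        apply Rle_trans with ((R * (x / 2)) * (rho * rho)).
        + replace (/ (2 * R) * x * (rho * rho * (rho * rho))) with ((rho * rho * / R * (x / 2)) * (rho * rho)) by (field; lra).
          apply Rmult_le_compat_r; [nra|]. apply Rmult_le_compat_r; [lra|].
          apply Rmult_le_reg_r with R; [lra|]. rewrite Rmult_assoc, Rinv_l by lra. nra.
        + rewrite Rmult_0_l, Rminus_0_r. apply Rmult_le_compat_r; nra. }
    pose proof (exp_ineq1_le (/ (2 * R) * far_sum eta n / 2)) as K.
    assert (exp (/ (2 * R) * far_sum eta n / 2) <= M / v) as K2.
    { apply Rmult_le_reg_r with v; auto. unfold Rdiv at 2. rewrite Rmult_assoc, Rinv_l; lra. }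
    replace (far_sum eta n) with (4 * R * (/ (2 * R) * far_sum eta n / 2)) by (field; lra).
    apply Rmult_le_compat_l; lra. }
  apply ex_series_bounded with (4 * R * (M / v)).
  - intros j. destruct (Z j) as [s|] eqn:E; [|lra]. pose proof (hZ j s E) as K. unfold in_half_plane in K. lra.
  - intros n. apply le_eps. intros eps he.
    set (eta := Rmin 1 (eps / (INR n + 1))). pose proof (pos_INR n).
    assert (0 < eta <= 1) as heta.
    { split; [apply Rmin_pos; [lra|apply Rdiv_lt_0_compat; lra]|apply Rmin_l]. }
    assert (INR n * eta <= eps) as hn.
    { apply Rle_trans with (INR n * (eps / (INR n + 1))); [apply Rmult_le_compat_l; auto; apply Rmin_r|].
      apply Rmult_le_reg_r with (INR n + 1); [lra|]. replace (INR n * (eps / (INR n + 1)) * (INR n + 1)) with (INR n * eps) by (field; lra). nra. }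
    assert (forall n, rsum (fun j => match Z j with Some s => Re s - 1 / 2 | None => 0 end) n <= far_sum eta n + INR n * eta) as T.
    { intros m. rewrite far_sum_eq. induction m as [|m IH]; [simpl; lra|].
      assert (match Z m with Some s => Re s - 1 / 2 | None => 0 end <= (if far eta m then Re (pt m) - 1 / 2 else 0) + eta).
      { unfold far, pt. destruct (Z m) as [s|]; [|lra]. destruct (Rle_dec eta (Re s - 1 / 2)); lra. }
      rewrite S_INR. simpl rsum. lra. }
    specialize (SB eta n heta). specialize (T n). eapply Rle_trans; [exact T|]. lra.
Qed.

End Necessity.

(** * Exponential polynomials and their energy *)

Definition dC (h : R -> C) (y : R) (d : C) : Prop :=
  is_derive (fun y => Re (h y)) y (Re d) /\ is_derive (fun y => Im (h y)) y (Im d).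

Lemma is_derive_eq (f g : R -> R) (y a b : R) : (forall t, f t = g t) -> a = b -> is_derive f y a -> is_derive g y b.
Proof. intros E <- h. apply (is_derive_ext f); auto. Qed.

Lemma dC_eq f y a b : dC f y a -> a = b -> dC f y b.
Proof. intros h <-. exact h. Qed.

Lemma dC_ext f g y d : (forall y, f y = g y) -> dC f y d -> dC g y d.
Proof. intros E. replace g with f; auto. apply functional_extensionality, E. Qed.

Lemma dC_const c y : dC (fun _ => c) y (RtoC 0).
Proof. split; simpl; apply (is_derive_const (V := R_NormedModule)). Qed.

Lemma dC_plus f g y a b : dC f y a -> dC g y b -> dC (fun y => f y + g y)%C y (a + b)%C.
Proof. intros [h1 h2] [h3 h4]. split; simpl; apply (is_derive_plus (V := R_NormedModule)); auto. Qed.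

Lemma dC_mult f g y a b : dC f y a -> dC g y b -> dC (fun y => f y * g y)%C y (a * g y + f y * b)%C.
Proof.
  intros [h1 h2] [h3 h4].
  assert (forall (u v : R -> R) u' v', is_derive u y u' -> is_derive v y v' -> is_derive (fun y => u y * v y) y (u' * v y + u y * v')) as M.
  { intros u v u' v' hu hv. apply (is_derive_mult u v y u' v' hu hv). intros; apply Rmult_comm. }
  split; simpl.
  - pose proof (is_derive_minus (V := R_NormedModule) _ _ _ _ _ (M _ _ _ _ h1 h3) (M _ _ _ _ h2 h4)) as K.
    unfold minus, plus, opp in K; simpl in K.
    refine (is_derive_eq _ _ _ _ _ _ _ K); [intros t; simpl; unfold Re, Im; ring|unfold Re, Im; ring].
  - pose proof (is_derive_plus (V := R_NormedModule) _ _ _ _ _ (M _ _ _ _ h1 h4) (M _ _ _ _ h2 h3)) as K.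
    unfold plus in K; simpl in K.
    refine (is_derive_eq _ _ _ _ _ _ _ K); [intros t; simpl; unfold Re, Im; ring|unfold Re, Im; ring].
Qed.

Lemma dC_scal c f y a : dC f y a -> dC (fun y => c * f y)%C y (c * a)%C.
Proof.
  intros h. pose proof (dC_mult (fun _ => c) f y _ _ (dC_const c y) h) as K.
  replace (c * a)%C with (0 * f y + c * a)%C by ring. exact K.
Qed.

Lemma dC_unique f y a b : dC f y a -> dC f y b -> a = b.
Proof.
  intros [h1 h2] [h3 h4]. apply C_ext.
  - rewrite <- (is_derive_unique _ _ _ h1). apply is_derive_unique. auto.
  - rewrite <- (is_derive_unique _ _ _ h2). apply is_derive_unique. auto.
Qed.

Lemma dC_Cexp lam y : dC (fun y => Cexp (lam * RtoC y)) y (lam * Cexp (lam * RtoC y))%C.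
Proof.
  destruct lam as [a b].
  assert (is_derive (fun y => exp (a * y) * cos (b * y)) y (exp (a * y) * (a * cos (b * y) - b * sin (b * y)))) as D1.
  { auto_derive; auto. ring. }
  assert (is_derive (fun y => exp (a * y) * sin (b * y)) y (exp (a * y) * (a * sin (b * y) + b * cos (b * y)))) as D2.
  { auto_derive; auto. ring. }
  assert (forall t, a * t - b * 0 = a * t) as E1 by (intros; ring).
  assert (forall t, a * 0 + b * t = b * t) as E2 by (intros; ring).
  split; [refine (is_derive_eq _ _ _ _ _ _ _ D1)|refine (is_derive_eq _ _ _ _ _ _ _ D2)];
    unfold Cexp; simpl; try intros t; rewrite ?E1, ?E2; ring.
Qed.

(** Solutions of (D + lam_1) ... (D + lam_m) h = 0. *)
Fixpoint expoly (l : list C) (h : R -> C) : Prop :=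
  match l with
  | nil => forall y, h y = RtoC 0
  | lam :: l => exists g, expoly l g /\ forall y, dC h y (g y - lam * h y)%C
  end.

Lemma expoly_0 l : expoly l (fun _ => RtoC 0).
Proof.
  induction l; simpl; auto. exists (fun _ => RtoC 0). split; auto. intros y.
  replace (0 - a * 0)%C with (RtoC 0) by ring. apply dC_const.
Qed.

Lemma expoly_plus l : forall f g, expoly l f -> expoly l g -> expoly l (fun y => f y + g y)%C.
Proof.
  induction l as [|lam l IH]; simpl; intros f g hf hg.
  - intros y. rewrite hf, hg. ring.
  - destruct hf as (f1 & hf1 & hf). destruct hg as (g1 & hg1 & hg).
    exists (fun y => f1 y + g1 y)%C. split; auto. intros y.
    replace (f1 y + g1 y - lam * (f y + g y))%C with ((f1 y - lam * f y) + (g1 y - lam * g y))%C by ring.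
    apply dC_plus; auto.
Qed.

Lemma expoly_scal l c : forall f, expoly l f -> expoly l (fun y => c * f y)%C.
Proof.
  induction l as [|lam l IH]; simpl; intros f hf.
  - intros y. rewrite hf. ring.
  - destruct hf as (f1 & hf1 & hf). exists (fun y => c * f1 y)%C. split; auto. intros y.
    replace (c * f1 y - lam * (c * f y))%C with (c * (f1 y - lam * f y))%C by ring. apply dC_scal; auto.
Qed.

Lemma expoly_ext l f g : (forall y, f y = g y) -> expoly l f -> expoly l g.
Proof. intros E. replace g with f; auto. apply functional_extensionality, E. Qed.

(** If (D - mu) H1 = (D + lam) g, then H = (H1 - g) / (lam + mu) satisfies (D - mu) H = g. *)
Lemma expoly_inv l mu : (forall lam, In lam l -> (lam + mu)%C <> RtoC 0) -> forall g, expoly l g ->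
  exists H, expoly l H /\ forall y, dC H y (g y + mu * H y)%C.
Proof.
  induction l as [|lam l IH]; intros hl g hg.
  - exists (fun _ => RtoC 0). split; [intros y; auto|]. intros y. simpl in hg. rewrite hg.
    replace (0 + mu * 0)%C with (RtoC 0) by ring. apply dC_const.
  - destruct hg as (g1 & hg1 & hg). destruct (IH ltac:(intros; apply hl; simpl; auto) g1 hg1) as (H1 & hH1 & dH1).
    assert (lam + mu <> 0)%C as ne by (apply hl; simpl; auto).
    exists (fun y => / (lam + mu) * (H1 y + (- (1)) * g y))%C.
    assert (forall y, dC (fun y => / (lam + mu) * (H1 y + (- (1)) * g y))%C y
       (/ (lam + mu) * ((g1 y + mu * H1 y) + (- (1)) * (g1 y - lam * g y)))%C) as D.
    { intros y. apply dC_scal. apply dC_plus; auto. apply dC_scal; auto. }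
    split.
    + exists H1. split; auto. intros y. specialize (D y). apply (dC_eq _ _ _ _ D). field. auto.
    + intros y. specialize (D y). apply (dC_eq _ _ _ _ D). field. auto.
Qed.

Lemma expoly_D l : forall h, expoly l h -> exists dh, expoly l dh /\ forall y, dC h y (dh y).
Proof.
  induction l as [|lam l IH]; intros h hh.
  - exists (fun _ => RtoC 0). split; [intros y; auto|]. intros y. simpl in hh.
    apply dC_ext with (f := fun _ => RtoC 0); [intros; now rewrite hh|apply dC_const].
  - destruct hh as (g & hg & D). destruct (IH g hg) as (dg & hdg & Dg).
    assert (expoly (lam :: l) g) as hg'.
    { exists (fun y => dg y + lam * g y)%C. split; [apply expoly_plus; auto; apply expoly_scal; auto|].
      intros y. replace (dg y + lam * g y - lam * g y)%C with (dg y) by ring. auto. }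
    exists (fun y => g y + (- lam) * h y)%C. split.
    + apply expoly_plus; auto. apply expoly_scal. exists g; auto.
    + intros y. replace (g y + - lam * h y)%C with (g y - lam * h y)%C by ring. auto.
Qed.

Lemma expoly_cons l lam g : expoly l g -> expoly (lam :: l) g.
Proof.
  intros hg. destruct (expoly_D l g hg) as (dg & hdg & Dg).
  exists (fun y => dg y + lam * g y)%C. split; [apply expoly_plus; auto; apply expoly_scal; auto|].
  intros y. replace (dg y + lam * g y - lam * g y)%C with (dg y) by ring. auto.
Qed.

Definition monexp (i : nat) (lam : C) (y : R) : C := (RtoC (y ^ i) * Cexp (- lam * RtoC y))%C.

Lemma dC_monexp i lam y : dC (monexp i lam) y (INR i * monexp (pred i) lam y - lam * monexp i lam y)%C.
Proof.
  assert (dC (fun y => RtoC (y ^ i)) y (RtoC (INR i * y ^ pred i))) as P.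
  { split; simpl.
    - auto_derive; auto. ring.
    - apply (is_derive_const (V := R_NormedModule)). }
  pose proof (dC_mult _ _ y _ _ P (dC_Cexp (- lam) y)) as K. unfold monexp.
  apply (dC_eq _ _ _ _ K). rewrite RtoC_mult. ring.
Qed.

(** D + lam lowers the power of y in y^i e^{-lam y}, and D + mu with mu distinct from lam does not raise it. *)
Lemma monexp_expoly l : forall i lam, (i < count_occ Ceq_dec l lam)%nat -> expoly l (monexp i lam).
Proof.
  induction l as [|mu l IH]; intros i lam hi; simpl in hi; [lia|].
  destruct (Ceq_dec mu lam) as [->|ne].
  - exists (fun y => INR i * monexp (pred i) lam y)%C. split.
    + destruct i as [|i].
      * apply expoly_ext with (f := fun _ => RtoC 0); [intros; simpl; ring|apply expoly_0].
      * apply expoly_scal. apply IH. simpl. lia.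
    + intros y. apply dC_monexp.
  - exists (fun y => INR i * monexp (pred i) lam y + (mu - lam) * monexp i lam y)%C. split.
    + apply expoly_plus; apply expoly_scal; apply IH; lia.
    + intros y. eapply dC_eq; [apply dC_monexp|]. ring.
Qed.

Lemma nondecreasing (F F' : R -> R) a b : a <= b -> (forall x, a <= x <= b -> is_derive F x (F' x)) ->
  (forall x, a <= x <= b -> 0 <= F' x) -> F a <= F b.
Proof.
  intros hab hF hF'. destruct (MVT_gen F a b F') as (c & hc & E).
  - intros x hx. apply hF. rewrite Rmin_left, Rmax_right in hx by lra. lra.
  - intros x hx. rewrite Rmin_left, Rmax_right in hx by lra.
    apply continuity_pt_filterlim. apply (ex_derive_continuous (V := R_NormedModule)). exists (F' x). apply hF. lra.
  - rewrite Rmin_left, Rmax_right in hc by lra. specialize (hF' c hc). nra.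
Qed.

Lemma derive_compare (F F' G G' : R -> R) a b : a <= b -> (forall x, a <= x <= b -> is_derive F x (F' x)) ->
  (forall x, a <= x <= b -> is_derive G x (G' x)) -> (forall x, a <= x <= b -> Rabs (F' x) <= G' x) ->
  Rabs (F b - F a) <= G b - G a.
Proof.
  intros hab hF hG hle.
  assert (G a - F a <= G b - F b).
  { apply (nondecreasing (fun x => G x - F x) (fun x => G' x - F' x)); auto.
    - intros x hx. apply (is_derive_minus (V := R_NormedModule)); auto.
    - intros x hx. specialize (hle x hx). apply Rabs_le_between in hle. lra. }
  assert (G a + F a <= G b + F b).
  { apply (nondecreasing (fun x => G x + F x) (fun x => G' x + F' x)); auto.
    - intros x hx. apply (is_derive_plus (V := R_NormedModule)); auto.
    - intros x hx. specialize (hle x hx). apply Rabs_le_between in hle. lra. }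
  apply Rabs_le. lra.
Qed.

Lemma derive_compare_C (f f' : R -> C) (G G' : R -> R) a b : a <= b -> (forall x, a <= x <= b -> dC f x (f' x)) ->
  (forall x, a <= x <= b -> is_derive G x (G' x)) -> (forall x, a <= x <= b -> Cmod (f' x) <= G' x) ->
  Cmod (f b - f a) <= 2 * (G b - G a).
Proof.
  intros hab hf hG hle. eapply Rle_trans; [apply Cmod_le_sum|].
  assert (Rabs (Re (f b) - Re (f a)) <= G b - G a).
  { apply (derive_compare (fun x => Re (f x)) (fun x => Re (f' x)) G G'); auto.
    - intros x hx. apply hf; auto.
    - intros x hx. eapply Rle_trans; [apply Re_le_Cmod|auto]. }
  assert (Rabs (Im (f b) - Im (f a)) <= G b - G a).
  { apply (derive_compare (fun x => Im (f x)) (fun x => Im (f' x)) G G'); auto.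
    - intros x hx. apply hf; auto.
    - intros x hx. eapply Rle_trans; [apply Im_le_Cmod|auto]. }
  simpl. unfold Re, Im, Rminus in *. lra.
Qed.

Lemma exp_le x y : x <= y -> exp x <= exp y.
Proof. intros [h|h]; [left; apply exp_increasing; auto|rewrite h; lra]. Qed.

Lemma expoly_decay l : (forall lam, In lam l -> 0 < Re lam) -> forall h, expoly l h ->
  exists kap M, 0 < kap /\ 0 <= M /\ forall y, 0 <= y -> Cmod (h y) <= M * exp (- (kap * y)).
Proof.
  induction l as [|lam l IH]; intros hl h hh.
  - exists 1, 0. split; [lra|split; [lra|]]. intros y _. simpl in hh. rewrite hh, Cmod_0. lra.
  - destruct hh as (g & hg & D). destruct (IH ltac:(intros; apply hl; simpl; auto) g hg) as (k0 & M0 & hk0 & hM0 & B0).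
    assert (0 < Re lam) as hx by (apply hl; simpl; auto). set (x := Re lam) in *.
    set (k := Rmin k0 (x / 2)). pose proof (Rmin_l k0 (x / 2)). pose proof (Rmin_r k0 (x / 2)).
    assert (0 < k) as hk by (apply Rmin_pos; lra). fold k in H, H0.
    exists k, (Cmod (h 0) + 2 * (M0 / (x - k))). split; auto.
    assert (0 <= M0 / (x - k)) as hq by (apply Rdiv_le_0_compat; lra).
    split; [pose proof (Cmod_ge_0 (h 0)); lra|].
    intros y hy.
    set (w := fun y => (h y * Cexp (lam * RtoC y))%C).
    assert (Cmod (w y - w 0) <= 2 * ((M0 / (x - k) * exp ((x - k) * y)) - (M0 / (x - k) * exp ((x - k) * 0)))) as W.
    { apply (derive_compare_C w (fun y => g y * Cexp (lam * RtoC y))%C (fun y => M0 / (x - k) * exp ((x - k) * y)) (fun y => M0 * exp ((x - k) * y))); auto.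
      - intros t _. pose proof (dC_mult _ _ t _ _ (D t) (dC_Cexp lam t)) as K. apply (dC_eq _ _ _ _ K). ring.
      - intros t _. auto_derive; auto. field. lra.
      - intros t ht. rewrite Cmod_mult, Cmod_Cexp.
        replace (Re (lam * RtoC t)%C) with (x * t) by (unfold x; simpl; unfold Re; ring).
        eapply Rle_trans; [apply Rmult_le_compat_r; [left; apply exp_pos|apply B0; lra]|].
        rewrite Rmult_assoc, <- exp_plus. apply Rmult_le_compat_l; auto. apply exp_le. nra. }
    assert (w 0 = h 0) as w0.
    { unfold w. replace (lam * RtoC 0)%C with (RtoC 0) by ring. rewrite Cexp_0. ring. }
    rewrite w0 in W.
    assert (Cmod (w y) = Cmod (h y) * exp (x * y)) as Ew.
    { unfold w. rewrite Cmod_mult, Cmod_Cexp. f_equal. f_equal. unfold x; simpl; unfold Re; ring. }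
    pose proof (Cmod_tri_rev (w y) (h 0)) as T. rewrite Ew in T.
    assert (0 <= M0 / (x - k) * exp ((x - k) * 0)) by (apply Rmult_le_pos; auto; left; apply exp_pos).
    assert (1 <= exp ((x - k) * y)) by (rewrite <- exp_0; apply exp_le; nra).
    pose proof (Cmod_ge_0 (h 0)).
    assert (Cmod (h y) * exp (x * y) <= (Cmod (h 0) + 2 * (M0 / (x - k))) * exp ((x - k) * y)).
    { assert (Cmod (h 0) <= Cmod (h 0) * exp ((x - k) * y)) by nra. lra. }
    apply Rmult_le_reg_r with (exp (x * y)); [apply exp_pos|].
    rewrite Rmult_assoc, <- exp_plus. replace (- (k * y) + x * y) with ((x - k) * y) by ring. auto.
Qed.

Definition rho_of (l : list C) : R := fold_right (fun lam acc => 2 * Re lam + acc) 0 l.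

Lemma rho_of_pos l : (forall lam, In lam l -> 0 < Re lam) -> 0 <= rho_of l.
Proof.
  induction l; simpl; intros H; [lra|]. pose proof (H a (or_introl eq_refl)). specialize (IHl ltac:(auto)). lra.
Qed.

Lemma cs_two a b al be A B : 0 <= a -> 0 <= b -> 0 <= al -> 0 <= be -> 0 <= A -> 0 <= B ->
  a * a <= al * A -> b * b <= be * B -> (a + b) * (a + b) <= (al + be) * (A + B).
Proof.
  intros ha hb hal hbe hA hB h1 h2.
  assert (2 * (a * b) <= al * B + be * A); [|nra].
  assert ((a * b) * (a * b) <= (al * B) * (be * A)).
  { replace ((a * b) * (a * b)) with ((a * a) * (b * b)) by ring. replace ((al * B) * (be * A)) with ((al * A) * (be * B)) by ring.
    apply Rmult_le_compat; auto; nra. }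
  assert (0 <= al * B) by nra. assert (0 <= be * A) by nra. assert (0 <= a * b) by nra.
  set (X := al * B) in *. set (Y := be * A) in *. clearbody X Y.
  assert ((2 * (a * b)) * (2 * (a * b)) <= (X + Y) * (X + Y)).
  { pose proof (Rle_0_sqr (X - Y)) as Q. unfold Rsqr in Q. nra. }
  apply Rsqr_incr_0; auto; nra.
Qed.

(** The energy V(y) is the integral of |h|^2 over [y, oo), computed exactly. With H the solution of
    (D - conj lam) H = (D + lam) h in the space without lam, the function e = h - H satisfies
    e' = - lam e - 2 Re lam H, hence the energy of h is that of H plus |e|^2 / (2 Re lam). The bounds for h
    and h' involve only the sum of the 2 Re lam and the size of the exponents, not their number. *)
Lemma energy Lam l : 0 <= Lam -> (forall lam, In lam l -> 0 < Re lam /\ Cmod lam <= Lam) -> forall h, expoly l h ->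
  exists V, (forall y, 0 <= V y) /\ (forall y, is_derive V y (- (Cmod (h y) * Cmod (h y)))) /\
    (forall y, Cmod (h y) * Cmod (h y) <= rho_of l * V y) /\
    (forall y d, dC h y d -> Cmod d * Cmod d <= (Lam + rho_of l) * (Lam + rho_of l) * (rho_of l * V y)) /\
    (forall eps, 0 < eps -> exists Y, forall y, Y <= y -> V y <= eps).
Proof.
  intros hLam. induction l as [|lam l IH]; intros hl h hh.
  - simpl in hh. exists (fun _ => 0). split; [|split; [|split; [|split]]]; intros; try lra.
    + rewrite hh, Cmod_0. replace (- (0 * 0)) with 0 by ring. apply (is_derive_const (V := R_NormedModule)).
    + rewrite hh, Cmod_0. simpl. lra.
    + assert (d = RtoC 0) as ->; [|rewrite Cmod_0; simpl; lra].
      apply (dC_unique h y); auto. apply dC_ext with (f := fun _ => RtoC 0); [intros; now rewrite hh|apply dC_const].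
    + exists 0. intros; lra.
  - assert (forall la, In la l -> 0 < Re la /\ Cmod la <= Lam) as hl' by (intros; apply hl; simpl; auto).
    destruct (hl lam (or_introl eq_refl)) as [hx hxL].
    pose proof hh as (g & hg & D).
    assert (forall la, In la l -> (la + Cconj lam)%C <> RtoC 0) as hne.
    { intros la hla E. apply (f_equal fst) in E. simpl in E. pose proof (proj1 (hl' la hla)). unfold Re in *. lra. }
    destruct (expoly_inv l (Cconj lam) hne g hg) as (H & hH & DH).
    destruct (IH hl' H hH) as (V0 & p1 & p2 & p3 & p4 & p5).
    set (k := 2 * Re lam). assert (0 < k) as hk by (unfold k; lra).
    set (e := fun y => (h y + (- (1)) * H y)%C).
    set (r0 := rho_of l) in *. assert (0 <= r0) as hr0 by (apply rho_of_pos; intros; apply hl'; auto).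
    assert (rho_of (lam :: l) = r0 + k) as Er by (unfold r0, k; simpl; ring). rewrite Er.
    assert (forall y, dC e y (- lam * e y - k * H y)%C) as De.
    { intros y. pose proof (dC_plus _ _ y _ _ (D y) (dC_scal (- (1)) _ y _ (DH y))) as K.
      apply (dC_eq _ _ _ _ K). unfold e, k. apply C_ext; simpl; unfold Re, Im; ring. }
    set (W := fun y => Cmod (e y) * Cmod (e y) / k).
    assert (forall y, 0 <= W y) as hW.
    { intros y. unfold W. apply Rdiv_le_0_compat; auto. pose proof (Cmod_ge_0 (e y)). nra. }
    assert (forall y, k * W y = Cmod (e y) * Cmod (e y)) as hkW by (intros; unfold W; field; lra).
    assert (forall y, h y = H y + e y)%C as Eh by (intros; unfold e; ring).
    exists (fun y => V0 y + W y). split; [|split; [|split; [|split]]].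
    + intros y. specialize (p1 y). specialize (hW y). lra.
    + intros y. destruct (De y) as [d1 d2].
      assert (forall (u : R -> R) u', is_derive u y u' -> is_derive (fun y => u y * u y) y (u' * u y + u y * u')) as M.
      { intros u u' hu. apply (is_derive_mult u u y u' u' hu hu). intros; apply Rmult_comm. }
      pose proof (is_derive_plus (V := R_NormedModule) _ _ _ _ _ (M _ _ d1) (M _ _ d2)) as K1.
      pose proof (is_derive_scal _ _ (/ k) _ K1) as K2.
      pose proof (is_derive_plus (V := R_NormedModule) _ _ _ _ _ (p2 y) K2) as K3.
      refine (is_derive_eq _ _ _ _ _ _ _ K3).
      * intros t. unfold plus, scal, mult; simpl. unfold W. rewrite Cmod_sqr. unfold Rdiv. rewrite (Rmult_comm _ (/ k)). reflexivity.
      * unfold plus, scal, mult; simpl. rewrite Eh, !Cmod_sqr. unfold k. simpl. unfold Re, Im in *. field. unfold k in hk; lra.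
    + intros y. rewrite Eh. pose proof (Cmod_triangle (H y) (e y)) as T. pose proof (Cmod_ge_0 (H y + e y)).
      apply Rle_trans with ((Cmod (H y) + Cmod (e y)) * (Cmod (H y) + Cmod (e y))); [apply Rmult_le_compat; auto|].
      apply cs_two; try apply Cmod_ge_0; auto; try lra. rewrite hkW. lra.
    + intros y d hd. assert (d = g y - lam * h y)%C as -> by (apply (dC_unique h y); auto).
      pose proof (p4 y _ (DH y)) as q4.
      set (a := sqrt (r0 * V0 y)). assert (0 <= r0 * V0 y) as hrv by (apply Rmult_le_pos; auto).
      assert (a * a = r0 * V0 y) as Ea by (apply sqrt_sqrt; auto). assert (0 <= a) as ha by apply sqrt_pos.
      assert (Cmod (g y + Cconj lam * H y) <= (Lam + r0) * a) as b1.
      { apply Rsqr_incr_0; [|apply Cmod_ge_0|apply Rmult_le_pos; lra]. unfold Rsqr.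
        eapply Rle_trans; [apply q4|]. right. rewrite <- Ea. ring. }
      assert (Cmod (H y) <= a) as b2.
      { apply Rsqr_incr_0; [|apply Cmod_ge_0|auto]. unfold Rsqr. rewrite Ea. auto. }
      assert (g y - lam * h y = (g y + Cconj lam * H y) + (- lam * e y + - (RtoC k) * H y))%C as E1.
      { unfold e, k. apply C_ext; simpl; unfold Re, Im; ring. }
      assert (Cmod (g y - lam * h y) <= (Lam + (r0 + k)) * (a + Cmod (e y))) as b3.
      { rewrite E1. eapply Rle_trans; [apply Cmod_triangle|].
        pose proof (Cmod_triangle (- lam * e y) (- (RtoC k) * H y)) as T. rewrite !Cmod_mult, !Cmod_opp, Cmod_R, Rabs_pos_eq in T by lra.
        pose proof (Cmod_ge_0 (e y)). pose proof (Cmod_ge_0 (H y)).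
        assert (Cmod lam * Cmod (e y) <= Lam * Cmod (e y)) by (apply Rmult_le_compat_r; auto).
        assert (k * Cmod (H y) <= k * a) by (apply Rmult_le_compat_l; lra).
        assert (0 <= (r0 + k) * Cmod (e y)) by (apply Rmult_le_pos; lra). lra. }
      apply Rle_trans with (((Lam + (r0 + k)) * (a + Cmod (e y))) * ((Lam + (r0 + k)) * (a + Cmod (e y)))).
      { apply Rmult_le_compat; auto; apply Cmod_ge_0. }
      replace (((Lam + (r0 + k)) * (a + Cmod (e y))) * ((Lam + (r0 + k)) * (a + Cmod (e y))))
        with ((Lam + (r0 + k)) * (Lam + (r0 + k)) * ((a + Cmod (e y)) * (a + Cmod (e y)))) by ring.
      apply Rmult_le_compat_l; [nra|].
      apply cs_two; try apply Cmod_ge_0; auto; try lra. rewrite hkW. lra.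
    + intros eps he. destruct (p5 (eps / 2)) as [Y1 hY1]; [lra|].
      destruct (expoly_decay (lam :: l)) with (h := h) as (k1 & M1 & hk1 & hM1 & B1); auto. { intros; apply hl; auto. }
      destruct (expoly_decay l) with (h := H) as (k2 & M2 & hk2 & hM2 & B2); auto. { intros; apply hl'; auto. }
      set (kk := Rmin k1 k2). assert (0 < kk) as hkk by (apply Rmin_pos; auto).
      pose proof (Rmin_l k1 k2). pose proof (Rmin_r k1 k2). fold kk in H0, H1.
      set (Q := (M1 + M2) * (M1 + M2) / k + 1).
      assert (0 < Q) as hQ. { unfold Q. assert (0 <= (M1 + M2) * (M1 + M2) / k) by (apply Rdiv_le_0_compat; nra). lra. }
      set (Y2 := 2 * Q / (eps * kk)).
      assert (0 < Y2) as hY2 by (apply Rdiv_lt_0_compat; nra).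
      exists (Rmax Y1 Y2). intros y hy. pose proof (Rmax_l Y1 Y2). pose proof (Rmax_r Y1 Y2).
      specialize (hY1 y ltac:(lra)).
      assert (W y <= eps / 2); [|lra].
      assert (Cmod (e y) <= (M1 + M2) * exp (- (kk * y))) as b.
      { unfold e. eapply Rle_trans; [apply Cmod_triangle|]. rewrite Cmod_mult, Cmod_opp, Cmod_1, Rmult_1_l.
        assert (exp (- (k1 * y)) <= exp (- (kk * y))) by (apply exp_le; nra).
        assert (exp (- (k2 * y)) <= exp (- (kk * y))) by (apply exp_le; nra).
        pose proof (B1 y ltac:(lra)). pose proof (B2 y ltac:(lra)).
        assert (M1 * exp (- (k1 * y)) <= M1 * exp (- (kk * y))) by (apply Rmult_le_compat_l; auto).
        assert (M2 * exp (- (k2 * y)) <= M2 * exp (- (kk * y))) by (apply Rmult_le_compat_l; auto). lra. }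
      set (E := exp (- (kk * y))) in *.
      assert (0 < E) as hE by apply exp_pos.
      assert (kk * y * E <= 1) as hE1.
      { pose proof (exp_ineq1_le (kk * y)). assert (exp (kk * y) * E = 1) by (unfold E; rewrite <- exp_plus; replace (kk * y + - (kk * y)) with 0 by ring; apply exp_0). nra. }
      assert (E <= 1) as hE2 by (unfold E; rewrite <- exp_0; apply exp_le; nra).
      assert (W y <= Q * E).
      { unfold W. apply Rle_trans with ((M1 + M2) * E * ((M1 + M2) * E) / k).
        - unfold Rdiv. apply Rmult_le_compat_r; [left; apply Rinv_0_lt_compat; auto|]. apply Rmult_le_compat; auto; apply Cmod_ge_0.
        - replace ((M1 + M2) * E * ((M1 + M2) * E) / k) with ((Q - 1) * (E * E)) by (unfold Q; field; lra).
          assert (0 <= Q - 1). { unfold Q. assert (0 <= (M1 + M2) * (M1 + M2) / k) by (apply Rdiv_le_0_compat; nra). lra. }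
          assert ((Q - 1) * (E * E) <= (Q - 1) * E) by (apply Rmult_le_compat_l; nra). lra. }
      assert (2 * Q <= eps * (kk * y)) as hy3.
      { apply Rle_trans with (Y2 * (eps * kk)); [right; unfold Y2; field; lra|]. assert (0 < eps * kk) by nra. nra. }
      assert (2 * Q * E <= eps * (kk * y) * E) by (apply Rmult_le_compat_r; lra).
      assert (eps * (kk * y) * E <= eps * 1) by (rewrite Rmult_assoc; apply Rmult_le_compat_l; lra). lra.
Qed.

(** * Sampling at the points ln n *)

(** For h(y) = y^i e^{-(s - 1/2) y} this is the sequence of the (ln n)^i n^{-s}. *)
Definition sample (h : R -> C) (k : nat) : C := (RtoC (Rpower (INR (S k)) (- (1 / 2))) * h (lnS k))%C.

Lemma sample_sqr h k : Cmod (sample h k) * Cmod (sample h k) = / INR (S k) * (Cmod (h (lnS k)) * Cmod (h (lnS k))).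
Proof.
  unfold sample. rewrite Cmod_mult, Cmod_R, Rabs_pos_eq by (left; apply exp_pos).
  transitivity (Rpower (INR (S k)) (- (1 / 2)) * Rpower (INR (S k)) (- (1 / 2)) * (Cmod (h (lnS k)) * Cmod (h (lnS k)))); [ring|].
  f_equal. rewrite <- Rpower_plus. replace (- (1 / 2) + - (1 / 2)) with (- (1)) by field.
  rewrite Rpower_Ropp, Rpower_1; auto. apply INR_S_pos.
Qed.

Lemma lnS_le n m : (n <= m)%nat -> lnS n <= lnS m.
Proof. intros h. unfold lnS. apply ln_le; [apply INR_S_pos|]. apply le_INR; lia. Qed.

Lemma lnS_large Y : exists n, Y <= lnS n.
Proof.
  destruct (nfloor_ex (exp Y)) as [n [_ hn]]; [left; apply exp_pos|].
  exists n. unfold lnS. rewrite <- (ln_exp Y). apply ln_le; [apply exp_pos|]. rewrite S_INR. lra.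
Qed.

(** The energy at lnS N is the integral of |h|^2 beyond lnS N. Its Riemann sum at the points lnS k is the sum of
    the squares of the samples, and the error is at most half of the energy when N is large, because |h'|^2 is
    bounded by a multiple of the energy. The energy grows at most exponentially from lnS N back to 0, where
    it controls h(0). The constants K and N depend only on Lam and rho. *)
Lemma sample_bound Lam rho : 0 <= Lam -> 0 <= rho -> exists K, 0 < K /\ exists N : nat, (1 <= N)%nat /\ forall l h B,
  (forall lam, In lam l -> 0 < Re lam /\ Cmod lam <= Lam) -> rho_of l <= rho -> expoly l h ->
  (forall M, (N <= M)%nat -> rsum (fun k => Cmod (sample h k) * Cmod (sample h k)) M
      - rsum (fun k => Cmod (sample h k) * Cmod (sample h k)) N <= B) ->
  Cmod (h 0) * Cmod (h 0) <= K * B.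
Proof.
  intros hLam hrho. set (B2 := (Lam + rho) * (Lam + rho) * rho).
  assert (0 <= B2) as hB2 by (unfold B2; apply Rmult_le_pos; [nra|auto]).
  destruct (inv_INR_small (1 / (32 * (B2 + 1)))) as [N' hN'].
  { apply Rdiv_lt_0_compat; lra. }
  set (N := S N'). assert (1 <= N)%nat as hN1 by (unfold N; lia).
  assert (/ INR (S N) <= 1 / (32 * (B2 + 1))) as hN by (apply hN'; unfold N; lia). clearbody N.
  exists ((rho + 1) * exp (rho * lnS N) * 4). split.
  { pose proof (exp_pos (rho * lnS N)). assert (0 < (rho + 1) * exp (rho * lnS N)) by (apply Rmult_lt_0_compat; lra). lra. }
  exists N. split; auto. intros l h B hl hrl hh hB.
  destruct (energy Lam l hLam hl h hh) as (V & p1 & p2 & p3 & p4 & p5).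
  assert (0 <= rho_of l) as hr0 by (apply rho_of_pos; intros; apply hl; auto).
  assert (forall a b, a <= b -> V b <= V a) as Vdec.
  { intros a b hab. assert (- V a <= - V b); [|lra].
    apply (nondecreasing (fun y => - V y) (fun y => Cmod (h y) * Cmod (h y))); auto.
    - intros x _. pose proof (is_derive_opp (V := R_NormedModule) _ _ _ (p2 x)) as K. unfold opp in K; simpl in K.
      rewrite Ropp_involutive in K. exact K.
    - intros x _. pose proof (Cmod_ge_0 (h x)). nra. }
  assert (forall k, (N <= k)%nat -> V (lnS k) - V (lnS (S k)) <=
    2 * (Cmod (sample h k) * Cmod (sample h k)) + 8 * B2 * V (lnS N) * (/ INR (S N) * npw 2 k)) as step.
  { intros k hk. pose proof (lnS_step k) as [d0 d1]. set (dl := lnS (S k) - lnS k) in *.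
    assert (lnS k <= lnS (S k)) as hle by (unfold dl in d0; lra).
    destruct (MVT_gen V (lnS k) (lnS (S k)) (fun y => - (Cmod (h y) * Cmod (h y)))) as (xi & hxi & E).
    { intros; apply p2. }
    { intros x _. apply continuity_pt_filterlim. apply (ex_derive_continuous (V := R_NormedModule)). eexists; apply p2. }
    rewrite Rmin_left, Rmax_right in hxi by auto. fold dl in E.
    destruct (expoly_D l h hh) as (dh & _ & Dh).
    set (b := sqrt (B2 * V (lnS k))).
    assert (0 <= B2 * V (lnS k)) as hbv by (apply Rmult_le_pos; auto).
    assert (b * b = B2 * V (lnS k)) as Eb by (apply sqrt_sqrt; auto). assert (0 <= b) as hb by apply sqrt_pos.
    assert (Cmod (h xi - h (lnS k)) <= 2 * (b * dl)) as hd.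
    { eapply Rle_trans; [apply (derive_compare_C h dh (fun y => b * y) (fun _ => b)); auto|].
      - lra.
      - intros x _. auto_derive; auto. ring.
      - intros x hx. apply Rsqr_incr_0; [|apply Cmod_ge_0|auto]. unfold Rsqr. rewrite Eb.
        eapply Rle_trans; [apply (p4 x _ (Dh x))|]. unfold B2.
        pose proof (Vdec (lnS k) x ltac:(lra)). pose proof (p1 x).
        rewrite (Rmult_assoc ((Lam + rho) * (Lam + rho)) rho).
        apply Rmult_le_compat; [nra|apply Rmult_le_pos; auto| |]; apply Rmult_le_compat; auto; lra.
      - apply Rmult_le_compat_l; [lra|]. unfold dl. nra. }
    set (hk0 := h (lnS k)) in *.
    assert (Cmod (h xi) * Cmod (h xi) <= 2 * (Cmod hk0 * Cmod hk0) + 8 * (b * b) * (dl * dl)) as hsq.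
    { pose proof (Cmod_tri_rev (h xi) hk0). pose proof (Cmod_ge_0 (h xi)). pose proof (Cmod_ge_0 hk0).
      assert (0 <= b * dl) by nra.
      apply Rle_trans with ((Cmod hk0 + 2 * (b * dl)) * (Cmod hk0 + 2 * (b * dl))); [apply Rmult_le_compat; lra|]. pose proof (Rle_0_sqr (Cmod hk0 - 2 * (b * dl))) as Q; unfold Rsqr in Q; lra. }
    assert (V (lnS k) - V (lnS (S k)) = Cmod (h xi) * Cmod (h xi) * dl) as E' by lra.
    rewrite E', sample_sqr. fold hk0.
    pose proof (INR_S_pos k) as ik. pose proof (Rinv_0_lt_compat _ ik) as ik'.
    assert (Cmod (h xi) * Cmod (h xi) * dl <= (2 * (Cmod hk0 * Cmod hk0) + 8 * (b * b) * (dl * dl)) * / INR (S k)).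
    { apply Rmult_le_compat; auto. pose proof (Cmod_ge_0 (h xi)). nra. }
    assert (npw 2 k = / INR (S k) * / INR (S k)) as En.
    { replace 2 with (1 + 1) by ring. rewrite npw_plus, npw_1. auto. }
    assert (/ INR (S k) <= / INR (S N)) as hkN.
    { apply Rinv_le_contravar; [apply INR_S_pos|]. apply le_INR; lia. }
    assert (dl * dl <= / INR (S k) * / INR (S k)) as hdl by (apply Rmult_le_compat; auto).
    assert (V (lnS k) <= V (lnS N)) as hVk by (apply Vdec, lnS_le; auto).
    assert (8 * (b * b) * (dl * dl) * / INR (S k) <= 8 * B2 * V (lnS N) * (/ INR (S N) * npw 2 k)).
    { rewrite Eb, En.
      apply Rle_trans with (8 * (B2 * V (lnS N)) * (/ INR (S k) * / INR (S k)) * / INR (S N)).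
      - apply Rmult_le_compat; auto; [|lra|].
        + apply Rmult_le_pos; [lra|nra].
        + apply Rmult_le_compat; auto; [lra|nra|]. apply Rmult_le_compat_l; [lra|]. apply Rmult_le_compat_l; auto.
      - right. ring. }
    lra. }
  assert (forall M, (N <= M)%nat -> V (lnS N) - V (lnS M) <= 2 * B + V (lnS N) / 2) as tele.
  { intros M hM.
    assert (V (lnS N) - V (lnS M) <= 2 * (rsum (fun k => Cmod (sample h k) * Cmod (sample h k)) M
      - rsum (fun k => Cmod (sample h k) * Cmod (sample h k)) N) +
      8 * B2 * V (lnS N) * / INR (S N) * (rsum (npw 2) M - rsum (npw 2) N)) as T.
    { clear - hM step. induction hM as [|M hM IH]; [lra|].
      specialize (step M hM). simpl rsum. lra. }
    pose proof (npw_sum 2 M ltac:(lra)) as K.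
    assert (0 <= rsum (npw 2) N) by (apply rsum_pos; intros; left; apply npw_pos).
    specialize (hB M hM).
    assert (8 * B2 * V (lnS N) * / INR (S N) * (rsum (npw 2) M - rsum (npw 2) N) <= V (lnS N) / 2); [|lra].
    pose proof (p1 (lnS N)) as hV. pose proof (Rinv_0_lt_compat _ (INR_S_pos N)).
    assert (rsum (npw 2) N <= rsum (npw 2) M) by (apply rsum_mono; auto; intros; left; apply npw_pos).
    apply Rle_trans with (8 * B2 * V (lnS N) * / INR (S N) * 2).
    - apply Rmult_le_compat_l; [|lra]. repeat apply Rmult_le_pos; lra.
    - assert (B2 * / INR (S N) <= 1 / 32).
      { apply Rle_trans with (B2 * (1 / (32 * (B2 + 1)))); [apply Rmult_le_compat_l; auto|].
        apply Rmult_le_reg_r with (32 * (B2 + 1)); [lra|]. replace (B2 * (1 / (32 * (B2 + 1))) * (32 * (B2 + 1))) with B2 by (field; lra). lra. }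
      replace (8 * B2 * V (lnS N) * / INR (S N) * 2) with (16 * (B2 * / INR (S N)) * V (lnS N)) by ring. nra. }
  assert (V (lnS N) <= 4 * B) as hVN.
  { apply le_eps. intros eps he. destruct (p5 (eps / 2)) as [Y hY]; [lra|].
    destruct (lnS_large Y) as [n hn]. specialize (tele (Nat.max N n) ltac:(lia)).
    pose proof (hY (lnS (Nat.max N n))) as K.
    assert (Y <= lnS (Nat.max N n)) by (eapply Rle_trans; [exact hn|]; apply lnS_le; lia). specialize (K H). lra. }
  assert (V 0 <= V (lnS N) * exp (rho * lnS N)) as hV0.
  { pose proof (lnS_pos N).
    assert (V 0 * exp (rho * 0) <= V (lnS N) * exp (rho * lnS N)) as K.
    { apply (nondecreasing (fun y => V y * exp (rho * y)) (fun y => - (Cmod (h y) * Cmod (h y)) * exp (rho * y) + V y * (rho * exp (rho * y)))); auto.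
      - intros x _. apply (is_derive_mult V (fun y => exp (rho * y)) x); [apply p2| |intros; apply Rmult_comm].
        auto_derive; auto. ring.
      - intros x _. pose proof (p3 x). pose proof (p1 x). pose proof (exp_pos (rho * x)).
        assert (rho_of l * V x <= rho * V x) by (apply Rmult_le_compat_r; auto).
        replace (- (Cmod (h x) * Cmod (h x)) * exp (rho * x) + V x * (rho * exp (rho * x)))
          with ((rho * V x - Cmod (h x) * Cmod (h x)) * exp (rho * x)) by ring. apply Rmult_le_pos; lra. }
    rewrite Rmult_0_r, exp_0, Rmult_1_r in K. auto. }
  pose proof (p3 0) as h0. pose proof (p1 0) as v0. pose proof (exp_pos (rho * lnS N)) as ep.
  assert (rho_of l * V 0 <= (rho + 1) * V 0) by (apply Rmult_le_compat_r; lra).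
  assert (V (lnS N) * exp (rho * lnS N) <= 4 * B * exp (rho * lnS N)) by (apply Rmult_le_compat_r; lra).
  assert ((rho + 1) * V 0 <= (rho + 1) * (4 * B * exp (rho * lnS N))) by (apply Rmult_le_compat_l; lra).
  lra.
Qed.

(** * Orthogonal projection in the sequence space *)

Definition L2 (u : nat -> C) : Prop := exists B, forall N, sqsum u N <= B.

Definition sqnorm (u : nat -> C) : R := real (Lim_seq (sqsum u)).

Lemma sq_pos (z : C) : 0 <= Cmod z * Cmod z.
Proof. pose proof (Cmod_ge_0 z). nra. Qed.

Lemma sqsum_mono u N M : (N <= M)%nat -> sqsum u N <= sqsum u M.
Proof. intros h. apply rsum_mono; auto. intros; apply sq_pos. Qed.

Lemma sqnorm_lim u : L2 u -> is_lim_seq (sqsum u) (Finite (sqnorm u)).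
Proof.
  intros [B hB]. destruct (ex_finite_lim_seq_incr (sqsum u) B) as [l hl]; auto.
  - intros n. apply sqsum_mono. lia.
  - unfold sqnorm. rewrite (is_lim_seq_unique _ _ hl). exact hl.
Qed.

Lemma sqnorm_ge u N : L2 u -> sqsum u N <= sqnorm u.
Proof. intros h. apply is_lim_seq_incr_compare; [apply sqnorm_lim; auto|]. intros. apply sqsum_mono. lia. Qed.

Lemma sqnorm_le u B : (forall N, sqsum u N <= B) -> L2 u /\ sqnorm u <= B.
Proof.
  intros h. assert (L2 u) as hu by (exists B; auto). split; auto.
  apply (is_lim_seq_le (sqsum u) (fun _ => B) (Finite (sqnorm u)) (Finite B)); auto; [apply sqnorm_lim; auto|apply is_lim_seq_const].
Qed.

Lemma sqsum_comb u v (s : R) N : 0 < s ->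
  sqsum (fun k => u k + v k)%C N <= (1 + s) * sqsum u N + (1 + / s) * sqsum v N.
Proof.
  intros hs. unfold sqsum. rewrite <- !rsum_scal, <- rsum_plus. apply rsum_le. intros k _.
  pose proof (Cmod_triangle (u k) (v k)) as T. pose proof (Cmod_ge_0 (u k + v k)).
  set (a := Cmod (u k)) in *. set (b := Cmod (v k)) in *.
  apply Rle_trans with ((a + b) * (a + b)); [apply Rmult_le_compat; auto|].
  assert (0 < / s) by (apply Rinv_0_lt_compat; auto).
  assert (2 * (a * b) <= s * (a * a) + / s * (b * b)); [|lra].
  assert (0 <= / s * ((s * a - b) * (s * a - b))) as K by (apply Rmult_le_pos; [lra|apply Rle_0_sqr]).
  replace (/ s * ((s * a - b) * (s * a - b))) with (s * (a * a) + / s * (b * b) - 2 * (a * b)) in K by (field; lra). lra.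
Qed.

Lemma L2_plus u v : L2 u -> L2 v -> L2 (fun k => u k + v k)%C.
Proof.
  intros [B hB] [B' hB']. exists (2 * B + 2 * B'). intros N. specialize (hB N). specialize (hB' N).
  pose proof (sqsum_comb u v 1 N ltac:(lra)) as K. rewrite Rinv_1 in K. lra.
Qed.

Lemma sqsum_scal c u N : sqsum (fun k => c * u k)%C N = Cmod c * Cmod c * sqsum u N.
Proof. unfold sqsum. rewrite <- rsum_scal. apply rsum_ext. intros. rewrite Cmod_mult. ring. Qed.

Lemma L2_scal c u : L2 u -> L2 (fun k => c * u k)%C.
Proof.
  intros [B hB]. exists (Cmod c * Cmod c * B). intros N. rewrite sqsum_scal.
  apply Rmult_le_compat_l; [apply sq_pos|auto].
Qed.

Lemma L2_minus u v : L2 u -> L2 v -> L2 (fun k => u k - v k)%C.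
Proof.
  intros hu hv. destruct (L2_plus u (fun k => (- (1)) * v k)%C hu (L2_scal _ v hv)) as [B hB].
  exists B. intros N. eapply Rle_trans; [|apply (hB N)]. right. apply rsum_ext. intros.
  replace (u k + - (1) * v k)%C with (u k - v k)%C by ring. auto.
Qed.

Lemma sqnorm_triangle u v s : L2 u -> L2 v -> 0 < s -> sqnorm (fun k => u k + v k)%C <= (1 + s) * sqnorm u + (1 + / s) * sqnorm v.
Proof.
  intros hu hv hs. apply sqnorm_le. intros N. eapply Rle_trans; [apply (sqsum_comb u v s); auto|].
  assert (0 < / s) by (apply Rinv_0_lt_compat; auto).
  apply Rplus_le_compat; apply Rmult_le_compat_l; try lra; apply sqnorm_ge; auto.
Qed.

Lemma sqnorm_parallelogram u v : L2 u -> L2 v ->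
  sqnorm (fun k => u k - v k)%C + sqnorm (fun k => u k + v k)%C = 2 * sqnorm u + 2 * sqnorm v.
Proof.
  intros hu hv.
  pose proof (is_lim_seq_plus' _ _ _ _ (sqnorm_lim _ (L2_minus u v hu hv)) (sqnorm_lim _ (L2_plus u v hu hv))) as K1.
  pose proof (is_lim_seq_plus' _ _ _ _ (is_lim_seq_scal_l _ 2 _ (sqnorm_lim _ hu)) (is_lim_seq_scal_l _ 2 _ (sqnorm_lim _ hv))) as K2.
  simpl in K2. apply is_lim_seq_unique in K1. apply is_lim_seq_unique in K2.
  rewrite (Lim_seq_ext _ (fun n => 2 * sqsum u n + 2 * sqsum v n)) in K1.
  - rewrite K1 in K2. injection K2. auto.
  - intros n. unfold sqsum. rewrite <- !rsum_scal, <- !rsum_plus. apply rsum_ext. intros k _.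
    rewrite !Cmod_sqr. simpl. unfold Re, Im. ring.
Qed.

Lemma sqnorm_ext u v : (forall k, u k = v k) -> sqnorm u = sqnorm v.
Proof. intros E. replace v with u; auto. apply functional_extensionality, E. Qed.

Lemma sqnorm_scal c u : L2 u -> sqnorm (fun k => c * u k)%C = Cmod c * Cmod c * sqnorm u.
Proof.
  intros hu. pose proof (is_lim_seq_scal_l _ (Cmod c * Cmod c) _ (sqnorm_lim _ hu)) as K. simpl in K.
  unfold sqnorm at 1. rewrite (Lim_seq_ext _ (fun n => Cmod c * Cmod c * sqsum u n)) by (intros; apply sqsum_scal).
  rewrite (is_lim_seq_unique _ _ K). reflexivity.
Qed.

(** The projection theorem: the residuals of a minimising sequence converge by the parallelogram law, and their
    limit U is a vector of minimal norm, hence orthogonal to V. The conjugate of U is the vector sought. *)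
Lemma orthogonal_vector (V : (nat -> C) -> Prop) (dl : nat -> C) (d0 : R) :
  (forall g, V g -> L2 g) -> (exists g, V g) ->
  (forall f g, V f -> V g -> V (fun k => f k + g k)%C) -> (forall c g, V g -> V (fun k => c * g k)%C) ->
  L2 dl -> 0 < d0 -> (forall g, V g -> d0 <= sqnorm (fun k => dl k - g k)%C) ->
  exists a, L2 a /\ (exists k, a k <> RtoC 0) /\ forall g, V g -> clim (csum (fun k => a k * g k)%C) (RtoC 0).
Proof.
  intros hV [g0 hg0] hplus hscal hdl hd0 hdist.
  set (S := fun x => exists g, V g /\ x = - sqnorm (fun k => dl k - g k)%C).
  destruct (completeness S) as (md & hub & hlub).
  { exists (- d0). intros x (g & hg & ->). specialize (hdist g hg). lra. }
  { exists (- sqnorm (fun k => dl k - g0 k)%C). exists g0. auto. }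
  set (d := - md).
  assert (forall g, V g -> d <= sqnorm (fun k => dl k - g k)%C) as hd.
  { intros g hg. specialize (hub _ (ex_intro _ g (conj hg eq_refl))). unfold d. lra. }
  assert (d0 <= d) as hd0d.
  { assert (md <= - d0); [|unfold d; lra]. apply hlub. intros x (g & hg & ->). specialize (hdist g hg). lra. }
  assert (forall n, exists g, V g /\ sqnorm (fun k => dl k - g k)%C <= d + / INR (Datatypes.S n)) as seqex.
  { intros n. apply NNPP. intros H. assert (md <= md - / INR (Datatypes.S n)).
    { apply hlub. intros x (g & hg & ->). apply Rnot_lt_le. intros L. apply H. exists g. split; auto. unfold d. lra. }
    pose proof (Rinv_0_lt_compat _ (INR_S_pos n)). lra. }
  destruct (choice _ seqex) as [g hg]. clear seqex.
  set (u := fun n k => (dl k - g n k)%C).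
  assert (forall n, L2 (u n)) as hu by (intros n; apply L2_minus; auto; apply hV, hg).
  assert (forall n m, sqnorm (fun k => u n k - u m k)%C <= 2 * / INR (Datatypes.S n) + 2 * / INR (Datatypes.S m)) as hc.
  { intros n m. pose proof (sqnorm_parallelogram (u n) (u m) (hu n) (hu m)) as P.
    assert (4 * d <= sqnorm (fun k => u n k + u m k)%C).
    { set (gm := fun k => (RtoC (/ 2) * (g n k + g m k))%C).
      assert (V gm) as hgm by (apply hscal, hplus; apply hg).
      rewrite (sqnorm_ext _ (fun k => RtoC 2 * (dl k - gm k))%C).
      - rewrite sqnorm_scal, Cmod_R, Rabs_pos_eq by (try lra; apply L2_minus; auto). specialize (hd gm hgm). lra.
      - intros k. unfold u, gm. apply C_ext; simpl; field. }
    pose proof (proj2 (hg n)). pose proof (proj2 (hg m)). unfold u in *. lra. }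
  assert (forall n m k, Cmod (u n k - u m k) * Cmod (u n k - u m k) <= 2 * / INR (Datatypes.S n) + 2 * / INR (Datatypes.S m)) as hck.
  { intros n m k. eapply Rle_trans; [|apply hc]. 
    eapply Rle_trans; [|apply (sqnorm_ge _ (Datatypes.S k))]; [|apply L2_minus; auto].
    set (w := fun k => Cmod (u n k - u m k) * Cmod (u n k - u m k)).
    change (w k <= rsum w k + w k). pose proof (rsum_pos w k (fun k => sq_pos _)). lra. }
  assert (forall k, exists l, clim (fun n => u n k) l) as hlk.
  { intros k. apply clim_cauchy. intros eps he. destruct (inv_INR_small (eps * eps / 8)) as [N hN]; [nra|].
    exists N. intros n m hn hm. pose proof (hck n m k). pose proof (hN n hn). pose proof (hN m hm).
    pose proof (Cmod_ge_0 (u n k - u m k)). destruct (Rlt_le_dec (Cmod (u n k - u m k)) eps); auto. exfalso. nra. }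
  destruct (choice _ hlk) as [U hU]. clear hlk.
  assert (forall n N, sqsum (fun k => U k - u n k)%C N <= 4 * / INR (Datatypes.S n)) as hUn.
  { intros n N. apply le_eps. intros eps he.
    assert (is_lim_seq (fun m => sqsum (fun k => u m k - u n k)%C N) (Finite (sqsum (fun k => U k - u n k)%C N))) as L.
    { unfold sqsum. induction N; simpl; [apply is_lim_seq_const|].
      apply is_lim_seq_plus'; auto.
      assert (is_lim_seq (fun m => Cmod (u m N - u n N)) (Finite (Cmod (U N - u n N)))) as LM.
      { apply is_lim_seq_spec. intros e. destruct (hU N e (cond_pos e)) as [M hM]. exists M. intros m hm.
        specialize (hM m hm). eapply Rle_lt_trans; [|apply hM].
        pose proof (Cmod_tri_rev (u m N - u n N) (U N - u n N)). pose proof (Cmod_tri_rev (U N - u n N) (u m N - u n N)).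
        replace (u m N - u n N - (U N - u n N))%C with (u m N - U N)%C in H by ring.
        replace (U N - u n N - (u m N - u n N))%C with (U N - u m N)%C in H0 by ring.
        rewrite (Cmod_minus_sym (U N) (u m N)) in H0. apply Rabs_le. lra. }
      apply (is_lim_seq_mult' _ _ _ _ LM LM). }
    assert (sqsum (fun k => U k - u n k)%C N <= 4 * / INR (Datatypes.S n)); [|lra].
    apply (is_lim_seq_le_loc (fun m => sqsum (fun k => u m k - u n k)%C N) (fun _ => 4 * / INR (Datatypes.S n)) (Finite _) (Finite _)).
    - exists n. intros m hm. eapply Rle_trans; [apply sqnorm_ge, L2_minus; auto|]. eapply Rle_trans; [apply hc|].
      assert (/ INR (Datatypes.S m) <= / INR (Datatypes.S n)); [|lra]. apply Rinv_le_contravar; [apply INR_S_pos|apply le_INR; lia].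
    - exact L.
    - apply is_lim_seq_const. }
  assert (forall n, L2 (fun k => U k - u n k)%C /\ sqnorm (fun k => U k - u n k)%C <= 4 * / INR (Datatypes.S n)) as hUn2.
  { intros n. apply sqnorm_le. auto. }
  assert (L2 U) as hUL.
  { destruct (L2_plus _ _ (proj1 (hUn2 0%nat)) (hu 0%nat)) as [B hB]. exists B. intros N.
    eapply Rle_trans; [|apply (hB N)]. right. apply rsum_ext. intros. replace (U k - u 0%nat k + u 0%nat k)%C with (U k) by ring. auto. }
  (* U is at distance exactly d *)
  assert (forall s, 0 < s -> sqnorm U <= (1 + s) * d) as hle.
  { intros s hs. assert (0 < / s) by (apply Rinv_0_lt_compat; auto). apply le_eps. intros eps he.
    set (cs := (1 + s) + (1 + / s) * 4). assert (0 < cs) as hcs by (unfold cs; lra).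
    destruct (inv_INR_small (eps / cs)) as [n hn]; [apply Rdiv_lt_0_compat; lra|]. specialize (hn n (le_n _)).
    pose proof (sqnorm_triangle (u n) (fun k => U k - u n k)%C s (hu n) (proj1 (hUn2 n)) hs) as T.
    rewrite (sqnorm_ext _ U) in T by (intros; ring). pose proof (proj2 (hUn2 n)). pose proof (proj2 (hg n)) as hgn.
    change (fun k => dl k - g n k)%C with (u n) in hgn. set (y := / INR (Datatypes.S n)) in *.
    assert ((1 + s) * sqnorm (u n) <= (1 + s) * (d + y)) by (apply Rmult_le_compat_l; lra).
    assert ((1 + / s) * sqnorm (fun k => U k - u n k)%C <= (1 + / s) * (4 * y)) by (apply Rmult_le_compat_l; lra).
    assert (cs * y <= eps).
    { apply Rle_trans with (cs * (eps / cs)); [apply Rmult_le_compat_l; lra|right; field; lra]. }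
    unfold cs in *. lra. }
  assert (sqnorm U <= d) as hUd.
  { apply le_eps. intros eps he. pose proof (hle (eps / (d + 1)) ltac:(apply Rdiv_lt_0_compat; lra)) as K.
    assert (eps / (d + 1) * d <= eps); [|lra].
    apply Rmult_le_reg_r with (d + 1); [lra|]. replace (eps / (d + 1) * d * (d + 1)) with (eps * d) by (field; lra). nra. }
  assert (forall h, V h -> d <= sqnorm (fun k => U k - h k)%C) as hge.
  { intros h hh. assert (L2 (fun k => U k - h k)%C) as hL by (apply L2_minus; auto).
    apply le_eps. intros eps he. set (Q := sqnorm (fun k => U k - h k)%C).
    assert (0 <= Q) as hQ by (eapply Rle_trans; [|apply (sqnorm_ge _ 0); auto]; unfold sqsum; simpl; lra).
    set (s := eps / 2 / (Q + 1)). assert (0 < s) as hs by (apply Rdiv_lt_0_compat; lra).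
    assert (0 < / s) by (apply Rinv_0_lt_compat; auto).
    set (cs := (1 + / s) * 4). assert (0 < cs) as hcs by (unfold cs; lra).
    destruct (inv_INR_small (eps / 2 / cs)) as [n hn]; [apply Rdiv_lt_0_compat; lra|]. specialize (hn n (le_n _)).
    pose proof (sqnorm_triangle (fun k => U k - h k)%C (fun k => - (1) * (U k - u n k))%C s hL (L2_scal _ _ (proj1 (hUn2 n))) hs) as T.
    rewrite (sqnorm_scal _ _ (proj1 (hUn2 n))), Cmod_opp, Cmod_1, !Rmult_1_l in T. fold Q in T.
    rewrite (sqnorm_ext _ (fun k => dl k - (g n k + h k))%C) in T by (intros; unfold u; ring).
    pose proof (hd _ (hplus _ _ (proj1 (hg n)) hh)) as K. pose proof (proj2 (hUn2 n)).
    assert (s * Q <= eps / 2).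
    { unfold s. apply Rmult_le_reg_r with (Q + 1); [lra|]. replace (eps / 2 / (Q + 1) * Q * (Q + 1)) with (eps / 2 * Q) by (field; lra). nra. }
    assert ((1 + / s) * sqnorm (fun k => U k - u n k)%C <= (1 + / s) * (4 * / INR (Datatypes.S n))) by (apply Rmult_le_compat_l; lra).
    assert (cs * / INR (Datatypes.S n) <= eps / 2).
    { apply Rle_trans with (cs * (eps / 2 / cs)); [apply Rmult_le_compat_l; lra|right; field; lra]. }
    unfold cs in *. lra. }
  exists (fun k => Cconj (U k)). split; [|split].
  - destruct hUL as [B hB]. exists B. intros N. eapply Rle_trans; [|apply (hB N)]. right. apply rsum_ext. intros. now rewrite Cmod_conj.
  - apply NNPP. intros H.
    assert (forall k, U k = RtoC 0) as U0.
    { intros k. destruct (Ceq_dec (U k) (RtoC 0)) as [e|ne]; auto. exfalso. apply H. exists k. intros e. apply ne.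
      rewrite <- (Cconj_conj (U k)), e. csolve. }
    assert (V (fun k => 0 * g0 k)%C) as hz by (apply hscal; auto).
    assert (sqnorm U <= 0) as K.
    { apply sqnorm_le. intros N. unfold sqsum. rewrite (rsum_ext _ (fun k => 0 * 0)).
      - rewrite rsum_scal. lra.
      - intros k _. rewrite U0, Cmod_0. ring. }
    pose proof (hge _ hz) as K2. rewrite (sqnorm_ext _ U) in K2 by (intros; ring). lra.
  - intros h hh. pose proof (hV h hh) as hhL.
    assert (exists c, clim (csum (fun k => Cconj (U k) * h k)%C) c) as [c hcc].
    { apply csum_cauchy with (v := fun k => Cmod (U k) * Cmod (U k) + Cmod (h k) * Cmod (h k)) (L := sqnorm U + sqnorm h).
      - intros k. rewrite Cmod_mult, Cmod_conj. pose proof (Cmod_ge_0 (U k)). pose proof (Cmod_ge_0 (h k)). nra.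
      - intros N. rewrite rsum_plus. apply Rplus_le_compat; apply sqnorm_ge; auto. }
    replace (RtoC 0) with c; auto.
    assert (forall z, sqnorm (fun k => U k - z * h k)%C = sqnorm U - 2 * Re (z * c)%C + Cmod z * Cmod z * sqnorm h) as EX.
    { intros z.
      assert (is_lim_seq (fun N => Re (z * csum (fun k => Cconj (U k) * h k) N)%C) (Finite (Re (z * c)%C))) as L1.
      { apply is_lim_seq_spec. intros e. destruct (clim_scal z _ _ hcc e (cond_pos e)) as [N hN]. exists N. intros n hn.
        specialize (hN n hn). eapply Rle_lt_trans; [|apply hN]. eapply Rle_trans; [|apply Re_le_Cmod]. right. f_equal. }
      pose proof (is_lim_seq_plus' _ _ _ _ (is_lim_seq_minus' _ _ _ _ (sqnorm_lim U hUL) (is_lim_seq_scal_l _ 2 _ L1))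
        (is_lim_seq_scal_l _ (Cmod z * Cmod z) _ (sqnorm_lim h hhL))) as K. simpl Rbar_mult in K. 
      apply is_lim_seq_unique in K. unfold sqnorm at 1.
      rewrite (Lim_seq_ext _ (fun n => sqsum U n - 2 * Re (z * csum (fun k => Cconj (U k) * h k) n)%C + Cmod z * Cmod z * sqsum h n)).
      - rewrite K. simpl. unfold Re. ring.
      - intros n. rewrite <- sqsum_scal. unfold sqsum.
        rewrite <- csum_scal, Re_csum.
        rewrite <- rsum_scal. 
        transitivity (rsum (fun k => Cmod (U k) * Cmod (U k) + (-1) * (2 * Re (z * (Cconj (U k) * h k))%C) + Cmod (z * h k) * Cmod (z * h k)) n).
        + apply rsum_ext. intros k _. rewrite !Cmod_sqr. simpl. unfold Re, Im. ring.
        + rewrite !rsum_plus, (rsum_scal (-1)). ring. }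
    apply Cmod_small_0. intros eps he.
    assert (0 <= sqnorm h) as hn0 by (eapply Rle_trans; [|apply (sqnorm_ge _ 0); auto]; unfold sqsum; simpl; lra).
    set (t := / (sqnorm h + 1)). assert (0 < t) as ht by (apply Rinv_0_lt_compat; lra).
    pose proof (hge _ (hscal (RtoC t * Cconj c)%C h hh)) as K. cbv beta in K; rewrite EX in K.
    assert (Re (RtoC t * Cconj c * c)%C = t * (Cmod c * Cmod c)) as E1 by (rewrite Cmod_sqr; simpl; unfold Re, Im; ring).
    assert (Cmod (RtoC t * Cconj c)%C = t * Cmod c) as E2 by (rewrite Cmod_mult, Cmod_conj, Cmod_R, Rabs_pos_eq; lra).
    rewrite E1, E2 in K.
    assert (t * sqnorm h <= 1).
    { unfold t. apply Rmult_le_reg_l with (sqnorm h + 1); [lra|]. rewrite <- Rmult_assoc, Rinv_r; lra. }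
    pose proof (Cmod_ge_0 c). set (q := Cmod c * Cmod c) in *. assert (0 <= q) by apply sq_pos.
    assert (t * Cmod c * (t * Cmod c) * sqnorm h <= t * q).
    { replace (t * Cmod c * (t * Cmod c) * sqnorm h) with (t * q * (t * sqnorm h)) by (unfold q; ring).
      rewrite <- (Rmult_1_r (t * q)) at 2. apply Rmult_le_compat_l; auto. apply Rmult_le_pos; lra. }
    assert (q <= 0) by nra. unfold q in H3. assert (Cmod c <= 0) by nra. lra.
Qed.

(** * Dirichlet series with square-summable coefficients *)

Definition abs_conv (b : nat -> C) : Prop :=
  forall sg, 1 / 2 < sg -> exists B, forall N, rsum (fun k => Cmod (b k) * npw sg k) N <= B.

Definition Dser (b : nat -> C) (s : C) : C := epsilon (inhabits (RtoC 0)) (clim (fun N => dsum b N s)).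

Lemma L2_abs_conv a : L2 a -> abs_conv a.
Proof.
  intros [B hB] sg hs. exists (B + 2 * sg / (2 * sg - 1)). intros N.
  eapply Rle_trans; [apply (rsum_le _ (fun k => Cmod (a k) * Cmod (a k) + npw (2 * sg) k))|].
  - intros k _. replace (2 * sg) with (sg + sg) by ring. rewrite npw_plus. pose proof (npw_pos sg k). pose proof (Cmod_ge_0 (a k)). nra.
  - rewrite rsum_plus. apply Rplus_le_compat; [apply hB|]. apply npw_sum. lra.
Qed.

Lemma abs_conv_ln c b : abs_conv b -> abs_conv (fun k => RtoC (c * lnS k) * b k)%C.
Proof.
  intros hb sg hs. set (e := (sg - 1 / 2) / 2). assert (0 < e) as he by (unfold e; lra).
  destruct (hb (sg - e)) as [B hB]; [unfold e; lra|].
  exists (Rabs c * / e * B). intros N.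
  assert (0 <= Rabs c * / e) by (apply Rmult_le_pos; [apply Rabs_pos|left; apply Rinv_0_lt_compat; auto]).
  eapply Rle_trans; [|apply Rmult_le_compat_l; [auto|apply (hB N)]]. rewrite <- rsum_scal. apply rsum_le. intros k _.
  rewrite Cmod_mult, Cmod_R, Rabs_mult, (Rabs_pos_eq (lnS k)) by apply lnS_pos.
  assert (lnS k <= / e * npw (- e) k) as L.
  { unfold lnS, npw. rewrite Ropp_involutive. apply ln_le_Rpower; auto. apply INR_S_pos. }
  replace sg with (e + (sg - e)) at 1 by ring. rewrite npw_plus.
  assert (npw (- e) k * npw e k = 1) as E1.
  { rewrite <- npw_plus. replace (- e + e) with 0 by ring. unfold npw. rewrite Ropp_0, Rpower_O; auto. apply INR_S_pos. }
  pose proof (npw_pos e k). pose proof (npw_pos (sg - e) k). pose proof (Cmod_ge_0 (b k)). pose proof (Rabs_pos c).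
  assert (lnS k * npw e k <= / e).
  { apply Rle_trans with (/ e * npw (- e) k * npw e k); [apply Rmult_le_compat_r; lra|]. rewrite Rmult_assoc, E1. lra. }
  replace (Rabs c * lnS k * Cmod (b k) * (npw e k * npw (sg - e) k)) with (Rabs c * (Cmod (b k) * npw (sg - e) k) * (lnS k * npw e k)) by ring.
  replace (Rabs c * / e * (Cmod (b k) * npw (sg - e) k)) with (Rabs c * (Cmod (b k) * npw (sg - e) k) * / e) by ring.
  apply Rmult_le_compat_l; auto. apply Rmult_le_pos; auto. apply Rmult_le_pos; lra.
Qed.

Lemma Dser_spec b s : abs_conv b -> 1 / 2 < Re s -> clim (fun N => dsum b N s) (Dser b s).
Proof.
  intros hb hs. unfold Dser. apply epsilon_spec. destruct (hb (Re s) hs) as [B hB].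
  apply (csum_cauchy _ (fun k => Cmod (b k) * npw (Re s) k) B); auto.
  intros k. rewrite Cmod_mult, Cmod_Cexp_lnS. lra.
Qed.

(** Termwise differentiation, with the quadratic bound for the exponential in each term. *)
Lemma Dser_derive b s : abs_conv b -> 1 / 2 < Re s -> cderq (Dser b) s (Dser (fun k => RtoC (-1 * lnS k) * b k)%C s).
Proof.
  intros hb hs. set (dl := (Re s - 1 / 2) / 2). assert (0 < dl) as hdl by (unfold dl; lra).
  pose proof (abs_conv_ln (-1) b hb) as hb1.
  destruct (abs_conv_ln (-1) _ hb1 (Re s - dl)) as [B hB]; [unfold dl; lra|].
  exists (4 * B), dl. split; auto. split.
  { specialize (hB 0%nat). simpl in hB. lra. }
  intros w hw. set (h := (w - s)%C) in *.
  assert (1 / 2 < Re w) as hw2.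
  { pose proof (Re_le_Cmod h) as T. apply Rabs_le_between in T.
    assert (Re h = Re w - Re s) as e by (unfold h; simpl; unfold Re; ring). unfold dl in hw. lra. }
  apply clim_le with (u := fun N => (dsum b N w + (- (1)) * dsum b N s + (- h) * dsum (fun k => RtoC (-1 * lnS k) * b k)%C N s)%C).
  - replace (Dser b w - Dser b s - Dser (fun k => RtoC (-1 * lnS k) * b k)%C s * h)%C
      with (Dser b w + - (1) * Dser b s + - h * Dser (fun k => RtoC (-1 * lnS k) * b k)%C s)%C by ring.
    apply clim_plus; [apply clim_plus; [apply Dser_spec; auto|apply clim_scal, Dser_spec; auto]|]. apply clim_scal, Dser_spec; auto.
  - exists 0%nat. intros N _. unfold dsum. rewrite <- !csum_scal, <- !csum_plus.
    replace (4 * B * (Cmod h * Cmod h)) with (4 * (Cmod h * Cmod h) * B) by ring.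
    eapply Rle_trans; [|apply Rmult_le_compat_l; [pose proof (sq_pos h); lra|apply (hB N)]]. rewrite <- rsum_scal.
    apply Cmod_csum_le. intros k _.
    set (v := (RtoC (- lnS k) * h)%C).
    assert (Cexp (RtoC (- lnS k) * w) = Cexp (RtoC (- lnS k) * s) * Cexp v)%C as E.
    { rewrite <- Cexp_add. f_equal. unfold v, h. ring. }
    rewrite E.
    replace (RtoC (-1 * lnS k)) with (RtoC (- lnS k)) by (f_equal; ring).
    replace (b k * (Cexp (RtoC (- lnS k) * s) * Cexp v) + - (1) * (b k * Cexp (RtoC (- lnS k) * s)) + - h * (RtoC (- lnS k) * b k * Cexp (RtoC (- lnS k) * s)))%C
      with (b k * Cexp (RtoC (- lnS k) * s) * (Cexp v - 1 - v))%C by (unfold v; ring).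
    rewrite !Cmod_mult, Cmod_Cexp_lnS, Cmod_R, Rabs_Ropp, Rabs_pos_eq by apply lnS_pos.
    pose proof (Cexp_quad v) as Q.
    assert (Cmod v = lnS k * Cmod h) as Ev by (unfold v; rewrite Cmod_mult, Cmod_R, Rabs_Ropp, Rabs_pos_eq; auto; apply lnS_pos).
    rewrite Ev in Q.
    assert (exp (lnS k * Cmod h) <= npw (- dl) k) as Ee.
    { unfold npw, Rpower. fold (lnS k). apply exp_le. pose proof (lnS_pos k). nra. }
    replace (Re s - dl) with (Re s + - dl) by ring. rewrite npw_plus.
    pose proof (lnS_pos k). pose proof (npw_pos (Re s) k). pose proof (Cmod_ge_0 (b k)).
    assert (Cmod (Cexp v - 1 - v) <= 4 * (lnS k * Cmod h * (lnS k * Cmod h)) * npw (- dl) k).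
    { eapply Rle_trans; [apply Q|]. apply Rmult_le_compat_l; auto. pose proof (Cmod_ge_0 h). nra. }
    apply Rle_trans with (Cmod (b k) * npw (Re s) k * (4 * (lnS k * Cmod h * (lnS k * Cmod h)) * npw (- dl) k)).
    + apply Rmult_le_compat_l; auto. apply Rmult_le_pos; lra.
    + right. ring.
Qed.

Lemma Dser_iter b i : abs_conv b -> abs_conv (fun k => RtoC ((-1 * lnS k) ^ i) * b k)%C /\
  forall s, 1 / 2 < Re s -> Nat.iter i C_derive (Dser b) s = Dser (fun k => RtoC ((-1 * lnS k) ^ i) * b k)%C s.
Proof.
  intros hb.
  induction i as [|i [IH1 IH2]].
  - replace (fun k => RtoC ((-1 * lnS k) ^ 0) * b k)%C with b; auto.
    apply functional_extensionality. intros. simpl. ring.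
  - replace (fun k => RtoC ((-1 * lnS k) ^ S i) * b k)%C with (fun k => RtoC (-1 * lnS k) * (RtoC ((-1 * lnS k) ^ i) * b k))%C.
    2: { apply functional_extensionality. intros k. simpl pow. rewrite (RtoC_mult (-1 * lnS k) ((-1 * lnS k) ^ i)). ring. }
    split; [apply abs_conv_ln; auto|]. intros s hs. simpl Nat.iter.
    rewrite (C_derive_local _ (Dser (fun k => RtoC ((-1 * lnS k) ^ i) * b k)%C)).
    + apply cderq_C_derive. apply Dser_derive; auto.
    + exists (Re s - 1 / 2). split; [lra|]. intros w hw. apply IH2.
      pose proof (Re_le_Cmod (w - s)) as T. apply Rabs_le_between in T. simpl in T. unfold Re in *. lra.
Qed.

Lemma rsum_tail (u v : nat -> R) K M : (K <= M)%nat -> (forall k, (k < K)%nat -> u k <= 0) -> (forall k, (K <= k)%nat -> u k <= v k) ->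
  rsum u M <= rsum v M - rsum v K.
Proof.
  intros h h0 h1. induction h.
  - assert (rsum u K <= rsum (fun _ => 0 * 0) K) as E by (apply rsum_le; intros; rewrite Rmult_0_l; auto).
    rewrite rsum_scal in E. lra.
  - simpl. specialize (h1 m h). lra.
Qed.

(** The norm of H^p with p < 2 is at most that of H^2, so the partial sums form a Cauchy sequence. *)
Lemma L2_in_Hp p a : 1 <= p < 2 -> L2 a -> in_Hp p (Dser a).
Proof.
  intros hp ha. exists (fun n => a (pred n)). split.
  - set (P := fun k => DirichletPoly k (fun n => a (pred n))). exists P.
    assert (forall k n, dp_coef (P k) (S n) = if (n <? k)%nat then a n else RtoC 0) as hco.
    { intros k n. unfold dp_coef, P; simpl dp_deg; simpl dp_seq.
      destruct (Nat.ltb_spec n k), (Nat.leb_spec (S n) k); simpl; auto; lia. }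
    split.
    + intros eps he. pose proof (sqnorm_lim a ha) as L. apply is_lim_seq_spec in L. simpl in L.
      assert (0 < eps / 2 * (eps / 2)) as he2 by nra.
      destruct (L (mkposreal _ he2)) as [K hK]. simpl in hK. exists K. intros k l hk hl.
      apply Rle_lt_trans with (eps / 2); [|lra]. apply Hp_norm_le; auto; [lra|].
      unfold psq. set (M := dp_deg (dp_minus (P k) (P l))).
      assert (K <= M)%nat as hM by (unfold M; simpl; lia).
      apply Rle_lt_trans with (sqsum a M - sqsum a K).
      * apply rsum_tail; auto.
        -- intros n hn. rewrite dp_coef_minus, !hco. replace (n <? k)%nat with true by (symmetry; apply Nat.ltb_lt; lia).
           replace (n <? l)%nat with true by (symmetry; apply Nat.ltb_lt; lia).
           replace (a n - a n)%C with (RtoC 0) by ring. rewrite Cmod_0. lra.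
        -- intros n hn. rewrite dp_coef_minus, !hco. pose proof (sq_pos (a n)).
           destruct (n <? k)%nat, (n <? l)%nat.
           ++ replace (a n - a n)%C with (RtoC 0) by ring. rewrite Cmod_0. lra.
           ++ replace (a n - 0)%C with (a n) by ring. lra.
           ++ replace (0 - a n)%C with (- a n)%C by ring. rewrite Cmod_opp. lra.
           ++ replace (0 - 0)%C with (RtoC 0) by ring. rewrite Cmod_0. lra.
      * specialize (hK K (le_n _)). apply Rabs_def2 in hK. pose proof (sqnorm_ge a M ha). lra.
    + intros n hn. destruct n as [|n]; [lia|]. apply clim_filterlim. intros eps he. exists (S n). intros k hk.
      rewrite hco. replace (n <? k)%nat with true by (symmetry; apply Nat.ltb_lt; lia). simpl pred.
      replace (a n - a n)%C with (RtoC 0) by ring. rewrite Cmod_0. auto.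
  - intros s hs. apply is_series_clim. unfold in_half_plane in hs.
    eapply clim_ext; [|apply (Dser_spec a s (L2_abs_conv a ha) hs)].
    intros n. apply csum_ext. intros k _. rewrite npow_opp_exp. reflexivity.
Qed.

(** * Sufficiency of the Blaschke condition *)

Fixpoint exponents (Z : point_seq) (n : nat) : list C :=
  match n with
  | O => nil
  | S m => match Z m with Some s => (s - RtoC (1 / 2))%C :: exponents Z m | None => exponents Z m end
  end.

Lemma exponents_mono Z n m h : (n <= m)%nat -> expoly (exponents Z n) h -> expoly (exponents Z m) h.
Proof.
  intros hnm hh. induction hnm; auto. simpl. destruct (Z m); auto. apply expoly_cons; auto.
Qed.

Lemma exponents_count Z s : forall n js, NoDup js -> (forall j, In j js -> (j < n)%nat /\ Z j = Some s) ->
  (length js <= count_occ Ceq_dec (exponents Z n) (s - RtoC (1 / 2))%C)%nat.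
Proof.
  induction n; intros js hn hj.
  - destruct js as [|j js]; simpl; auto. destruct (hj j (or_introl eq_refl)). lia.
  - destruct (in_dec Nat.eq_dec n js) as [hi|hi].
    + destruct (hj n hi) as [_ hZ]. simpl exponents. rewrite hZ. simpl. destruct (Ceq_dec _ _) as [_|ne]; [|congruence].
      apply in_split in hi. destruct hi as (l1 & l2 & ->). apply NoDup_remove in hn as [hn hni].
      assert (length (l1 ++ l2) <= count_occ Ceq_dec (exponents Z n) (s - RtoC (1 / 2))%C)%nat.
      { apply IHn; auto. intros j hj'. assert (j <> n) by (intros ->; auto).
        destruct (hj j); [|split; auto; lia]. apply in_app_iff in hj'. apply in_app_iff. simpl. tauto. }
      rewrite length_app in *. simpl. lia.
    + assert (length js <= count_occ Ceq_dec (exponents Z n) (s - RtoC (1 / 2))%C)%nat.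
      { apply IHn; auto. intros j hj'. assert (j <> n) by (intros ->; auto). destruct (hj j hj'). split; auto. lia. }
      simpl. destruct (Z n) as [s'|]; auto. simpl. destruct (Ceq_dec _ _); lia.
Qed.

Lemma expoly_sample_L2 l h : (forall lam, In lam l -> 0 < Re lam) -> expoly l h -> L2 (sample h).
Proof.
  intros hl hh. destruct (expoly_decay l hl h hh) as (k & M & hk & hM & B).
  exists (M * M * ((1 + 2 * k) / (1 + 2 * k - 1))). intros N.
  eapply Rle_trans; [|apply Rmult_le_compat_l; [nra|apply (npw_sum (1 + 2 * k) N); lra]].
  rewrite <- rsum_scal. apply rsum_le. intros j _. rewrite sample_sqr, npw_plus, npw_1.
  specialize (B (lnS j) (lnS_pos j)).
  assert (exp (- (k * lnS j)) * exp (- (k * lnS j)) = npw (2 * k) j) as E.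
  { rewrite <- exp_plus. unfold npw, Rpower. f_equal. unfold lnS. ring. }
  rewrite <- E. pose proof (Rinv_0_lt_compat _ (INR_S_pos j)). pose proof (Cmod_ge_0 (h (lnS j))).
  assert (Cmod (h (lnS j)) * Cmod (h (lnS j)) <= M * exp (- (k * lnS j)) * (M * exp (- (k * lnS j)))) by (apply Rmult_le_compat; auto).
  replace (M * M * (/ INR (S j) * (exp (- (k * lnS j)) * exp (- (k * lnS j))))) with (/ INR (S j) * (M * exp (- (k * lnS j)) * (M * exp (- (k * lnS j))))) by ring.
  apply Rmult_le_compat_l; lra.
Qed.

Lemma sample_monexp i s k : sample (monexp i (s - RtoC (1 / 2))) k = (RtoC (lnS k ^ i) * Cexp (RtoC (- lnS k) * s))%C.
Proof.
  unfold sample, monexp.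
  assert (RtoC (Rpower (INR (S k)) (- (1 / 2))) = Cexp (RtoC (- lnS k) * RtoC (1 / 2)))%C as E.
  { unfold Cexp. simpl. replace (- lnS k * 0 + 0 * (1 / 2)) with 0 by ring. rewrite cos_0, sin_0.
    replace (- lnS k * (1 / 2) - 0 * 0) with (- (1 / 2) * ln (INR (S k))) by (unfold lnS; simpl; ring).
    unfold Rpower. csolve. }
  rewrite E.
  transitivity (RtoC (lnS k ^ i) * (Cexp (RtoC (- lnS k) * RtoC (1 / 2)) * Cexp (- (s - RtoC (1 / 2)) * RtoC (lnS k))))%C; [ring|].
  rewrite <- Cexp_add. f_equal. f_equal. rewrite RtoC_opp. ring.
Qed.

(** The sequences (ln n)^i n^{-s_j} are the samples of exponential polynomials. Since the sample at n = 1 is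
    controlled by those far out, uniformly in the number of exponents, the first unit vector dl has
    positive distance from their span; a vector orthogonal to the span gives the coefficients. *)
Lemma sufficiency p Z : 1 <= p < 2 -> all_points Z in_half_plane -> bounded_points Z ->
  ex_sum_over Z (fun s => Re s - 1 / 2) -> Hp_zero_seq p Z.
Proof.
  intros hp hZ [M hM] hsum.
  assert (forall j, 0 <= match Z j with Some s => Re s - 1 / 2 | None => 0 end) as hpos.
  { intros j. destruct (Z j) as [s|] eqn:E; [|lra]. pose proof (hZ j s E) as K. unfold in_half_plane in K. lra. }
  destruct (ex_series_bound _ hpos hsum) as [B hB].
  assert (0 <= B) as hB0 by (specialize (hB 0%nat); simpl in hB; auto).
  set (Lam := Rabs M + 1). assert (0 <= Lam) as hLam by (unfold Lam; pose proof (Rabs_pos M); lra).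
  assert (forall n lam, In lam (exponents Z n) -> 0 < Re lam /\ Cmod lam <= Lam) as hexp.
  { induction n; simpl; [tauto|]. intros lam. destruct (Z n) as [s|] eqn:E; [|apply IHn].
    intros [<-|hi]; [|apply IHn; auto]. pose proof (hZ n s E) as K. unfold in_half_plane in K. pose proof (hM n s E). split.
    - simpl. unfold Re in *. lra.
    - eapply Rle_trans; [apply Cmod_tri_minus|]. rewrite Cmod_R, (Rabs_pos_eq (1 / 2)) by lra. unfold Lam. pose proof (Rle_abs M). lra. }
  assert (forall n, rho_of (exponents Z n) <= 2 * B) as hrho.
  { intros n. apply Rle_trans with (2 * rsum (fun j => match Z j with Some s => Re s - 1 / 2 | None => 0 end) n).
    - induction n; simpl; [lra|]. destruct (Z n); simpl; [|lra]. unfold Re, Rminus in *. lra.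
    - specialize (hB n). lra. }
  destruct (sample_bound Lam (2 * B) hLam ltac:(lra)) as (K & hK & N & hN & SB).
  set (V := fun g : nat -> C => exists n h, expoly (exponents Z n) h /\ g = sample h).
  set (dl := fun k : nat => if (k =? 0)%nat then RtoC 1 else RtoC 0).
  assert (L2 dl) as hdl.
  { exists 1. intros n. set (w := fun k => Cmod (dl k) * Cmod (dl k)). change (rsum w n <= 1).
    assert (w 0%nat = 1) as w0 by (unfold w, dl; simpl; rewrite Cmod_1; ring).
    assert (forall k, w (S k) = 0) as wS by (intros k; unfold w, dl; simpl; rewrite Cmod_0; ring).
    assert (forall m, rsum w (S m) <= 1) as hw.
    { induction m as [|m IH]; [simpl; lra|]. change (rsum w (S m) + w (S m) <= 1). rewrite wS. lra. }
    destruct n; [simpl; lra|apply hw]. }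
  destruct (orthogonal_vector V dl (/ (2 * (1 + K)))) as (a & ha & hane & horth).
  - intros g (n & h & hh & ->). apply expoly_sample_L2 with (exponents Z n); auto. intros lam hl. apply (hexp n lam hl).
  - exists (sample (fun _ => RtoC 0)), 0%nat, (fun _ => RtoC 0). split; auto. intros y; auto.
  - intros f g (n & h & hh & ->) (m & h' & hh' & ->). exists (Nat.max n m), (fun y => h y + h' y)%C. split.
    + apply expoly_plus; [apply exponents_mono with n; auto; lia|apply exponents_mono with m; auto; lia].
    + apply functional_extensionality. intros k. unfold sample. ring.
  - intros c g (n & h & hh & ->). exists n, (fun y => c * h y)%C. split; [apply expoly_scal; auto|].
    apply functional_extensionality. intros k. unfold sample. ring.
  - auto.
  - apply Rinv_0_lt_compat. lra.
  - intros g (n & h & hh & ->). set (D := sqnorm (fun k => dl k - sample h k)%C).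
    assert (L2 (sample h)) as hsL.
    { apply expoly_sample_L2 with (exponents Z n); auto. intros lam hl. apply (hexp n lam hl). }
    assert (L2 (fun k => dl k - sample h k)%C) as hL by (apply L2_minus; auto).
    assert (sample h 0 = h 0) as s0.
    { unfold sample, lnS. simpl INR. rewrite ln_1. unfold Rpower. rewrite ln_1, Rmult_0_r, exp_0. ring. }
    assert (Cmod (1 - h 0) * Cmod (1 - h 0) <= D) as h1.
    { pose proof (sqnorm_ge _ 1 hL) as G. unfold sqsum in G. simpl in G. unfold dl at 1 2 in G. simpl in G. rewrite s0 in G. unfold D. lra. }
    assert (Cmod (h 0) * Cmod (h 0) <= K * D) as h2.
    { apply (SB (exponents Z n) h D (hexp n) (hrho n) hh). intros M' hM'.
      eapply Rle_trans; [|apply (sqnorm_ge _ M' hL)].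
      assert (forall m, (N <= m)%nat -> sqsum (sample h) m - sqsum (sample h) N <= sqsum (fun k => dl k - sample h k)%C m) as T.
      { intros m hm. unfold sqsum. induction hm as [|m hm IH].
        - pose proof (rsum_pos (fun k => Cmod (dl k - sample h k) * Cmod (dl k - sample h k)) N (fun k => sq_pos _)). lra.
        - simpl. replace (dl m - sample h m)%C with (- sample h m)%C.
          + rewrite Cmod_opp. lra.
          + unfold dl. replace (m =? 0)%nat with false by (symmetry; apply Nat.eqb_neq; lia). ring. }
      apply T. auto. }
    pose proof (Cmod_triangle (1 - h 0) (h 0)) as T. replace (1 - h 0 + h 0)%C with (RtoC 1) in T by ring. rewrite Cmod_1 in T.
    pose proof (Cmod_ge_0 (1 - h 0)). pose proof (Cmod_ge_0 (h 0)).
    assert (1 <= 2 * (1 + K) * D).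
    { set (x := Cmod (1 - h 0)) in *. set (y := Cmod (h 0)) in *.
      assert (1 <= (x + y) * (x + y)) by nra. assert ((x + y) * (x + y) <= 2 * (x * x) + 2 * (y * y)).
      { pose proof (Rle_0_sqr (x - y)) as Q. unfold Rsqr in Q. lra. }
      lra. }
    apply Rmult_le_reg_l with (2 * (1 + K)); [lra|]. rewrite Rinv_r by lra. auto.
  - pose proof (L2_abs_conv a ha) as hac.
    exists (Dser a). split; [apply L2_in_Hp; auto|]. split.
    + destruct (nonvanishing_right a (Dser a)) as (s1 & hs1 & hne); auto.
      { intros s hs. apply Dser_spec; auto. }
      exists (s1, 0). split; [unfold in_half_plane; simpl; lra|]. apply hne. simpl. lra.
    + intros s js hn hj i hi.
      assert (1 / 2 < Re s) as hs.
      { destruct js as [|j js]; [simpl in hi; lia|]. apply (hZ j s), hj. simpl; auto. }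
      destruct (Dser_iter a i hac) as [hci hit]. rewrite hit by auto.
      apply clim_unique with (u := fun N => dsum (fun k => RtoC ((-1 * lnS k) ^ i) * a k)%C N s); [apply Dser_spec; auto|].
      replace (RtoC 0) with (RtoC ((-1) ^ i) * 0)%C by ring.
      apply clim_ext with (u := fun N => (RtoC ((-1) ^ i) * csum (fun k => a k * sample (monexp i (s - RtoC (1 / 2))) k)%C N)%C).
      * intros n. rewrite <- csum_scal. apply csum_ext. intros k _. rewrite sample_monexp, Rpow_mult_distr, RtoC_mult. ring.
      * apply clim_scal. apply horth. exists (S (list_max js)), (monexp i (s - RtoC (1 / 2))). split; auto.
        apply monexp_expoly. eapply Nat.lt_le_trans; [exact hi|]. apply exponents_count; auto.
        intros j hji. split; auto.
        pose proof (proj1 (list_max_le js (list_max js)) (le_n _)) as F. rewrite Forall_forall in F. specialize (F j hji). lia.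
Qed.

Theorem mainTheorem2 (p : R) (Z : point_seq)
  (hp : 1 <= p < 2)
  (hZ : all_points Z in_half_plane)
  (hbdd : bounded_points Z) :
  (ex_sum_over Z (fun s => Re s - 1 / 2) -> Hp_zero_seq p Z)
  /\
  (Hp_zero_seq p Z ->
   forall eps : R, 0 < eps ->
     ex_sum_over Z (fun s => Rpower (Re s - 1 / 2) (1 + eps)))
  /\
  (forall t0 c : R, 0 < c -> all_points Z (in_cone t0 c) ->
   (Hp_zero_seq p Z <-> ex_sum_over Z (fun s => Re s - 1 / 2))).
Proof.
  assert (forall f, in_Hp p f -> nontrivial f -> vanishes_on f Z ->
    (forall eps, 0 < eps -> ex_sum_over Z (fun s => Rpower (Re s - 1 / 2) (1 + eps))) /\
    forall t0 c, 0 < c -> all_points Z (in_cone t0 c) -> ex_sum_over Z (fun s => Re s - 1 / 2)) as nec.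
  { intros f hf hnt hv. destruct (Hp_function p f hp hf hnt) as (hA & (G & hG0 & hG) & (s1 & hs1 & hne)).
    destruct hbdd as [M hM].
    assert (all_points Z (fun s => Cmod s <= Rabs M)) as hM'.
    { intros j s E. eapply Rle_trans; [apply (hM j s E)|apply Rle_abs]. }
    pose proof (Rabs_pos M). split.
    - apply (necessity_eps Z f G s1 (Rabs M)); auto.
    - intros t0 c. apply (necessity_cone Z f G s1 (Rabs M)); auto. }
  split; [|split].
  - apply sufficiency; auto.
  - intros (f & hf & hnt & hv). apply (nec f hf hnt hv).
  - intros t0 c hc hcone. split.
    + intros (f & hf & hnt & hv). apply (proj2 (nec f hf hnt hv) t0 c hc hcone).
    + apply sufficiency; auto.
Qed.
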